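(* Let $n\ge 2$, let $\mathfrak g=A^{(2)}_{2n}$ or $\mathfrak g=D^{(2)}_{n+1}$, let $l,k\in\mathbb Z_{\ge1}$, and let $B_l,B_k$ be the $U_q'(\mathfrak g)$ crystals defined in the context. Given $b_1\otimes b_2\in B_l\otimes B_k$, let $\tilde b_2\otimes\tilde b_1\in B_{2k}\otimes B_{2l}$ (tensor product of $U_q'(C^{(1)}_n)$ crystals) and $l',k',m\in\mathbb Z_{\ge 0}$ be obtained from $b_1\otimes b_2$ by the Rule described in the context. Let $\iota:B_l\otimes B_k\to B_k\otimes B_l$ be the isomorphism of $U_q'(\mathfrak g)$ crystals, and let $H_{B_lB_k}$ be the energy function on $B_l\otimes B_k$, normalized as in the context. Then $\tilde b_2\otimes\tilde b_1$ lies in the image of $B_k\otimes B_l$ under the injective map $\omega$ (where $\omega(c\otimes d)=\omega(c)\otimes\omega(d)$), and $$\iota(b_1\otimes b_2)=\omega^{-1}(\tilde b_2\otimes\tilde b_1),\qquad H_{B_lB_k}(b_1\otimes b_2)=\min(l',k')-m .$$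
   Context: **Crystals.** A crystal with index set $I=\{0,1,\dots,n\}$ is a finite set $B$ with maps $\tilde e_i,\tilde f_i:B\sqcup\{0\}\to B\sqcup\{0\}$ ($i\in I$), $\tilde e_i0=\tilde f_i0=0$, such that for $b,b'\in B$, $\tilde f_ib=b'$ iff $\tilde e_ib'=b$. Put $\varepsilon_i(b)=\max\{m\ge0:\tilde e_i^m b\ne0\}$, $\varphi_i(b)=\max\{m\ge0:\tilde f_i^m b\neq0\}$. The crystal $B\otimes B'$ is the set $B\times B'$ with $\tilde e_i(b\otimes b')=\tilde e_ib\otimes b'$ if $\varphi_i(b)\ge\varepsilon_i(b')$ and $b\otimes\tilde e_ib'$ otherwise; $\tilde f_i(b\otimes b')=\tilde f_ib\otimes b'$ if $\varphi_i(b)>\varepsilon_i(b')$ and $b\otimes\tilde f_ib'$ otherwise ($0\otimes b'=b\otimes0=0$). An isomorphism of crystals is a bijection commuting with all $\tilde e_i,\tilde f_i$, $i\in I$. For the crystals below it is known that $B_l\otimes B_k$ is connected and that there is a unique isomorphism $\iota:B_l\otimes B_k\to B_k\otimes B_l$. **Energy function.** $H=H_{B_lB_k}:B_l\otimes B_k\to\mathbb Z$ is determined up to a global additive constant by: whenever $\tilde e_i(b\otimes b')\ne0$, writing $\iota(b\otimes b')=\tilde b'\otimes\tilde b$, $H(\tilde e_i(b\otimes b'))-H(b\otimes b')$ equals $+1$ if $i=0$, $\varphi_0(b)\ge\varepsilon_0(b')$ and $\varphi_0(\tilde b')\ge\varepsilon_0(\tilde b)$; equals $-1$ if $i=0$,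 $\varphi_0(b)<\varepsilon_0(b')$ and $\varphi_0(\tilde b')<\varepsilon_0(\tilde b)$; equals $0$ otherwise. Normalization: $H(b_1\otimes b_2)=0$ when $b_1$ has $x_1=l$ and all other coordinates $0$, and $b_2$ has $\bar x_1=k$ and all other coordinates $0$. **The crystals.** In all formulas only changed coordinates are indicated, and the result is $0$ if it is not in the set. $A^{(2)}_{2n}$: $B_l=\{(x_1,\dots,x_n,\bar x_n,\dots,\bar x_1): x_i,\bar x_i\in\mathbb Z_{\ge0},\ \sum_i(x_i+\bar x_i)\le l\}$. $\tilde e_0$: $x_1\mapsto x_1-1$ if $x_1>\bar x_1$; $\bar x_1\mapsto\bar x_1+1$ if $x_1\le\bar x_1$. $\tilde f_0$: $x_1\mapsto x_1+1$ if $x_1\ge\bar x_1$; $\bar x_1\mapsto\bar x_1-1$ if $x_1<\bar x_1$. For $1\le i\le n-1$, $\tilde e_i$: $(x_i,x_{i+1})\mapsto(x_i+1,x_{i+1}-1)$ if $x_{i+1}>\bar x_{i+1}$; $(\bar x_{i+1},\bar x_i)\mapsto(\bar x_{i+1}+1,\bar x_i-1)$ if $x_{i+1}\le\bar x_{i+1}$. $\tilde f_i$: $(x_i,x_{i+1})\mapsto(x_i-1,x_{i+1}+1)$ if $x_{i+1}\ge\bar x_{i+1}$; $(\bar x_{i+1},\bar x_i)\mapsto(\bar x_{i+1}-1,\bar x_i+1)$ if $x_{i+1}<\bar x_{i+1}$. $\tilde e_n$: $(x_n,\bar x_n)\mapsto(x_n+1,\bar x_n-1)$; $\tilde f_n$: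 $(x_n,\bar x_n)\mapsto(x_n-1,\bar x_n+1)$. $D^{(2)}_{n+1}$: $B_l=\{(x_1,\dots,x_n,x_\circ,\bar x_n,\dots,\bar x_1): x_\circ\in\{0,1\},\ x_i,\bar x_i\in\mathbb Z_{\ge0},\ x_\circ+\sum_i(x_i+\bar x_i)\le l\}$, with $\tilde e_i,\tilde f_i$ for $0\le i\le n-1$ as for $A^{(2)}_{2n}$, and $\tilde e_n$: $(x_\circ,\bar x_n)\mapsto(1,\bar x_n-1)$ if $x_\circ=0$; $(x_n,x_\circ)\mapsto(x_n+1,0)$ if $x_\circ=1$. $\tilde f_n$: $(x_n,x_\circ)\mapsto(x_n-1,1)$ if $x_\circ=0$; $(x_\circ,\bar x_n)\mapsto(0,\bar x_n+1)$ if $x_\circ=1$. $C^{(1)}_n$: as a set $B_{l'}=\{(x_1,\dots,x_n,\bar x_n,\dots,\bar x_1):x_i,\bar x_i\in\mathbb Z_{\ge0},\ \sum_i(x_i+\bar x_i)\in\{l',l'-2,l'-4,\dots\}\}$ (only the set is needed here). **The map $\omega$** from the $U_q'(\mathfrak g)$ crystal $B_l$ to the $U_q'(C^{(1)}_n)$ crystal $B_{2l}$: for $A^{(2)}_{2n}$ it doubles all coordinates; for $D^{(2)}_{n+1}$, $\omega(x_1,\dots,x_n,x_\circ,\bar x_n,\dots,\bar x_1)=(2x_1,\dots,2x_{n-1},2x_n+x_\circ,2\bar x_n+x_\circ,2\bar x_{n-1},\dots,2\bar x_1)$. **Tableaux.** Letters: $0<1<\dots<n<\bar n<\dots<\bar1<\bar0$.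 For $b'=(x_1,\dots,\bar x_1)$ in the $C^{(1)}_n$ crystal $B_{l'}$, $\mathbb T(b')$ is the weakly increasing one-row tableau of length $l'$ with $x_i$ letters $i$, $\bar x_i$ letters $\bar i$ ($1\le i\le n$), and $\frac12(l'-\sum_i(x_i+\bar x_i))$ letters $0$ and equally many letters $\bar0$. **Type $C$ column insertion.** Write $(a)$ for a one-box column and $(a|b)$ for a column with top entry $a$, bottom entry $b$. ''$c\to K\Rightarrow K';\,d$'' means: inserting letter $c$ in column $K$ turns it into $K'$ and bumps out $d$, which is then inserted into the next column on the right. Here $\alpha,\beta,\gamma$ are arbitrary letters and $x\in\{0,\dots,n\}$. A0: $\alpha\to\emptyset\Rightarrow(\alpha)$, nothing bumped (stop). A1: $\beta\to(\alpha)\Rightarrow(\alpha|\beta)$, nothing bumped (stop), if $\alpha<\beta$. B0: $\alpha\to(\beta)\Rightarrow(\alpha);\beta$ if $\alpha\le\beta$. B1: $\beta\to(\alpha|\gamma)\Rightarrow(\alpha|\beta);\gamma$ if $\alpha<\beta\le\gamma$ and $(\alpha,\gamma)\ne(x,\bar x)$ for all $x$. B2: $\alpha\to(\beta|\gamma)\Rightarrow(\alpha|\gamma);\beta$ if $\alpha\le\beta<\gamma$ and $(\alpha,\gamma)\neq(x,\bar x)$ for all $x$. B3: $\beta\to(x|\bar x)\Rightarrow(x-1|\beta);\overline{x-1}$ if $x\le\beta\le\bar x$, $x\ne0$. B4: $x\to(\beta|\bar x)\Rightarrow(x+1|\overline{x+1});\beta$ if $x<\beta<\bar x$, $x\ne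 n$. To insert a letter into a tableau $T$ (written $c\longrightarrow T$), insert it in the leftmost column and continue to the right until A0 or A1 occurs. **Inverse column insertion.** It starts at the rightmost box of a row: this box is removed and its letter is inversely inserted into the column to its left, which changes and expels a letter to be inversely inserted into the next column to the left, and so on; the letter expelled from the leftmost column is the letter bumped out of the tableau (if the removed box is in the leftmost column, its letter is itself bumped out). The elementary inverse steps are B0–B4 read backwards: inversely inserting $d$ into $K'$ gives $K$ and expels $c$ whenever $c\to K\Rightarrow K';d$ is an instance of B0–B4. **Rule.** Let $z$ be the minimum of the numbers of letters $0$ in $\mathbb T(\omega(b_1))$ and in $\mathbb T(\omega(b_2))$. Remove $z$ letters $0$ and $z$ letters $\bar0$ from $\mathbb T(\omega(b_1))$, obtaining a one-row tableau $T_*$ of length $l'=2l-2z$, and from $\mathbb T(\omega(b_2))$, obtaining the row $v_1\le\dots\le v_{k'}$ with $k'=2k-2z$. Let $T^{(0)}=(v_1\longrightarrow(\cdots(v_{k'-1}\longrightarrow(v_{k'}\longrightarrow T_* ))\cdots))$. Only the listed cases occur, and $T^{(0)}$ has at most two rows; let $m$ be the length of its second row, so its first row has length $l'+k'-m$. Now perform $l'$ successive inverse column insertions: the first $l'-m$ start at the current rightmost box of the first row, the last $m$ start at the current rightmost box of the second row. Let $w_1,w_2,\dots,w_{l'}$ be the letters successively bumped out (they satisfy $w_1\le\cdots\le w_{l'}$) and let $T^{(l')}$ be the remaining one-row tableau of length $k'$. Then $\tilde b_2\in B_{2k}$ and $\tilde b_1\in B_{2l}$ are the $C^{(1)}_n$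 crystal elements such that $\mathbb T(\tilde b_2)$ consists of $z$ letters $0$, then $T^{(l')}$, then $z$ letters $\bar0$, and $\mathbb T(\tilde b_1)$ consists of $z$ letters $0$, then $w_1,\dots,w_{l'}$, then $z$ letters $\bar0$. *)

(* Defs.v *)
From HB Require Import structures.
From mathcomp Require Import all_boot all_order all_algebra zify.

Set Implicit Arguments.
Unset Strict Implicit.
Unset Printing Implicit Defensive.

Import Order.TTheory GRing.Theory Num.Theory.

(** * Crystals with index set I = {0, ..., n} *)

(* The element 0 adjoined to a crystal is None. [crystal_axiom] is kept apart
   from the data, so that the tensor product can be formed without proof. *)
Record crystal (n : nat) := Crystal {
  crystal_sort :> finType;
  et : 'I_n.+1 -> crystal_sort -> option crystal_sort;
  ft : 'I_n.+1 -> crystal_sort -> option crystal_sort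
}.
Arguments et {n c} i b : rename.
Arguments ft {n c} i b : rename.

Definition crystal_axiom n (B : crystal n) : Prop :=
  forall (i : 'I_n.+1) (b b' : B), ft i b = Some b' <-> et i b' = Some b.

(* In a finite crystal a string without repetition has at most #|B| elements,
   so the maximum of all m with et^m b <> 0 is attained at some m < #|B|. *)
Definition eps n (B : crystal n) (i : 'I_n.+1) (b : B) : nat :=
  \max_(m < #|B| | isSome (iter m (obind (et i)) (Some b))) m.

Definition phi n (B : crystal n) (i : 'I_n.+1) (b : B) : nat :=
  \max_(m < #|B| | isSome (iter m (obind (ft i)) (Some b))) m.

Definition tensor n (B B' : crystal n) : crystal n :=
  @Crystal n (B * B')%type
    (fun i p => if eps i p.2 <= phi i p.1
                then omap (fun c => (c, p.2)) (et i p.1)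
                else omap (fun c => (p.1, c)) (et i p.2))
    (fun i p => if eps i p.2 < phi i p.1
                then omap (fun c => (c, p.2)) (ft i p.1)
                else omap (fun c => (p.1, c)) (ft i p.2)).

Definition crystal_iso n (B B' : crystal n) (h : B -> B') : Prop :=
  [/\ bijective h,
      forall i b, et i (h b) = omap h (et i b)
    & forall i b, ft i (h b) = omap h (ft i b)].

(** * Energy functions *)

(* The increment of the energy function along [et i] at p, given q = iota p. *)
Definition energy_step n (B B' : crystal n) (i : 'I_n.+1)
    (p : tensor B B') (q : tensor B' B) : int :=
  if i != ord0 then 0%R
  else if (eps i p.2 <= phi i p.1) && (eps i q.2 <= phi i q.1) then 1%R
  else if (phi i p.1 < eps i p.2) && (phi i q.1 < eps i q.2) then (- 1)%R
  else 0%R.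

Definition energy_function n (B B' : crystal n)
    (iota : tensor B B' -> tensor B' B) (H : tensor B B' -> int) : Prop :=
  forall (i : 'I_n.+1) (p p' : tensor B B'),
    et i p = Some p' -> (H p' - H p = energy_step i p (iota p))%R.

(** * Coordinates *)

(* The coordinate x_i (1 <= i <= n) is the value at the element i - 1 of 'I_n.
   Coordinates are integers, so that an operator is given by its formula and
   the result is then discarded (with insub) if it is not in the set. *)
Definition vec (n : nat) : Type := {ffun 'I_n -> int}.

(* x_i, with i counted from 1 *)
Definition coordv n (x : vec n) (i : nat) : int := oapp x 0%R (insub i.-1).

(* x_i |-> x_i + d, with i counted from 1 *)
Definition shift n (i : nat) (d : int) (x : vec n) : vec n :=
  [ffun j : 'I_n => if j.+1 == i then (x j + d)%R else x j].

(* x = (l, 0, ..., 0) *)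
Definition vec_first n (l : nat) : vec n :=
  [ffun j : 'I_n => if val j == 0%N then l%:Z else 0]%R.

Definition vec0 n : vec n := [ffun _ => 0%R].

(* ((x_1, ..., x_n), (xbar_1, ..., xbar_n)) *)
Definition vec2 (n : nat) : Type := (vec n * vec n)%type.

Definition nonneg n (p : vec2 n) : bool :=
  [forall j, (0 <= p.1 j)%R && (0 <= p.2 j)%R].

Definition csum n (p : vec2 n) : int := (\sum_j (p.1 j + p.2 j))%R.

(** * The operators, on arbitrary integer coordinates *)

Definition e_lt n (i : nat) (p : vec2 n) : vec2 n :=
  let: (x, y) := p in
  if i == 0 then
    if (coordv y 1 < coordv x 1)%R then (shift 1 (-1)%R x, y)
    else (x, shift 1 1%R y)
  else
    if (coordv y i.+1 < coordv x i.+1)%R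
    then (shift i.+1 (-1)%R (shift i 1%R x), y)
    else (x, shift i.+1 1%R (shift i (-1)%R y)).

Definition f_lt n (i : nat) (p : vec2 n) : vec2 n :=
  let: (x, y) := p in
  if i == 0 then
    if (coordv y 1 <= coordv x 1)%R then (shift 1 1%R x, y)
    else (x, shift 1 (-1)%R y)
  else
    if (coordv y i.+1 <= coordv x i.+1)%R
    then (shift i.+1 1%R (shift i (-1)%R x), y)
    else (x, shift i.+1 (-1)%R (shift i 1%R y)).

Definition eA n (i : nat) (p : vec2 n) : vec2 n :=
  if i == n then (shift n 1%R p.1, shift n (-1)%R p.2) else e_lt i p.

Definition fA n (i : nat) (p : vec2 n) : vec2 n :=
  if i == n then (shift n (-1)%R p.1, shift n 1%R p.2) else f_lt i p.

(* In type D the second component is the coordinate x_o in {0, 1}. *)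
Definition eD n (i : nat) (q : vec2 n * bool) : vec2 n * bool :=
  let: (p, o) := q in
  if i == n then
    if o then ((shift n 1%R p.1, p.2), false)
    else ((p.1, shift n (-1)%R p.2), true)
  else (e_lt i p, o).

Definition fD n (i : nat) (q : vec2 n * bool) : vec2 n * bool :=
  let: (p, o) := q in
  if i == n then
    if o then ((p.1, shift n 1%R p.2), false)
    else ((shift n (-1)%R p.1, p.2), true)
  else (f_lt i p, o).

(** * The sets B_l *)

Definition inA n (l : nat) : pred (vec2 n) :=
  fun p => nonneg p && (csum p <= l%:Z)%R.
Definition inD n (l : nat) : pred (vec2 n * bool) :=
  fun q => nonneg q.1 && ((q.2 : nat)%:Z + csum q.1 <= l%:Z)%R.
Definition inC n (l : nat) : pred (vec2 n) :=
  fun p => [&& nonneg p, (csum p <= l%:Z)%R & (2 %| (l%:Z - csum p)%R)%Z].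

Record Aset (n l : nat) := Aelt { Aval : vec2 n; _ : inA l Aval }.
Record Dset (n l : nat) := Delt { Dval : vec2 n * bool; _ : inD l Dval }.
Record Cset (n l : nat) := Celt { Cval : vec2 n; _ : inC l Cval }.

HB.instance Definition _ n l := [isSub for @Aval n l].
HB.instance Definition _ n l := [isSub for @Dval n l].
HB.instance Definition _ n l := [isSub for @Cval n l].
HB.instance Definition _ n l := [Countable of Aset n l by <:].
HB.instance Definition _ n l := [Countable of Dset n l by <:].
HB.instance Definition _ n l := [Countable of Cset n l by <:].

Section Finiteness.
Variables n l : nat.

Definition code (p : vec2 n) : {ffun 'I_n -> 'I_l.+1} * {ffun 'I_n -> 'I_l.+1} :=
  ([ffun j => inord `|p.1 j|%N], [ffun j => inord `|p.2 j|%N]).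
Definition decode (c : {ffun 'I_n -> 'I_l.+1} * {ffun 'I_n -> 'I_l.+1}) : vec2 n :=
  ([ffun j => Posz (c.1 j)], [ffun j => Posz (c.2 j)]).

Fact codeK p : inA l p -> decode (code p) = p.
Proof.
case: p => x y /andP[/forallP nn tot]; rewrite /decode /code /=.
have bnd j : (x j <= l%:Z)%R /\ (y j <= l%:Z)%R.
  have xy0 i : (0 <= x i + y i)%R by have /andP[? ?] := nn i; apply: addr_ge0.
  have le : (x j + y j <= l%:Z)%R.
    apply: le_trans tot; rewrite /csum /= (bigD1 j) //= lerDl.
    exact: sumr_ge0.
  have /andP[x0 y0] := nn j.
  by split; apply: le_trans le; rewrite ?lerDl ?lerDr.
by congr pair; apply/ffunP=> j; rewrite !ffunE; have /andP[/= x0 y0] := nn j;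
  have [xl yl] := bnd j; rewrite inordK ?gez0_abs // ltnS -lez_nat gez0_abs.
Qed.

Definition codeA (b : Aset n l) := code (val b).
Definition decodeA c : option (Aset n l) := insub (decode c).
Fact codeAK : pcancel codeA decodeA.
Proof. by move=> b; rewrite /decodeA codeK ?valK //; case: b. Qed.
HB.instance Definition _ := isFinite.Build (Aset n l) (pcan_enumP codeAK).

Definition codeD (b : Dset n l) := (code (val b).1, (val b).2).
Definition decodeD c : option (Dset n l) := insub (decode c.1, c.2).
Fact codeDK : pcancel codeD decodeD.
Proof.
move=> b; rewrite /decodeD codeK /= -?surjective_pairing ?valK //.
case: b => -[p o] /= /andP[nn tot]; rewrite /inA nn.
by apply: le_trans tot; rewrite lerDr.
Qed.
HB.instance Definition _ := isFinite.Build (Dset n l) (pcan_enumP codeDK).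

End Finiteness.

(** * The crystals B_l of type A^(2)_2n and D^(2)_(n+1) *)

Definition crystalA (n l : nat) : crystal n :=
  @Crystal n (Aset n l) (fun i b => insub (eA i (val b)))
                        (fun i b => insub (fA i (val b))).
Definition crystalD (n l : nat) : crystal n :=
  @Crystal n (Dset n l) (fun i b => insub (eD i (val b)))
                        (fun i b => insub (fD i (val b))).

(* A2 is A^(2)_2n, D2 is D^(2)_(n+1). *)
Inductive affine_type := A2 | D2.

Definition Bl (g : affine_type) (n l : nat) : crystal n :=
  match g with A2 => crystalA n l | D2 => crystalD n l end.

Section CrystalAxiom.
Variables n l : nat.

Let shiftK i (d d' : int) : (d + d' = 0)%R ->
  cancel (@shift n i d) (shift i d').
Proof.
by move=> dd x; apply/ffunP=> j; rewrite !ffunE; case: eqP; rewrite // -addrA dd addr0.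
Qed.

Let shiftC i i' d d' (x : vec n) :
  shift i d (shift i' d' x) = shift i' d' (shift i d x).
Proof.
by apply/ffunP=> j; rewrite !ffunE; do 2!case: eqP => //; rewrite addrAC.
Qed.

Let coord_shift i d (x : vec n) : 0 < i <= n ->
  coordv (shift i d x) i = (coordv x i + d)%R.
Proof.
case: i => // i /andP[_ iln]; rewrite /coordv /=.
by rewrite insubT /= ffunE /= eqxx.
Qed.

Let coord_shiftN i i' d (x : vec n) : 0 < i' -> i' != i ->
  coordv (shift i d x) i' = coordv x i'.
Proof.
case: i' => // i' _ ne; rewrite /coordv /=; case: insubP => //= j _ jE.
by rewrite ffunE jE (negPf ne).
Qed.

Let e_ltK i : i < n -> cancel (@e_lt n i) (f_lt i).
Proof.
move=> iln [x y]; rewrite /e_lt /f_lt; have SN : i.+1 != i by rewrite eqn_leq ltnn.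
have n0 : 0 < 1 <= n by exact: leq_ltn_trans iln.
case: (i =P 0) => [_|_].
  case: ltrP => h.
    by rewrite coord_shift // lerBrDr lezD1 h shiftK.
  by rewrite coord_shift // lezD1 ltNge h /= shiftK.
case: ltrP => h.
  rewrite coord_shift // coord_shiftN // lerBrDr lezD1 h.
  by rewrite shiftC shiftK // shiftC shiftK.
rewrite coord_shift // coord_shiftN // lezD1 ltNge h /=.
by rewrite shiftC shiftK // shiftC shiftK.
Qed.

Let f_ltK i : i < n -> cancel (@f_lt n i) (e_lt i).
Proof.
move=> iln [x y]; rewrite /e_lt /f_lt; have SN : i.+1 != i by rewrite eqn_leq ltnn.
have n0 : 0 < 1 <= n by exact: leq_ltn_trans iln.
case: (i =P 0) => [_|_].
  case: lerP => h; rewrite coord_shift //.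
    by rewrite ltzD1 h shiftK.
  by rewrite ltrBlDr ltzD1 leNgt h /= shiftK.
case: lerP => h; rewrite coord_shift // coord_shiftN //.
  by rewrite ltzD1 h shiftC shiftK // shiftC shiftK.
by rewrite ltrBlDr ltzD1 leNgt h /= shiftC shiftK // shiftC shiftK.
Qed.

Let insub_axiom T (P : pred T) (sT : subType P) (e f : T -> T) (b b' : sT) :
  cancel e f -> cancel f e ->
  insub (f (val b)) = Some b' <-> insub (e (val b')) = Some b.
Proof.
move=> eK fK; split.
  case: insubP => // u _ uE [<-].
  by rewrite [val u]uE fK valK.
case: insubP => // u _ uE [<-].
by rewrite [val u]uE eK valK.
Qed.

Lemma crystalA_axiom : crystal_axiom (crystalA n l).
Proof.
have lt (i : 'I_n.+1) : (i == n :> nat) = false -> i < n.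
  by move=> iN; rewrite ltn_neqAle iN -ltnS ltn_ord.
move=> i b b'; apply: insub_axiom => p; rewrite /eA /fA; case iN: (i == n :> nat).
- by case: p => x y; rewrite ?iN /= ?shiftK.
- by rewrite ?iN e_ltK ?lt.
- by case: p => x y; rewrite ?iN /= ?shiftK.
- by rewrite ?iN f_ltK ?lt.
Qed.

Lemma crystalD_axiom : crystal_axiom (crystalD n l).
Proof.
have lt (i : 'I_n.+1) : (i == n :> nat) = false -> i < n.
  by move=> iN; rewrite ltn_neqAle iN -ltnS ltn_ord.
move=> i b b'; apply: insub_axiom => -[p o]; rewrite /eD /fD; case iN: (i == n :> nat).
- by case: p o => [x y] [] /=; rewrite ?iN /= ?shiftK.
- by rewrite ?iN e_ltK ?lt.
- by case: p o => [x y] [] /=; rewrite ?iN /= ?shiftK.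
- by rewrite ?iN f_ltK ?lt.
Qed.

End CrystalAxiom.

Lemma Bl_axiom g n l : crystal_axiom (Bl g n l).
Proof. by case: g; [apply: crystalA_axiom | apply: crystalD_axiom]. Qed.

(** * The two elements that normalize the energy function *)

Section Extremal.
Variables n l : nat.

Let sum_first : (\sum_(j < n) vec_first n l j <= l%:Z)%R.
Proof.
case: n => [|n']; first by rewrite big_ord0.
rewrite big_ord_recl big1 => [|j _]; last by rewrite ffunE.
by rewrite ffunE addr0.
Qed.

Let first_ge0 j : (0 <= vec_first n l j)%R.
Proof. by rewrite ffunE; case: ifP. Qed.

Fact inA_first : inA l (vec_first n l, vec0 n).
Proof.
apply/andP; split; first by apply/forallP=> j /=; rewrite first_ge0 ffunE.
rewrite /csum (eq_bigr (vec_first n l)) // => j _.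
by rewrite /= [vec0 n j]ffunE addr0.
Qed.

Fact inA_first_bar : inA l (vec0 n, vec_first n l).
Proof.
apply/andP; split; first by apply/forallP=> j /=; rewrite first_ge0 ffunE.
rewrite /csum (eq_bigr (vec_first n l)) // => j _.
by rewrite /= [vec0 n j]ffunE add0r.
Qed.

Fact inD_first : inD l ((vec_first n l, vec0 n), false).
Proof. by rewrite /inD add0r; apply: inA_first. Qed.

Fact inD_first_bar : inD l ((vec0 n, vec_first n l), false).
Proof. by rewrite /inD add0r; apply: inA_first_bar. Qed.

End Extremal.

(* x_1 = l and all other coordinates are 0 *)
Definition b_first (g : affine_type) (n l : nat) : Bl g n l :=
  match g return Bl g n l with
  | A2 => Aelt (inA_first n l)
  | D2 => Delt (inD_first n l)
  end.

(* xbar_1 = l and all other coordinates are 0 *)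
Definition b_first_bar (g : affine_type) (n l : nat) : Bl g n l :=
  match g return Bl g n l with
  | A2 => Aelt (inA_first_bar n l)
  | D2 => Delt (inD_first_bar n l)
  end.

(** * The map omega *)

Definition vec_double n (x : vec n) : vec n := [ffun j => (x j *+ 2)%R].

Definition omega_vecA n (p : vec2 n) : vec2 n := (vec_double p.1, vec_double p.2).
Definition omega_vecD n (q : vec2 n * bool) : vec2 n :=
  (shift n (q.2 : nat)%:Z%R (vec_double q.1.1),
   shift n (q.2 : nat)%:Z%R (vec_double q.1.2)).

Section OmegaProofs.
Variables n l : nat.

Fact omegaA_subproof (b : Aset n l) : inC (2 * l) (omega_vecA (val b)).
Proof.
case: b => -[x y] /= /andP[/forallP nn tot].
have E : csum (omega_vecA (x, y)) = (2 * csum (x, y))%R.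
  rewrite /csum mulr_sumr; apply: eq_bigr => j _ /=.
  by rewrite !ffunE mulr_natl mulrnDl.
rewrite /inC E PoszM -mulrBr dvdz_mulr // ler_pM2l // andbT.
rewrite [X in _ && X]tot andbT; apply/forallP=> j /=.
by rewrite !ffunE !mulrn_wge0 //; have /andP[] := nn j.
Qed.

Fact omegaD_subproof (b : Dset n l) : inC (2 * l) (omega_vecD (val b)).
Proof.
case: b => -[[x y] o] /= /andP[/forallP nn tot].
pose c : int := (\sum_(j < n) (if j.+1 == n then (o : nat)%:Z else 0%R))%R.
have E : csum (omega_vecD ((x, y), o)) = (2 * (c + csum (x, y)))%R.
  rewrite /csum /c -big_split /= mulr_sumr; apply: eq_bigr => j _ /=.
  rewrite !ffunE !mulr2n mulrDl !mul1r.
  case: eqP => _; last by rewrite !add0r addrACA.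
  by rewrite addrACA (addrACA (x j)) [in RHS]addrACA addrC.
have cle : (c <= (o : nat)%:Z)%R.
  rewrite /c; case: n => [|n']; first by rewrite big_ord0.
  rewrite big_ord_recr big1 => [|j _] /=; first by rewrite eqxx add0r.
  by rewrite eqSS ltn_eqF ?ltn_ord.
rewrite /inC E PoszM -mulrBr dvdz_mulr // ler_pM2l // andbT.
rewrite [X in _ && X](le_trans _ tot) ?lerD2r // andbT; apply/forallP=> j /=.
have /andP[/= x0 y0] := nn j; rewrite !ffunE.
by case: eqP => _; rewrite ?addr_ge0 ?mulrn_wge0.
Qed.

End OmegaProofs.

Definition omega (g : affine_type) (n l : nat) : Bl g n l -> Cset n (2 * l) :=
  match g return Bl g n l -> Cset n (2 * l) with
  | A2 => fun b => Celt (omegaA_subproof b)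
  | D2 => fun b => Celt (omegaD_subproof b)
  end.
Arguments omega {g n l} b.

Lemma omega_inj (g : affine_type) (n l : nat) : 0 < n ->
  injective (@omega g n l).
Proof.
have dblK (x y : vec n) : vec_double x = vec_double y -> x = y.
  move=> /ffunP E; apply/ffunP=> j; have := E j; rewrite !ffunE => /eqP.
  by rewrite eqrMn2r => /eqP.
move=> n0; case: g => -[p ip] [q iq] /(congr1 val) /= E; apply: val_inj => /=; clear ip iq.
  by case: p q E => x y [x' y'] [/dblK -> /dblK ->].
case: p q E => -[x y] o [[x' y'] o']; rewrite /omega_vecD /= => -[Ex Ey].
have oE : o = o'.
  have ln : n.-1 < n by rewrite prednK.
  have /ffunP/(_ (Ordinal ln)) := Ex; rewrite !ffunE /= prednK // eqxx.
  by case: o o' {Ex Ey} => [] [] //; lia.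
have shift_inj d : injective (@shift n n d).
  move=> u v /ffunP E; apply/ffunP=> j; have := E j; rewrite !ffunE.
  by case: eqP => _ // /addIr.
by move: Ex Ey; rewrite oE => /shift_inj/dblK -> /shift_inj/dblK ->.
Qed.

(* omega (c (x) d) = omega c (x) omega d *)
Definition omega2 (g : affine_type) (n l k : nat)
    (p : tensor (Bl g n l) (Bl g n k)) : Cset n (2 * l) * Cset n (2 * k) :=
  (omega p.1, omega p.2).
Arguments omega2 {g n l k} p.

(** * Letters, columns and tableaux *)

(* 0 < 1 < ... < n < nbar < ... < 1bar < 0bar is 'I_(2n + 2) with its natural
   order; the unbarred letters are the elements <= n, and the bar is rev_ord. *)
Definition letter (n : nat) : finType := 'I_n.*2.+2.
Definition ub n (x : nat) : letter n := inord x.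
Definition br n (x : nat) : letter n := rev_ord (ub n x).

Definition bar_pair n (a c : letter n) : Prop :=
  exists2 x : nat, x <= n & (a, c) = (ub n x, br n x).

(* A column is listed from top to bottom, and a tableau is given as the sequence of its
   columns from left to right. *)
Definition column (n : nat) : Type := seq (letter n).
Definition tableau (n : nat) : Type := seq (column n).

Definition one_row n (r : seq (letter n)) : tableau n := [seq [:: a] | a <- r].

Definition second_row_length n (T : tableau n) : nat :=
  count (fun K => 1 < size K) T.

(* The weakly increasing word of the one-row tableau T(b) *)
Definition row_word n L (b : Cset n L) : seq (letter n) :=
  let: (x, y) := val b in
  let z := `|(L%:Z - csum (x, y))%R|%N./2 in
  nseq z (ub n 0)
  ++ flatten [seq nseq `|x j|%N (ub n j.+1) | j : 'I_n <- enum 'I_n]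
  ++ flatten [seq nseq `|y j|%N (br n j.+1) | j : 'I_n <- rev (enum 'I_n)]
  ++ nseq z (br n 0).

(** * Column insertion *)

(* insA c K K': the insertion c -> K => K' stops (A0, A1). *)
Inductive insA n : letter n -> column n -> column n -> Prop :=
| InsA0 (a : letter n) : insA a [::] [:: a]
| InsA1 (a b : letter n) of a < b : insA b [:: a] [:: a; b].

(* insB c K K' d: the insertion c -> K => K' bumps out d (B0, ..., B4). *)
Inductive insB n : letter n -> column n -> column n -> letter n -> Prop :=
| InsB0 (a b : letter n) of a <= b :
    insB a [:: b] [:: a] b
| InsB1 (a b c : letter n) of a < b <= c & ~ bar_pair a c :
    insB b [:: a; c] [:: a; b] c
| InsB2 (a b c : letter n) of a <= b < c & ~ bar_pair a c :
    insB a [:: b; c] [:: a; c] b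
| InsB3 (x : nat) (b : letter n) of x <= n & ub n x <= b <= br n x & x != 0 :
    insB b [:: ub n x; br n x] [:: ub n x.-1; b] (br n x.-1)
| InsB4 (x : nat) (b : letter n) of x <= n & ub n x < b < br n x & x != n :
    insB (ub n x) [:: b; br n x] [:: ub n x.+1; br n x.+1] b.

(* insert c T T': the insertion c --> T gives T'. *)
Inductive insert n : letter n -> tableau n -> tableau n -> Prop :=
| InsertNew c K' of insA c [::] K' : insert c [::] [:: K']
| InsertStop c K K' T of insA c K K' : insert c (K :: T) (K' :: T)
| InsertBump c K K' d T T' of insB c K K' d & insert d T T' :
    insert c (K :: T) (K' :: T').

(* v_1 --> (... (v_s --> T)) = T' *)
Inductive insert_word n : seq (letter n) -> tableau n -> tableau n -> Prop :=
| InsertNil T : insert_word [::] T T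
| InsertCons v vs T T1 T2 of insert_word vs T T1 & insert v T1 T2 :
    insert_word (v :: vs) T T2.

(** * Inverse column insertion *)

(* inv_cols T d T' w: d, coming from the right, is inversely inserted into the
   columns of T from right to left, giving T', and w is finally expelled. *)
Inductive inv_cols n : tableau n -> letter n -> tableau n -> letter n -> Prop :=
| InvNil d : inv_cols [::] d [::] d
| InvCons K K' T T' d c w of inv_cols T d T' c & insB w K K' c :
    inv_cols (K' :: T) d (K :: T') w.

Inductive row_index := Row1 | Row2.

(* inv_insert s T w T': inverse insertion starting at the rightmost box of the
   row s of T bumps out w and leaves T'. *)
Inductive inv_insert n : row_index -> tableau n -> letter n -> tableau n -> Prop :=
| InvRow1 T T' d w of inv_cols T d T' w :
    inv_insert Row1 (rcons T [:: d]) w T'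
| InvRow2 T T' R a d w of inv_cols T d T' w & second_row_length R = 0 :
    inv_insert Row2 (T ++ [:: a; d] :: R) w (T' ++ [:: a] :: R).

(* inv_inserts s T ws T': successive inverse insertions starting at the rows
   listed in s bump out the letters of ws, in this order. *)
Inductive inv_inserts n :
    seq row_index -> tableau n -> seq (letter n) -> tableau n -> Prop :=
| InvDone T : inv_inserts [::] T [::] T
| InvStep s ss T T1 T2 w ws of inv_insert s T w T1 & inv_inserts ss T1 ws T2 :
    inv_inserts (s :: ss) T (w :: ws) T2.

(** * The Rule *)

Definition count0 n (r : seq (letter n)) : nat := count_mem (ub n 0) r.

Definition remove0 n (z : nat) (r : seq (letter n)) : seq (letter n) :=
  iter z (rem (ub n 0)) (iter z (rem (br n 0)) r).

Definition pad0 n (z : nat) (r : seq (letter n)) : seq (letter n) :=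
  nseq z (ub n 0) ++ r ++ nseq z (br n 0).

(* With c1 = omega b_1, c2 = omega b_2, L = 2l and K = 2k, the Rule yields
   c2' (x) c1' and the numbers l', k' and m. It is a relation because insertion
   is given by its rules. *)
Definition Rule n L K (c1 : Cset n L) (c2 : Cset n K)
    (c2' : Cset n K) (c1' : Cset n L) (l' k' m : nat) : Prop :=
  let z := minn (count0 (row_word c1)) (count0 (row_word c2)) in
  [/\ l' = L - 2 * z, k' = K - 2 * z &
      exists (T0 : tableau n) (w r : seq (letter n)),
        [/\ insert_word (remove0 z (row_word c2))
                       (one_row (remove0 z (row_word c1))) T0,
            m = second_row_length T0,
            inv_inserts (nseq (l' - m) Row1 ++ nseq m Row2) T0 w (one_row r),
            row_word c2' = pad0 z r
          & row_word c1' = pad0 z w]].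

(* Main.v *)
Require Import Defs.
From mathcomp Require Import all_boot all_order all_algebra zify.

(* The derivation rules of the insertions are preserved by all the lowering
   operators of type C_(n+1) on words, applied through the signature rule: if a
   rule rewrites the word u into v, then f_j u and f_j v are related by the same
   kind of rule. Hence the pairs of words related by the Rule are stable under
   every f_j, and starting from words in the two letters 0 and 1, where the
   insertions are trivial, one reaches the image under omega of every classical
   highest weight element of B_l (x) B_k.
   On the other side, the isomorphism and the energy at such an element follow
   from one e_0-string, which ends at an element of the form
   (1bar^l) (x) (x_1, x_2, xbar_1), itself connected by f_1, ..., f_n to an element
   whose image is known by weights. Both sides agree at the highest weight
   elements and are propagated along f_1, ..., f_n, each of which acts on the
   words of omega as the first or second power of its type C counterpart. *)

Set Implicit Arguments.
Unset Strict Implicit.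
Unset Printing Implicit Defensive.

Import Order.TTheory GRing.Theory Num.Theory.

(** * Words and the signature rule *)

(** Two different operators have index 0. Node 0 of type C_(n+1) sends 0 to 1 and 1bar to 0bar and
    is compatible with the insertions. The affine [et ord0] trades two letters 1 for a pair 0, 0bar,
    or such a pair for two letters 1bar, and has no counterpart on the side of the insertions. This
    is why the two sides are compared only at classical highest weight elements: there the first
    operator computes the Rule, the second one computes [iota] and [H], and [hw_arith] matches the
    two sets of integers.

    All insertion rules keep the number of letters, so a tableau can be recovered from its reading
    word and its shape. The shape is constant along every lowering path, hence so is [m], which
    depends on it alone. Inverse insertion is the same relation read backwards, so one simulation
    argument serves both directions.

    The removal of the [z] common pairs 0, 0bar leaves one of the two rows without 0. For such
    highest weight words the starting word of the path contains only the letters 0 and 1. *)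

Section Signature.
Variables (T : Type) (ph ep : pred T) (fl : T -> T).

(* The signature rule for letters in which ep and ph count at most one: epw, phw
   and fw are epsilon, phi and the lowering operator on words, read as tensor
   products. *)
Fixpoint epw (w : seq T) : nat :=
  if w is a :: w' then ep a + (epw w' - ph a) else 0.
Fixpoint phw (w : seq T) : nat :=
  if w is a :: w' then phw w' + (ph a - epw w') else 0.
Fixpoint fw (w : seq T) : seq T :=
  if w is a :: w' then
    if epw w' < ph a then fl a :: w' else a :: fw w'
  else [::].

Lemma size_fw w : size (fw w) = size w.
Proof. by elim: w => //= a w IH; case: ifP => //= _; rewrite IH. Qed.

Lemma size_iter_fw k w : size (iter k fw w) = size w.
Proof. by elim: k => //= k IH; rewrite size_fw. Qed.

Lemma epw_cat u v : epw (u ++ v) = epw u + (epw v - phw u).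
Proof. by elim: u => [|a u IH] /=; [lia | rewrite IH; lia]. Qed.

Lemma phw_cat u v : phw (u ++ v) = phw v + (phw u - epw v).
Proof. by elim: u => [|a u IH] /=; [lia | rewrite IH epw_cat; lia]. Qed.

Lemma fw_cat u v :
  fw (u ++ v) = if epw v < phw u then fw u ++ v else u ++ fw v.
Proof.
elim: u => [|a u IH] //=; rewrite IH epw_cat.
by do ![case: ifP => //]; lia.
Qed.

Hypothesis ph_ep : forall a, ph a -> ep a = false.
Hypothesis ph_fl : forall a, ph a -> ph (fl a) = false.
Hypothesis ep_fl : forall a, ph a -> ep (fl a).

Lemma epw_fw w : 0 < phw w -> epw (fw w) = (epw w).+1.
Proof.
elim: w => //= a w IH; case pa: (ph a); last first.
  by rewrite ltn0 /= pa => h; rewrite IH; lia.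
case: (ltnP (epw w)) => h /= h'; first by rewrite ph_fl // ep_fl // (ph_ep pa); lia.
by rewrite pa (ph_ep pa) IH; lia.
Qed.

Lemma phw_fw w : 0 < phw w -> phw (fw w) = (phw w).-1.
Proof.
elim: w => //= a w IH; case pa: (ph a); last first.
  by rewrite ltn0 /= pa => h; rewrite IH; lia.
case: (ltnP (epw w)) => h /= h'; first by rewrite (ph_fl pa); lia.
by rewrite pa IH ?epw_fw; lia.
Qed.

Lemma phw_iter k w : k <= phw w -> phw (iter k fw w) = phw w - k.
Proof. by elim: k => [|k IH] h /=; [lia | rewrite phw_fw IH; lia]. Qed.

Lemma epw_iter k w : k <= phw w -> epw (iter k fw w) = epw w + k.
Proof. by elim: k => [|k IH] h /=; [lia | rewrite epw_fw ?phw_iter ?IH; lia]. Qed.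

(** While the operator acts on [u], [phw u] decreases and [epw v] stays; once it has passed to [v],
    [epw v] grows. So it never returns to [u], and the steps on [u] come before those on [v]. *)
Lemma iter_fw_cat k u v : k <= phw (u ++ v) ->
  let k1 := minn k (phw u - epw v) in
  iter k fw (u ++ v) = iter k1 fw u ++ iter (k - k1) fw v.
Proof.
rewrite phw_cat; elim: k => [|k IH] h /=; first by rewrite min0n.
rewrite IH ?fw_cat; last by lia.
rewrite epw_iter ?phw_iter; [|lia|lia].
case: ltnP => h'.
  have -> : minn k.+1 (phw u - epw v) = (minn k (phw u - epw v)).+1 by lia.
  by rewrite subSS.
have -> : minn k.+1 (phw u - epw v) = minn k (phw u - epw v) by lia.
by rewrite subSn // geq_minl.
Qed.

Lemma phw_nseq m a : phw (nseq m a) = if ph a then m else 0.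
Proof.
have e0 : ph a -> forall i, epw (nseq i a) = 0.
  by move=> pa; elim=> //= i ->; rewrite (ph_ep pa) pa.
elim: m => /= [|m IH]; first by case: ifP.
by rewrite IH; case pa: (ph a); [rewrite e0 // addn1 | lia].
Qed.

Lemma epw_nseq m a : epw (nseq m a) = if ep a then m else 0.
Proof.
elim: m => /= [|m IH]; first by case: ifP.
rewrite IH; case ea: (ep a); last by lia.
by case pa: (ph a); [move: ea; rewrite (ph_ep pa) | lia].
Qed.

Lemma iter_fw_nseq k m a : ph a -> k <= m ->
  iter k fw (nseq m a) = nseq k (fl a) ++ nseq (m - k) a.
Proof.
move=> pa; elim: k => [|k IH] h /=; first by rewrite subn0.
rewrite IH ?(ltnW h) // fw_cat phw_nseq (ph_fl pa) ltn0.
have -> : m - k = (m - k.+1).+1 by lia.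
rewrite /= epw_nseq (ph_ep pa) pa /=.
by move: (nseq (m - k.+1) a) => x; elim: k {IH h} => //= k ->.
Qed.

End Signature.

(** Transports words of letters to words of natural numbers, where the rules become linear
    arithmetic. The equation on [fl] is asked only where a letter is lowered, because [fll] wraps
    around at the last letter. *)
Lemma map_fw (T T' : Type) (g : T' -> T) (ph ep : pred T) (fl : T -> T)
    (fl' : T' -> T') (w : seq T') : (forall a, ph (g a) -> g (fl' a) = fl (g a)) ->
  [/\ epw (ph \o g) (ep \o g) w = epw ph ep (map g w),
      phw (ph \o g) (ep \o g) w = phw ph ep (map g w)
    & map g (fw (ph \o g) (ep \o g) fl' w) = fw ph ep fl (map g w)].
Proof.
move=> gfl; have E v : epw (ph \o g) (ep \o g) v = epw ph ep (map g v).
  by elim: v => //= a v ->.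
split=> //; elim: w => //= a w IH; rewrite E //; first by rewrite IH.
case: ifP => h /=; last by rewrite IH.
by rewrite gfl //; case: (ph (g a)) h.
Qed.

Ltac ord_lia :=
  repeat match goal with
  | H : context [@nat_of_ord ?m ?x] |- _ =>
      let y := fresh in set y := (@nat_of_ord m x) in *; clearbody y
  | |- context [@nat_of_ord ?m ?x] =>
      let y := fresh in set y := (@nat_of_ord m x) in *; clearbody y
  end; lia.

(** * The nodes of type C_(n+1) on numbered letters *)

Section Nodes.
Variables (n j : nat).
Hypothesis jn : j <= n.

(* Node j of type C_(n+1): its lowering operator sends j to j + 1 and the barred
   letter 2n - j of j + 1 to the barred letter 2n + 1 - j of j. *)
Definition phn (a : nat) : bool := (a == j) || (a + j.+1 == n.*2.+1).
Definition epn (a : nat) : bool := (a == j.+1) || (a + j == n.*2.+1).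

Lemma phn_epn a : phn a -> epn a = false.
Proof. by rewrite /phn /epn; ord_lia. Qed.
Lemma phn_succ a : phn a -> phn a.+1 = false.
Proof. by rewrite /phn; ord_lia. Qed.
Lemma epn_succ a : phn a -> epn a.+1.
Proof. by rewrite /phn /epn; ord_lia. Qed.

Definition phl (a : letter n) : bool := phn a.
Definition epl (a : letter n) : bool := epn a.
Definition fll (a : letter n) : letter n := inord a.+1.

Lemma val_fll (a : letter n) : phl a -> fll a = a.+1 :> nat.
Proof. by rewrite /phl /phn => h; rewrite inordK //; ord_lia. Qed.

End Nodes.

(** * Insertions commute with the lowering operators *)

Section Insertion.
Variable n : nat.

Lemma val_ub x : x <= n -> ub n x = x :> nat.
Proof. by move=> h; rewrite inordK //; ord_lia. Qed.

Lemma val_br x : x <= n -> br n x = n.*2.+1 - x :> nat.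
Proof. by move=> h; rewrite /= val_ub //; ord_lia. Qed.

Lemma letter_inj (a b : letter n) : a = b :> nat -> a = b.
Proof. exact: val_inj. Qed.

(** Under [a < c] the bar condition is a linear equation, so that [lia] can treat all the rules
    together. *)
Lemma bar_pairP (a c : letter n) : a < c -> bar_pair a c <-> a + c = n.*2.+1.
Proof.
move=> ac; split=> [[x xn [-> ->]]|e].
  by rewrite val_ub // val_br //; ord_lia.
have an : a <= n by ord_lia.
by exists (nat_of_ord a) => //; congr pair; apply: letter_inj; rewrite ?val_ub ?val_br //; ord_lia.
Qed.

(** Rules B1, B2, B3, B4 in this order, for [c] inserted in the column (a|b) with result (a'|b') and
    bumped letter [d]. The conditions x <= n, and x <> n in B4, follow from the inequalities between
    the letters. *)
Definition ins2 (c a b a' b' d : nat) : bool :=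
  [|| [&& a < c, c <= b, a + b != n.*2.+1, a' == a, b' == c & d == b],
      [&& c <= a, a < b, c + b != n.*2.+1, a' == c, b' == b & d == a],
      [&& a + b == n.*2.+1, a <= c, c <= b, 0 < a, a' == a.-1, b' == c
        & d + a' == n.*2.+1]
    | [&& c + b == n.*2.+1, c < a, a < b, a' == c.+1, b' + a' == n.*2.+1
        & d == a]].

Definition insB_spec (c : letter n) (K K' : column n) (d : letter n) : bool :=
  match K, K' with
  | [:: b], [:: a'] => [&& c <= b, a' == c & d == b]
  | [:: a; b], [:: a'; b'] => ins2 c a b a' b' d
  | _, _ => false
  end.

Lemma insBP c K K' d : insB c K K' d <-> insB_spec c K K' d.
Proof.
split.
  case.
  - by move=> a b /= ->; rewrite !eqxx.
  - move=> a b e /andP[h1 h2] h; move: (h1) (h2) h; rewrite /= /ins2.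
    by rewrite (bar_pairP (leq_trans h1 h2)); ord_lia.
  - move=> a b e /andP[h1 h2] h; move: (h1) (h2) h; rewrite /= /ins2.
    by rewrite (bar_pairP (leq_ltn_trans h1 h2)); ord_lia.
  - move=> x b xn h x0; move: h; rewrite /insB_spec /ins2 !val_ub ?val_br; try lia; ord_lia.
  - move=> x b xn h xN; have xn' : x < n by lia.
    by move: h; rewrite /insB_spec /ins2 !val_ub ?val_br; try lia; ord_lia.
case: K K' => [|a [|b []]] // [|a' [|b' []]] //=.
  by case/and3P=> h /eqP -> /eqP ->; constructor.
case/or4P.
- case/and5P=> h1 h2 h3 /eqP/val_inj -> /andP[/eqP/val_inj -> /eqP/val_inj ->].
  by constructor; rewrite ?h1 // bar_pairP; ord_lia.
- case/and5P=> h1 h2 h3 /eqP/val_inj -> /andP[/eqP/val_inj -> /eqP/val_inj ->].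
  by constructor; rewrite ?h1 // bar_pairP; ord_lia.
- case/and5P=> h1 h2 h3 h4 /and3P[h5 /eqP/val_inj -> h6].
  have an : a <= n by ord_lia.
  have -> : a = ub n a by apply: letter_inj; rewrite val_ub.
  have -> : b = br n a by apply: letter_inj; rewrite val_br //; ord_lia.
  have -> : a' = ub n a.-1 by apply: letter_inj; rewrite val_ub //; ord_lia.
  have -> : d = br n a.-1 by apply: letter_inj; rewrite val_br //; ord_lia.
  by constructor; rewrite ?val_br ?val_ub; ord_lia.
- case/and5P=> h1 h2 h3 h4 /andP[h5 /eqP/val_inj ->].
  have cn : c < n by ord_lia.
  have -> : c = ub n c by apply: letter_inj; rewrite val_ub //; ord_lia.
  have -> : b = br n c by apply: letter_inj; rewrite val_br //; ord_lia.
  have -> : a' = ub n c.+1 by apply: letter_inj; rewrite val_ub //; ord_lia.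
  have -> : b' = br n c.+1 by apply: letter_inj; rewrite val_br //; ord_lia.
  by constructor; rewrite ?val_br ?val_ub; ord_lia.
Qed.

End Insertion.

(** * Stability of the two-box rules under lowering *)

Section Closure.
Variables n j : nat.
Hypothesis jn : j <= n.

Definition ins2_word (u v : seq nat) : bool :=
  match u, v with
  | [:: a; b; c], [:: d; a'; b'] => ins2 n c a b a' b' d
  | _, _ => false
  end.

Definition same_step3 (u v : seq nat) : Prop :=
  let ph := phn n j in let ep := epn n j in
  [/\ epw ph ep u = epw ph ep v, phw ph ep u = phw ph ep v
    & 0 < phw ph ep u -> ins2_word (fw ph ep succn u) (fw ph ep succn v)].

Variant node_spec (a : nat) : bool -> bool -> Prop :=
  | NodePhi of (a == j) || (a + j.+1 == n.*2.+1) : node_spec a true false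
  | NodeEps of (a == j.+1) || (a + j == n.*2.+1) : node_spec a false true
  | NodeNone of [&& a != j, a != j.+1, a + j != n.*2.+1 & a + j.+1 != n.*2.+1] :
      node_spec a false false.

Lemma nodeP a : node_spec a (phn n j a) (epn n j a).
Proof.
rewrite /phn /epn; case: (boolP (a == j)) => [/eqP|] h1.
  case: (boolP (a == j.+1)) => h2; first by lia.
  case: (boolP (a + j == n.*2.+1)) => h3; first by lia.
  by constructor; lia.
case: (boolP (a + j.+1 == n.*2.+1)) => h2.
  case: (boolP (a == j.+1)) => h3; first by lia.
  case: (boolP (a + j == n.*2.+1)) => h4; first by lia.
  by constructor; lia.
case: (boolP (a == j.+1)) => h3; first by constructor; lia.
case: (boolP (a + j == n.*2.+1)) => h4; constructor; lia.
Qed.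

Ltac close_ins2 :=
  (split; [by [] | by [] | move=> //= _; rewrite /ins2; apply/or4P;
   first [by apply: Or41; lia | by apply: Or42; lia | by apply: Or43; lia
     | by apply: Or44; lia]]).

(** The words [a b c] and [d a' b'] are the two sides of a Knuth type relation of type C: column
    then inserted letter, bumped letter then new column. A node sees a letter only through [phn] and
    [epn], which leaves finitely many cases. Lowering may change the rule: B1 turns into B3 when
    [a = j], [c = j + 1] and [b] is the bar of [j + 1]. *)
Lemma ins2_same_step c a b a' b' d : ins2 n c a b a' b' d ->
  same_step3 [:: a; b; c] [:: d; a'; b'].
Proof.
case/or4P=> h; rewrite /same_step3 /ins2_word /=.
- have [-> [-> ->]] : a' = a /\ b' = c /\ d = b by lia.
  case: (nodeP a) => ha; case: (nodeP b) => hb; case: (nodeP c) => hc;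
  first [by exfalso; lia | close_ins2].
- have [-> [-> ->]] : a' = c /\ b' = b /\ d = a by lia.
  case: (nodeP a) => ha; case: (nodeP b) => hb; case: (nodeP c) => hc;
  first [by exfalso; lia | close_ins2].
- have eb : b' = c by lia.
  rewrite eb in h *.
  case: (nodeP a) => ha; case: (nodeP a') => ha'; try (exfalso; lia);
  case: (nodeP b) => hb; try (exfalso; lia);
  case: (nodeP d) => hd; try (exfalso; lia);
  case: (nodeP c) => hc; first [by exfalso; lia | close_ins2].
- have eb : d = a by lia.
  rewrite eb in h *.
  case: (nodeP c) => hc; case: (nodeP a') => ha'; try (exfalso; lia);
  case: (nodeP b) => hb; try (exfalso; lia);
  case: (nodeP b') => hb'; try (exfalso; lia);
  case: (nodeP a) => ha; first [by exfalso; lia | close_ins2].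
Qed.

End Closure.

(** * Reading words and shapes of tableaux *)

Definition reading n (T : tableau n) : seq (letter n) := flatten (rev T).

Lemma reading_cons n K (T : tableau n) : reading (K :: T) = reading T ++ K.
Proof. by rewrite /reading rev_cons flatten_rcons. Qed.

Lemma reading_cat n (T1 T2 : tableau n) :
  reading (T1 ++ T2) = reading T2 ++ reading T1.
Proof. by rewrite /reading rev_cat flatten_cat. Qed.

Lemma reading_one_row n (r : seq (letter n)) : reading (one_row r) = rev r.
Proof. by elim: r => //= a r IH; rewrite reading_cons IH rev_cons -cats1. Qed.

Lemma size_reading n (T : tableau n) : size (reading T) = sumn (shape T).
Proof. by rewrite size_flatten /shape map_rev sumn_rev. Qed.

Lemma shape_one_row n (r : seq (letter n)) : shape (one_row r) = nseq (size r) 1.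
Proof. by elim: r => //= a r ->. Qed.

Lemma shape_cat n (T1 T2 : tableau n) : shape (T1 ++ T2) = shape T1 ++ shape T2.
Proof. exact: map_cat. Qed.

Lemma one_row_of_shape n (T : tableau n) m :
  shape T = nseq m 1 -> exists2 r, T = one_row r & size r = m.
Proof.
elim: T m => [|K T IH] [|m] //= ; first by exists [::].
by case: K => [|a []] //= [/IH [r -> <-]]; exists (a :: r).
Qed.

Lemma second_row_shape n (T : tableau n) :
  second_row_length T = count (fun m => 1 < m) (shape T).
Proof. by rewrite /second_row_length /shape count_map. Qed.

Lemma cat_inj T (x x' y y' : seq T) :
  size x = size x' -> x ++ y = x' ++ y' -> x = x' /\ y = y'.
Proof.
elim: x x' => [|a x IH] [|a' x'] //= [/IH{}IH] [-> /IH [-> ->]] //.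
Qed.

(** Tableaux carry no condition on their entries, so a word can be cut along any shape of the right
    size. This turns a lowered reading word into a tableau again. *)
Lemma reading_surj n (T : tableau n) x : size x = size (reading T) ->
  exists2 T1 : tableau n, shape T1 = shape T & reading T1 = x.
Proof.
elim: T x => [|K T IH] x; first by move/size0nil->; exists ([::] : tableau n).
rewrite reading_cons size_cat => e.
case: (IH (take (size (reading T)) x)) => [|T1 s1 r1].
  by rewrite size_takel // e leq_addr.
exists (drop (size (reading T)) x :: T1); last by rewrite reading_cons r1 cat_take_drop.
by rewrite /= s1 size_drop e addKn.
Qed.

Lemma reading_inj n (T T1 : tableau n) :
  reading T = reading T1 -> shape T = shape T1 -> T = T1.
Proof.
elim: T T1 => [|K T IH] [|K1 T1] //= + [sK sT].
rewrite !reading_cons => /cat_inj[]; first by rewrite !size_reading sT.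
by move=> E ->; rewrite (IH _ E sT).
Qed.

(** * Simulation of insertion and inverse insertion under lowering *)

Section Simulation.
Variables n j : nat.
Hypothesis jn : j <= n.
Notation word := (seq (letter n)).
Notation ew := (epw (@phl n j) (@epl n j)).
Notation pw := (phw (@phl n j) (@epl n j)).
Notation fs := (fw (@phl n j) (@epl n j) (@fll n)).

Lemma val_fs (w : word) :
  [/\ ew w = epw (phn n j) (epn n j) (map val w),
      pw w = phw (phn n j) (epn n j) (map val w)
    & map val (fs w) = fw (phn n j) (epn n j) succn (map val w)].
Proof. exact: (@map_fw _ _ _ (phn n j) (epn n j) succn (@fll n) w (@val_fll n j jn)). Qed.

(** One step of a bisimulation, at a given pair of words. The relations [R] used with it fix the
    shapes, which are thereby shown to be constant. *)
Definition sim_at (R : word -> word -> Prop) (u v : word) : Prop :=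
  [/\ ew u = ew v, pw u = pw v & 0 < pw u -> R (fs u) (fs v)].

(** The lengths of the context are recorded because they decide how the middle word of a composite
    is cut. *)
Definition in_ctx p q (R : word -> word -> Prop) (u v : word) : Prop :=
  exists x y u' v', [/\ size x = p, size y = q,
    u = x ++ u' ++ y, v = x ++ v' ++ y & R u' v'].

Definition comp (R S : word -> word -> Prop) (u w : word) : Prop :=
  exists2 v, R u v & S v w.

(** By the tensor rule the piece acted on depends only on the string lengths of the three pieces,
    and these agree for [u] and [v]. So both words are lowered in the same part of the context, or
    both in the middle. *)
Lemma sim_ctx R u v x y : R u v -> sim_at R u v ->
  sim_at (in_ctx (size x) (size y) R) (x ++ u ++ y) (x ++ v ++ y).
Proof.
move=> Ruv [e p s]; split; first by rewrite !epw_cat e p.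
  by rewrite !phw_cat !epw_cat e p.
move=> p0; rewrite !fw_cat !epw_cat -e -p.
case: ifP => h1; first by exists (fs x), y, u, v; rewrite size_fw.
case: ifP => h2; first by exists x, y, (fs u), (fs v); split=> //; apply: s; lia.
by exists x, (fs y), u, v; rewrite size_fw.
Qed.

Lemma sim_comp R S u v w : sim_at R u v -> sim_at S v w -> sim_at (comp R S) u w.
Proof.
move=> [e p s] [e' p' s']; split; rewrite ?e ?p // => h.
by exists (fs v); [apply: s; rewrite p | apply: s'].
Qed.

Lemma sim_sym R u v : sim_at R u v -> sim_at (fun v u => R u v) v u.
Proof. by move=> [e p s]; split=> //; rewrite -p. Qed.

Lemma sim_sub (R S : word -> word -> Prop) u v :
  (forall u' v', R u' v' -> S u' v') -> sim_at R u v -> sim_at S u v.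
Proof. by move=> RS [e p s]; split=> // h; apply/RS/s. Qed.

Lemma sim_refl (R : word -> word -> Prop) u : R (fs u) (fs u) -> sim_at R u u.
Proof. by []. Qed.

Lemma fs_pair (a b : letter n) : exists a1 b1, fs [:: a; b] = [:: a1; b1].
Proof.
have := size_fw (@phl n j) (@epl n j) (@fll n) [:: a; b].
by case: (fs _) => [|a1 [|b1 []]] // _; exists a1, b1.
Qed.

(** If lowering [a] would produce [b], then [b = a + 1] has epsilon 1 and cancels the phi of [a],
    which stays. In [fs_le], likewise, of two equal letters the left one in the reading is
    lowered. *)
Lemma fs_lt (a b a1 b1 : letter n) :
  fs [:: a; b] = [:: a1; b1] -> a < b -> a1 < b1.
Proof.
have [_ _] := val_fs [:: a; b]; move=> + E; rewrite E /= /phn /epn => + ab.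
case: ifP => [h|h1]; first by case=> -> ->; ord_lia.
by case: ifP => [h|h] [-> ->]; ord_lia.
Qed.

Lemma fs_le (a b a1 b1 : letter n) :
  fs [:: b; a] = [:: b1; a1] -> a <= b -> a1 <= b1.
Proof.
have [_ _] := val_fs [:: b; a]; move=> + E; rewrite E /= /phn /epn => + ab.
case: ifP => [h|h1]; first by case=> -> ->; ord_lia.
by case: ifP => [h|h] [-> ->]; ord_lia.
Qed.

Definition RB s s' (u v : word) : Prop := exists c K K' d,
  [/\ insB c K K' d, size K = s, size K' = s', u = K ++ [:: c] & v = d :: K'].

Lemma insB_sim c K K' d : insB c K K' d ->
  sim_at (RB (size K) (size K')) (K ++ [:: c]) (d :: K').
Proof.
move=> h; have := h; rewrite insBP.
case: K K' h => [|a [|b []]] // [|a' [|b' []]] //= h.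
  case/and3P=> ab /eqP -> /eqP ->; apply: sim_refl.
  have [b1 [a1 E]] := fs_pair a c; rewrite E.
  exists a1, [:: b1], [:: a1], b1; split=> //.
  by constructor; apply: fs_le E ab.
move=> ins; have [e p s] := ins2_same_step jn ins.
have [e1 p1 f1] := val_fs [:: a; b; c]; have [e2 p2 f2] := val_fs [:: d; a'; b'].
split; rewrite ?e1 ?e2 ?p1 ?p2 //.
move=> /s; rewrite -[fw _ _ _ [:: val a; _; _]]f1 -[fw _ _ _ [:: val d; _; _]]f2.
move: (size_fw (@phl n j) (@epl n j) (@fll n) [:: a; b; c]).
move: (size_fw (@phl n j) (@epl n j) (@fll n) [:: d; a'; b']).
case: (fs [:: d; a'; b']) => [|d1 [|a1' [|b1' []]]] // _.
case: (fs [:: a; b; c]) => [|a1 [|b1 [|c1 []]]] // _ h'.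
by exists c1, [:: a1; b1], [:: a1'; b1'], d1; split=> //; exact: (insBP _ _ _ _).2.
Qed.

Definition RA s s' (u v : word) : Prop := exists c K K',
  [/\ insA c K K', size K = s, size K' = s', u = K ++ [:: c] & v = K'].

Lemma insA_sim c K K' : insA c K K' ->
  sim_at (RA (size K) (size K')) (K ++ [:: c]) K'.
Proof.
case=> [a|a b ab] /=; apply: sim_refl.
  have := size_fw (@phl n j) (@epl n j) (@fll n) [:: a].
  case: (fs _) => [|a1 []] // _; exists a1, [::], [:: a1]; split=> //.
  by constructor.
have [a1 [b1 E]] := fs_pair a b; rewrite E.
exists b1, [:: a1], [:: a1; b1]; split=> //.
by constructor; apply: fs_lt E ab.
Qed.

Definition RI sh sh' (u v : word) : Prop := exists c T T',
  [/\ insert c T T', shape T = sh, shape T' = sh', u = reading T ++ [:: c]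
    & v = reading T'].

Lemma insert_sim c T T' : insert c T T' ->
  sim_at (RI (shape T) (shape T')) (reading T ++ [:: c]) (reading T').
Proof.
elim=> {c T T'}.
- move=> c K' h; rewrite reading_cons; have := insA_sim h; apply: sim_sub => u v [c1 [K1 [K1' []]]].
  case: K1 => // h1 _ e1 -> ->; exists c1, [::], [:: K1']; split=> //=.
  + by constructor.
  + by rewrite e1.
  + by rewrite reading_cons.
- move=> c K K' T h; have := insA_sim h.
  have R0 : RA (size K) (size K') (K ++ [:: c]) K' by exists c, K, K'.
  move/(sim_ctx (reading T) [::] R0).
  rewrite !cats0 !reading_cons -catA; apply: sim_sub => u v.
  case=> x [y [u' [v' [e1 /size0nil-> -> -> [c1 [K1 [K1' [h1 e2 e3 -> ->]]]]]]]].
  have [T1 sT1 rT1] := reading_surj e1.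
  exists c1, (K1 :: T1), (K1' :: T1).
  by split; rewrite ?reading_cons ?rT1 ?cats0 -?catA //= ?sT1 ?e2 ?e3 //; constructor.
(* Bumping is a composite: the column rule acts in the context [reading T] on the left, then the
   induction hypothesis in the context [K'] on the right. The shapes make the two cuts of the middle
   word agree. *)
- move=> c K K' d T T' hB hI IH; rewrite !reading_cons -catA.
  have RB0 : RB (size K) (size K') (K ++ [:: c]) (d :: K') by exists c, K, K', d.
  have RI0 : RI (shape T) (shape T') (reading T ++ [:: d]) (reading T') by exists d, T, T'.
  have /(sim_ctx (reading T) [::] RB0) := insB_sim hB.
  rewrite !cats0 => s1; have := sim_ctx [::] K' RI0 IH.
  rewrite !cat0s -catA => s2; have := sim_comp s1 s2; apply: sim_sub => u v.
  case=> m [x [y [u' [v' [e1 /size0nil-> -> -> [c1 [K1 [K1' [d1 [h1 e2 e3 -> ->]]]]]]]]]].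
  case=> x' [y' [u'' [v'' [/size0nil-> e4 E -> [c2 [T1 [T1' [h2 e5 e6 e7 ->]]]]]]]].
  move: E; rewrite e7 /= cats0 -catA => /cat_inj[].
    by rewrite e1 !size_reading e5.
  move=> -> [e8 e9]; subst c2 y'.
  exists c1, (K1 :: T1), (K1' :: T1'); split=> //=.
  + by apply: InsertBump h1 h2.
  + by rewrite e2 e5.
  + by rewrite e3 e6.
  + by rewrite reading_cons -!catA cats0.
  + by rewrite reading_cons.
Qed.

Definition RW sh sh' m (u v : word) : Prop := exists vs T T',
  [/\ insert_word vs T T', shape T = sh, shape T' = sh', size vs = m
    & u = reading T ++ rev vs /\ v = reading T'].

Lemma insert_word_sim vs T T' : insert_word vs T T' ->
  sim_at (RW (shape T) (shape T') (size vs)) (reading T ++ rev vs) (reading T').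
Proof.
elim=> {vs T T'} [T|v vs T T1 T2 hW IH hI].
  rewrite cats0; split=> // _.
  have [T1 <- <-] := reading_surj (size_fw (@phl n j) (@epl n j) (@fll n) (reading T)).
  by exists [::], T1, T1; split=> //=; [constructor | rewrite cats0].
rewrite rev_cons -cats1 catA.
have RW0 : RW (shape T) (shape T1) (size vs) (reading T ++ rev vs) (reading T1).
  by exists vs, T, T1.
have s1 := sim_ctx [::] [:: v] RW0 IH; rewrite !cat0s in s1.
have := sim_comp s1 (insert_sim hI); apply: sim_sub => u w.
case=> m [x [y [u' [v' [/size0nil-> sy -> -> ]]]]].
case=> vs1 [T3 [T4 [h1 e1 e2 e3 [-> ->]]]].
case=> c1 [T5 [T6 [h2 e4 e5 E ->]]].
move: sy E; case: y => [|y []] //= _ /cat_inj[].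
  by rewrite !size_reading e2 e4.
move=> E [E']; have ET : T4 = T5.
  by have := reading_inj E (etrans e2 (esym e4)).
subst T5 c1; exists (y :: vs1), T3, T6; split=> //=.
- by apply: InsertCons h1 h2.
- by rewrite e3.
- by rewrite rev_cons -cats1 catA.
Qed.

Definition RC sh sh' (u v : word) : Prop := exists d T T' w,
  [/\ inv_cols T d T' w, shape T = sh, shape T' = sh', u = d :: reading T
    & v = reading T' ++ [:: w]].

(** Each column is an [insB] step read backwards, so [sim_sym] reduces it to [insB_sim]. *)
Lemma inv_cols_sim T d T' w : inv_cols T d T' w ->
  sim_at (RC (shape T) (shape T')) (d :: reading T) (reading T' ++ [:: w]).
Proof.
elim=> {T d T' w} [d|K K' T T' d c w hI IH hB].
  apply: (@sim_refl _ [:: d]).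
  have := size_fw (@phl n j) (@epl n j) (@fll n) [:: d].
  case: (fs [:: d]) => [|d1 []] // _; exists d1, [::], [::], d1.
  by split=> //; constructor.
rewrite !reading_cons -catA.
have RB0 : RB (size K) (size K') (K ++ [:: w]) (c :: K') by exists w, K, K', c.
have RC0 : RC (shape T) (shape T') (d :: reading T) (reading T' ++ [:: c]).
  by exists d, T, T', c.
have s1 := sim_ctx [::] K' RC0 IH; rewrite !cat0s -catA in s1.
have s2 := @sim_ctx (fun v u => RB (size K) (size K') u v) _ _ (reading T') [::]
  RB0 (sim_sym (insB_sim hB)).
rewrite !cats0 in s2; have := sim_comp s1 s2; apply: sim_sub => u v.
case=> m [x [y [u' [v' [/size0nil-> sy -> -> ]]]]].
case=> d1 [T1 [T1' [c1 [h1 e1 e2 -> ->]]]].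
case=> x' [y' [u'' [v'' [sx /size0nil-> E -> ]]]].
case=> w1 [K1 [K1' [c2 [h2 e3 e4 -> E']]]].
move: E; rewrite E' cats0 /= -catA => /cat_inj[].
  by rewrite sx !size_reading e2.
move=> <- [ec ey]; subst c2 y.
exists d1, (K1' :: T1), (K1 :: T1'), w1; split=> //=.
- by apply: InvCons h1 h2.
- by rewrite e4 e1.
- by rewrite e3 e2.
- by rewrite reading_cons.
- by rewrite reading_cons -!catA cats0.
Qed.

Definition RV s sh sh' (u v : word) : Prop := exists T w T',
  [/\ inv_insert s T w T', shape T = sh, shape T' = sh', u = reading T
    & v = reading T' ++ [:: w]].

Lemma inv_insert_sim s T w T' : inv_insert s T w T' ->
  sim_at (RV s (shape T) (shape T')) (reading T) (reading T' ++ [:: w]).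
Proof.
case=> {s T w T'} [T T' d w h|T T' R a d w h hR].
  rewrite -cats1 reading_cat /=; have := inv_cols_sim h; apply: sim_sub => u v.
  case=> d1 [T1 [T1' [w1 [h1 e1 e2 -> ->]]]].
  exists (rcons T1 [:: d1]), w1, T1'; split=> //; first by constructor.
    by rewrite -cats1 !shape_cat e1.
  by rewrite -cats1 reading_cat.
rewrite !reading_cat !reading_cons -!catA /=.
have RC0 : RC (shape T) (shape T') (d :: reading T) (reading T' ++ [:: w]).
  by exists d, T, T', w.
have := sim_ctx (reading R ++ [:: a]) [::] RC0 (inv_cols_sim h).
rewrite !cats0 -!catA /=; apply: sim_sub => u v.
case=> x [y [u' [v' [sx /size0nil-> -> -> ]]]].
case=> d1 [T1 [T1' [w1 [h1 e1 e2 -> ->]]]].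
have [T3 sT3 rT3] : exists2 T3 : tableau n, shape T3 = shape ([:: a] :: R) & reading T3 = x.
  by apply: reading_surj; rewrite sx reading_cons.
case: T3 sT3 rT3 => [//|[//|a1 [|//]] R1 [sR rT3]].
exists (T1 ++ [:: a1; d1] :: R1), w1, (T1' ++ [:: a1] :: R1); split.
- by constructor; rewrite // second_row_shape sR -second_row_shape.
- by rewrite !shape_cat e1 /= sR.
- by rewrite !shape_cat e2 /= sR.
- by rewrite reading_cat reading_cons -rT3 reading_cons -!catA cats0.
- by rewrite reading_cat -rT3 -!catA cats0.
Qed.

Definition RVs ss sh sh' (u v : word) : Prop := exists T ws T',
  [/\ inv_inserts ss T ws T', shape T = sh, shape T' = sh', u = reading T
    & v = reading T' ++ rev ws].

Lemma inv_inserts_sim ss T ws T' : inv_inserts ss T ws T' ->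
  sim_at (RVs ss (shape T) (shape T')) (reading T) (reading T' ++ rev ws).
Proof.
elim=> {ss T ws T'} [T|s ss T T1 T2 w ws hV hVs IH].
  rewrite cats0; split=> // _.
  have [T1 <- <-] := reading_surj (size_fw (@phl n j) (@epl n j) (@fll n) (reading T)).
  by exists T1, [::], T1; split=> //=; [constructor | rewrite cats0].
rewrite rev_cons -cats1 catA.
have RV0 : RVs ss (shape T1) (shape T2) (reading T1) (reading T2 ++ rev ws).
  by exists T1, ws, T2.
have s1 := sim_ctx [::] [:: w] RV0 IH; rewrite !cat0s in s1.
have := sim_comp (inv_insert_sim hV) s1; apply: sim_sub => u v.
case=> m [T3 [w1 [T4 [h1 e1 e2 -> ->]]]].
case=> x [y [u' [v' [/size0nil-> sy E -> ]]]].
case=> T5 [ws1 [T6 [h2 e3 e4 E' ->]]].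
move: sy E; rewrite E'; case: y => [|y []] //= _ /cat_inj[].
  by rewrite !size_reading e2 e3.
move=> E [ey]; have ET : T4 = T5 by apply: reading_inj E _; rewrite e2 e3.
subst T5 y; exists T3, (w1 :: ws1), T6; split=> //=.
- by apply: InvStep h1 h2.
- by rewrite rev_cons -cats1 catA.
Qed.

End Simulation.

(* The Rule after the removal of the letters 0 and 0bar. *)
Definition core_rule n (t v r w : seq (letter n)) (m : nat) : Prop :=
  exists T0, [/\ insert_word v (one_row t) T0, m = second_row_length T0
    & inv_inserts (nseq (size t - m) Row1 ++ nseq m Row2) T0 w (one_row r)].

Section CoreSimulation.
Variables n j : nat.
Hypothesis jn : j <= n.
Notation ew := (epw (@phl n j) (@epl n j)).
Notation pw := (phw (@phl n j) (@epl n j)).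
Notation fs := (fw (@phl n j) (@epl n j) (@fll n)).

(** The reading of [T0] is the middle word: insertion links it to the first pair of rows, inverse
    insertion to the second. As the shape of [T0] is kept, so are [m] and the list of starting
    rows. *)
Lemma core_rule_sim (t v r w : seq (letter n)) m : core_rule t v r w m ->
  [/\ ew (rev t ++ rev v) = ew (rev r ++ rev w),
      pw (rev t ++ rev v) = pw (rev r ++ rev w) &
      0 < pw (rev t ++ rev v) -> exists t1 v1 r1 w1,
      [/\ core_rule t1 v1 r1 w1 m, size t1 = size t, size r1 = size r,
          fs (rev t ++ rev v) = rev t1 ++ rev v1
        & fs (rev r ++ rev w) = rev r1 ++ rev w1]].
Proof.
case=> T0 [hW em hV].
have := sim_comp (insert_word_sim jn hW) (inv_inserts_sim jn hV).
rewrite !reading_one_row => -[e p s]; split=> // /s.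
case=> u [vs1 [T1 [T1' [h1 e1 e2 e3 [-> ->]]]]].
case=> T2 [ws1 [T2' [h2 e4 e5 E ->]]].
have ET : T1' = T2 by apply: reading_inj E _; rewrite e2 e4.
subst T2; move: e1 e5; rewrite !shape_one_row.
move=> /one_row_of_shape[t1 ? st] /one_row_of_shape[r1 ? sr]; subst T1 T2'.
exists t1, vs1, r1, ws1; rewrite !reading_one_row; split=> //.
exists T1'; split=> //; first by rewrite em !second_row_shape e2.
by rewrite st.
Qed.

End CoreSimulation.

(** * The Rule on highest weight words *)

Section Paths.
Variable n : nat.
Notation pw j := (phw (phn n j) (epn n j)).
Notation ew j := (epw (phn n j) (epn n j)).
Notation fs j := (fw (phn n j) (epn n j) succn).

(** The bound on [k] matters: at the end of a string [fw] is the identity and not an undefined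
    value. *)
Fixpoint steps (path : seq (nat * nat)) (u u' : seq nat) : Prop :=
  if path is (j, k) :: path' then
    [/\ j <= n, k <= pw j u & steps path' (iter k (fs j) u) u']
  else u = u'.

Lemma steps_cat p1 p2 u v w : steps p1 u v -> steps p2 v w -> steps (p1 ++ p2) u w.
Proof. by elim: p1 u => [|[j k] p IH] u /=; [move-> | case=> ? ? /IH h /h]. Qed.

(* The pair (t, v) of rows is recorded by the concatenation of the two reversed
   rows and the size a of t; likewise for (r, w). *)
Definition core_word a b m (u1 u2 : seq nat) : Prop :=
  exists t v r w : seq (letter n),
  [/\ core_rule t v r w m, size t = a, size r = b,
      u1 = map val (rev t ++ rev v) & u2 = map val (rev r ++ rev w)].

Lemma core_word_step a b m j u1 u2 : j <= n -> core_word a b m u1 u2 ->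
  pw j u1 = pw j u2 /\ (0 < pw j u1 -> core_word a b m (fs j u1) (fs j u2)).
Proof.
move=> jn [t [v [r [w [h st sr -> ->]]]]].
have [_ p s] := core_rule_sim jn h.
have [_ p1 f1] := val_fs jn (rev t ++ rev v).
have [_ p2 f2] := val_fs jn (rev r ++ rev w).
rewrite -p1 -p2 -f1 -f2; split=> // /s[t1 [v1 [r1 [w1 [h1 e1 e2 e3 e4]]]]].
by exists t1, v1, r1, w1; rewrite e1 e2 e3 e4.
Qed.

Lemma core_word_iter a b m j k u1 u2 : j <= n -> core_word a b m u1 u2 ->
  k <= pw j u1 -> core_word a b m (iter k (fs j) u1) (iter k (fs j) u2).
Proof.
move=> jn h; elim: k => //= k IH lek.
have [_] := core_word_step jn (IH (ltnW lek)); apply.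
by rewrite phw_iter; [lia|exact: phn_epn|exact: phn_succ|exact: epn_succ|lia].
Qed.

Lemma core_word_steps a b m path u1 u2 u1' u2' : core_word a b m u1 u2 ->
  steps path u1 u1' -> steps path u2 u2' -> core_word a b m u1' u2'.
Proof.
elim: path u1 u2 => [|[j k] path IH] u1 u2 h /=; first by move=> <- <-.
by case=> jn k1 s1 [_ k2 s2]; apply: IH s1 s2; apply: core_word_iter.
Qed.

Section Node.
Variable j : nat.
Hypothesis jn : j <= n.

Lemma iter_fs_cat k1 k u v u' v' : k <= pw j (u ++ v) ->
  k1 = minn k (pw j u - ew j v) ->
  iter k1 (fs j) u = u' -> iter (k - k1) (fs j) v = v' ->
  iter k (fs j) (u ++ v) = u' ++ v'.
Proof.
move=> le -> <- <-; apply: iter_fw_cat le;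
  [exact: phn_epn | exact: phn_succ | exact: epn_succ].
Qed.

Lemma iter_fs_nseq k m c : phn n j c -> k <= m ->
  iter k (fs j) (nseq m c) = nseq k c.+1 ++ nseq (m - k) c.
Proof. apply: iter_fw_nseq; [exact: phn_epn | exact: phn_succ]. Qed.

Lemma pw_nseq m c : pw j (nseq m c) = if phn n j c then m else 0.
Proof. by apply: phw_nseq; exact: phn_epn. Qed.

Lemma ew_nseq m c : ew j (nseq m c) = if epn n j c then m else 0.
Proof. by apply: epw_nseq; exact: phn_epn. Qed.

Definition up a := if phn n j a then a.+1 else a.

Lemma signature_up u : ~~ has (epn n j) u ->
  pw j u = count (phn n j) u /\ ew j u = 0.
Proof.
elim: u => //= a u IH; rewrite negb_or => /andP[/negbTE -> /IH[-> ->]].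
by rewrite subn0 addnC.
Qed.

(** Without letters of epsilon 1 nothing cancels in the signature, so each letter of phi 1 is
    lowered exactly once. *)
Lemma iter_fs_up u : ~~ has (epn n j) u ->
  iter (count (phn n j) u) (fs j) u = map up u.
Proof.
elim: u => //= a u IH; rewrite negb_or => /andP[ea nu].
have [pu eu] := signature_up nu.
change (iter (phn n j a + count (phn n j) u) (fs j) ([:: a] ++ u) =
        [:: up a] ++ map up u).
apply: (@iter_fs_cat (phn n j a)).
- by rewrite phw_cat eu pu /=; lia.
- by rewrite eu /=; lia.
- by rewrite /up; case pa: (phn n j a) => //=; rewrite pa.
- by rewrite addKn IH.
Qed.

Lemma iter_fs_up_cat u v : ~~ has (epn n j) u -> ew j v = 0 ->
  count (phn n j) u <= pw j (u ++ v) /\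
  iter (count (phn n j) u) (fs j) (u ++ v) = map up u ++ v.
Proof.
move=> nu e0; have [pu eu] := signature_up nu.
have le : count (phn n j) u <= pw j (u ++ v) by rewrite phw_cat e0 pu; lia.
split=> //; apply: (@iter_fs_cat (count (phn n j) u)); rewrite ?subnn //.
  by rewrite e0 pu; lia.
exact: iter_fs_up.
Qed.

End Node.
Arguments iter_fs_cat [j] jn k1 [k u v u' v'].

Lemma up_phi j a : phn n j a -> up j a = a.+1.
Proof. by rewrite /up => ->. Qed.

Lemma up_neutral j a : phn n j a = false -> up j a = a.
Proof. by rewrite /up => ->. Qed.

Hypothesis n2 : 2 <= n.

(** Letter [i] goes to [i + 1] by node [i] up to [n] and by node [2n - i] from [n] on, hence the
    minimum. The bounds on [c] and [m] keep these nodes at least 2, where 0, 1 and 0bar are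
    neutral. *)
Lemma steps_bar e0 P s0 e1 Y q s1 m c : 2 <= c -> c + m < n.*2 ->
  steps [seq (minn i (n.*2 - i), P + Y) | i <- iota c m]
    ((nseq e0 n.*2.+1 ++ nseq P c ++ nseq s0 0) ++
      nseq e1 n.*2.+1 ++ nseq Y c ++ nseq q 1 ++ nseq s1 0)
    ((nseq e0 n.*2.+1 ++ nseq P (c + m) ++ nseq s0 0) ++
      nseq e1 n.*2.+1 ++ nseq Y (c + m) ++ nseq q 1 ++ nseq s1 0).
Proof.
elim: m c => [|m IH] c c2 cm; first by rewrite addn0.
rewrite /=; set j := minn c _; have [jn j2] : j <= n /\ 1 < j by lia.
have pc : phn n j c by rewrite /phn; lia.
have [p0 e00] : phn n j 0 = false /\ epn n j 0 = false by rewrite /phn /epn; lia.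
have [p1 e10] : phn n j 1 = false /\ epn n j 1 = false by rewrite /phn /epn; lia.
have [pN eN] : phn n j n.*2.+1 = false /\ epn n j n.*2.+1 = false.
  by rewrite /phn /epn; lia.
have := IH c.+1 (leqW c2); rewrite addSnnS => /(_ cm).
move: jn pc p0 e00 p1 e10 pN eN; clear=> jn pc p0 e00 p1 e10 pN eN.
set u := (X in steps _ X _ -> _); set u' := (X in _ -> [/\ _, _ & steps _ (iter _ _ X) _]).
have eu : ~~ has (epn n j) u'.
  by rewrite /u' !has_cat !has_nseq e00 e10 eN (phn_epn jn pc) !andbF.
have cu : count (phn n j) u' = P + Y.
  by rewrite /u' !count_cat !count_nseq p0 p1 pN pc; lia.
have [le] := iter_fs_up_cat jn eu (erefl : ew j [::] = 0).
rewrite cats0 cu in le *; move=> ->; rewrite cats0.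
rewrite /u' !map_cat !map_nseq !(up_neutral p0) (up_neutral p1) !(up_neutral pN).
by rewrite !(up_phi pc).
Qed.

(** Carries [P] letters from 1 to 1bar = [2n]: node 1, then one node for each of the letters 2, ...,
    2n - 2, then node 1 again. The last power also turns [X2] further letters 1 into 2. *)
Definition bar_path P X2 : seq (nat * nat) :=
  (1, P) :: [seq (minn i (n.*2 - i), P) | i <- iota 2 (n.*2 - 3)] ++ [:: (1, P + X2)].

Lemma steps_bar_path e0 P s0 e1 Y X2 q s1 :
  steps (bar_path (P + Y) X2)
    ((nseq e0 n.*2.+1 ++ nseq P 1 ++ nseq s0 0) ++
      nseq e1 n.*2.+1 ++ nseq (Y + X2 + q) 1 ++ nseq s1 0)
    ((nseq e0 n.*2.+1 ++ nseq P n.*2 ++ nseq s0 0) ++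
      nseq e1 n.*2.+1 ++ nseq Y n.*2 ++ nseq X2 2 ++ nseq q 1 ++ nseq s1 0).
Proof.
have n1 : 1 <= n by lia.
have pc : phn n 1 1 by [].
have pd : phn n 1 n.*2.-1 by rewrite /phn; lia.
have [p0 e00] : phn n 1 0 = false /\ epn n 1 0 = false by rewrite /phn /epn; lia.
have [pN eN] : phn n 1 n.*2.+1 = false /\ epn n 1 n.*2.+1 = false.
  by rewrite /phn /epn; lia.
have e11 : epn n 1 1 = false by exact: phn_epn pc.
have step c X : phn n 1 c -> phn n 1 1 ->
  let u := (nseq e0 n.*2.+1 ++ nseq P c ++ nseq s0 0) ++
      nseq e1 n.*2.+1 ++ nseq Y c ++ nseq X 1 ++ nseq (X2 + q - X) 1 ++ nseq s1 0 in
  P + Y + X <= pw 1 u /\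
  iter (P + Y + X) (fs 1) u = (nseq e0 n.*2.+1 ++ nseq P c.+1 ++ nseq s0 0) ++
      nseq e1 n.*2.+1 ++ nseq Y c.+1 ++ nseq X 2 ++ nseq (X2 + q - X) 1 ++ nseq s1 0.
  move=> p p1; set u1 := (nseq e0 n.*2.+1 ++ nseq P c ++ nseq s0 0) ++
      nseq e1 n.*2.+1 ++ nseq Y c ++ nseq X 1.
  have eu : ~~ has (epn n 1) u1.
    by rewrite /u1 !has_cat !has_nseq e00 eN e11 (phn_epn n1 p) !andbF.
  have cu : count (phn n 1) u1 = P + Y + X.
    by rewrite /u1 !count_cat !count_nseq p0 pN p p1; lia.
  have e0v : ew 1 (nseq (X2 + q - X) 1 ++ nseq s1 0) = 0.
    by rewrite epw_cat !ew_nseq // e11 e00.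
  have [] := iter_fs_up_cat n1 eu e0v.
  rewrite cu /u1 !map_cat !map_nseq !(up_neutral p0) !(up_neutral pN).
  by rewrite !(up_phi p) (up_phi p1) -!catA.
have [le1 E1] := step 1 0 pc pc; have [le2 E2] := step n.*2.-1 X2 pd pc.
rewrite /= addn0 subn0 in le1 E1; rewrite /= addKn in le2 E2.
rewrite -addnA nseqD -!catA; split; rewrite // ?E1.
  by rewrite -!catA in le1.
rewrite -!catA in E1 le2 E2 *; rewrite E1.
apply: steps_cat.
  have := @steps_bar e0 P s0 e1 Y (X2 + q) s1 (n.*2 - 3) 2 isT.
  rewrite -!catA; apply; lia.
have -> : 2 + (n.*2 - 3) = n.*2.-1 by lia.
rewrite nseqD -!catA /=; split=> //.
by rewrite E2 prednK //; lia.
Qed.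

(** The word of a classical highest weight element after removal of the common pairs 0, 0bar; [p]
    such pairs remain on the left and [q] on the right. *)
Definition hw_word p A q X1 X2 Y : seq nat :=
  (nseq p n.*2.+1 ++ nseq A 1 ++ nseq p 0) ++
  nseq q n.*2.+1 ++ nseq Y n.*2 ++ nseq X2 2 ++ nseq X1 1 ++ nseq q 0.

(** For [M <= L] this is a highest weight word for all nodes of type C_(n+1), node 0 included. *)
Definition top_word L K M : seq nat := nseq L 0 ++ nseq M 1 ++ nseq (K - M) 0.

Definition hw_path a1 P X2 a2 : seq (nat * nat) :=
  (0, a2) :: bar_path P X2 ++ [:: (0, a1)].

Local Ltac arith0 K pq := unfold K; clear - pq; lia.

(** [K] counts the letters 1 of the right factor before [bar_path]: [Y + q] of them go to 1bar, [X2]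
    to 2, the others stay. Those that stay are the letters 1 matched, in the signature of node 0, by
    the [p] letters 0 on the left or the [Y] letters 1bar. The last power of node 0 creates the
    other [X1 - p - Y], as well as the [A] letters 1 of the left factor and all letters 0bar. *)
Lemma steps_hw p A q X1 X2 Y : (p == 0) || (q == 0) ->
  let K := minn X1 (p + Y) + X2 + Y + q in
  steps (hw_path (p + q + A + (X1 - p - Y)) (p + q + Y) X2 (p + (K - p - A)))
    (top_word (p.*2 + A) (X1 + X2 + Y + q.*2) (minn K (p + A)))
    (hw_word p A q X1 X2 Y).
Proof.
move=> pq K; have n0 : 0 <= n by [].
have [p0 e0] : phn n 0 0 = true /\ epn n 0 0 = false by rewrite /phn /epn; lia.
have [p1 e1] : phn n 0 1 = false /\ epn n 0 1 = true by rewrite /phn /epn; lia.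
have [p2 e2] : phn n 0 2 = false /\ epn n 0 2 = false by rewrite /phn /epn; lia.
have [pB eB] : phn n 0 n.*2 = true /\ epn n 0 n.*2 = false by rewrite /phn /epn; lia.
have [pN eN] : phn n 0 n.*2.+1 = false /\ epn n 0 n.*2.+1 = true.
  by rewrite /phn /epn; lia.
pose sig := (phw_cat, epw_cat, pw_nseq n0, ew_nseq n0, p0, e0, p1, e1, p2, e2,
  pB, eB, pN, eN).
have nil_iter k : iter k (fs 0) (nseq 0 0) = nseq 0 0 by elim: k => //= k ->.
split=> //; first by rewrite /top_word !sig; arith0 K pq.
have -> : iter (p + (K - p - A)) (fs 0)
    (top_word (p.*2 + A) (X1 + X2 + Y + q.*2) (minn K (p + A))) =
  ((nseq p 1 ++ nseq (p + A) 0) ++ nseq K 1 ++ nseq (X1 + X2 + Y + q.*2 - K) 0).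
  apply: (iter_fs_cat n0 p).
  - by rewrite !sig; arith0 K pq.
  - by rewrite !sig; arith0 K pq.
  - by rewrite iter_fs_nseq //; [congr (_ ++ nseq _ _)|]; arith0 K pq.
  have -> : p + (K - p - A) - p = K - p - A by arith0 K pq.
  have -> : nseq K 1 = nseq (minn K (p + A)) 1 ++ nseq (K - p - A) 1.
    by rewrite -nseqD; congr nseq; arith0 K pq.
  rewrite -catA; apply: (iter_fs_cat n0 0) => //.
  - by rewrite !sig; arith0 K pq.
  - by rewrite !sig; arith0 K pq.
  rewrite subn0 iter_fs_nseq //; last by arith0 K pq.
  by congr (_ ++ nseq _ _); arith0 K pq.
apply: steps_cat.
  have := steps_bar_path 0 p (p + A) 0 (Y + q) X2 (minn X1 (p + Y)) (X1 + X2 + Y + q.*2 - K).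
  rewrite /=; have -> : p + (Y + q) = p + q + Y by arith0 K pq.
  have -> : Y + q + X2 + minn X1 (p + Y) = K by arith0 K pq.
  by apply.
split=> //; first by rewrite !sig; arith0 K pq.
rewrite /hw_word; apply: (iter_fs_cat n0 (p + A)).
- by rewrite !sig; arith0 K pq.
- by rewrite !sig; arith0 K pq.
- apply: (iter_fs_cat n0 p); [by rewrite !sig; arith0 K pq | by rewrite !sig; arith0 K pq | |].
    by rewrite iter_fs_nseq // subnn cats0.
  by rewrite addKn iter_fs_nseq ?leq_addl // addnK.
have -> : p + q + A + (X1 - p - Y) - (p + A) = q + (X1 - minn X1 (p + Y)) by arith0 K pq.
rewrite [RHS]catA; apply: (iter_fs_cat n0 q).
- by rewrite !sig; arith0 K pq.
- by rewrite !sig; arith0 K pq.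
- by rewrite iter_fs_nseq ?leq_addl // addnK.
rewrite addKn; apply: (iter_fs_cat n0 0) => //.
- by rewrite !sig; arith0 K pq.
- by rewrite !sig; arith0 K pq.
have -> : nseq X1 1 = nseq (minn X1 (p + Y)) 1 ++ nseq (X1 - minn X1 (p + Y)) 1.
  by rewrite -nseqD; congr nseq; arith0 K pq.
rewrite subn0 -catA; apply: (iter_fs_cat n0 0) => //.
- by rewrite !sig; arith0 K pq.
- by rewrite !sig; arith0 K pq.
rewrite subn0 iter_fs_nseq //; last by arith0 K pq.
by congr (_ ++ nseq _ _); arith0 K pq.
Qed.

End Paths.

(** * The insertions on words in the letters 0 and 1 *)

Section TopRule.
Variable n : nat.
Hypothesis n1 : 1 <= n.
Let o := ub n 0.
Let i := ub n 1.

Let val_o : o = 0 :> nat. Proof. exact: val_ub. Qed.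
Let val_i : i = 1 :> nat. Proof. exact: val_ub. Qed.

Let insB_i : insB i [:: o; i] [:: o; i] i.
Proof. by apply/insBP; rewrite /= /ins2 val_o val_i; lia. Qed.

Let insB_o2 : insB o [:: o; i] [:: o; i] o.
Proof. by apply/insBP; rewrite /= /ins2 val_o val_i; lia. Qed.

Let insB_o1 : insB o [:: o] [:: o] o.
Proof. by constructor. Qed.

Definition top_tableau a b : tableau n := nseq a [:: o; i] ++ nseq b [:: o].

(** By B1 the letter 1 bumps the 1 of each column (0|1), until A1 puts it under the first single
    0. *)
Lemma insert_top_i a b :
  insert i (top_tableau a b.+1) (top_tableau a.+1 b).
Proof.
elim: a => [|a IH].
  by apply: InsertStop; constructor; rewrite val_o val_i.
by apply: InsertBump insB_i IH.
Qed.

(** Each column gives back the 0 that it receives, by B2 or B0, until a new column opens on the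
    right. *)
Lemma insert_top_o a b :
  insert o (top_tableau a b) (top_tableau a b.+1).
Proof.
elim: a => [|a IH]; last by apply: InsertBump insB_o2 IH.
elim: b => [|b IH]; first by apply: InsertNew; constructor.
by apply: InsertBump insB_o1 IH.
Qed.

Lemma inv_cols_o a b : inv_cols (top_tableau a b) o (top_tableau a b) o.
Proof.
elim: a => [|a IH]; last by apply: InvCons IH insB_o2.
by elim: b => [|b IH]; [constructor | apply: InvCons IH insB_o1].
Qed.

Lemma inv_cols_i a : inv_cols (nseq a [:: o; i]) i (nseq a [:: o; i]) i.
Proof. by elim: a => [|a IH]; [constructor | apply: InvCons IH insB_i]. Qed.

(** The first-row steps take away single columns and expel 0. When the second row is reached, all
    columns to the left of the removed box are (0|1), so 1 is expelled through B1 read backwards. *)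
Lemma inv_inserts_top L M b :
  inv_inserts (nseq L Row1 ++ nseq M Row2) (top_tableau M (L + b))
    (nseq L o ++ nseq M i) (one_row (nseq (M + b) o)).
Proof.
elim: L => [|L IH].
  elim: M b => [|M IH] b.
    by rewrite /one_row map_nseq; apply: InvDone.
  rewrite addSnnS; apply: InvStep (IH b.+1).
  have -> : top_tableau M.+1 (0 + b) = nseq M [:: o; i] ++ [:: o; i] :: nseq b [:: o].
    by rewrite /top_tableau -cat_rcons; congr cat; elim: (M) => //= m ->.
  constructor; first exact: inv_cols_i.
  by rewrite /second_row_length count_nseq.
apply: InvStep IH.
have -> : top_tableau M (L.+1 + b) = rcons (top_tableau M (L + b)) [:: o].
  by rewrite /top_tableau -cats1 -catA -[[:: [:: o]]]/(nseq 1 _) -nseqD addn1.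
by constructor; apply: inv_cols_o.
Qed.

Lemma core_word_top L K M : M <= L -> M <= K ->
  core_word n L K M (top_word L K M) (top_word K L M).
Proof.
move=> ML MK; exists (nseq L o), (nseq (K - M) o ++ nseq M i), (nseq K o),
  (nseq (L - M) o ++ nseq M i).
rewrite !size_nseq !rev_cat !rev_nseq !map_cat !map_nseq /= val_o val_i; split=> //.
exists (top_tableau M (L - M + (K - M))); split.
- have hM : insert_word (nseq M i) (one_row (nseq L o)) (top_tableau M (L - M)).
    elim: M ML {MK} => [|M IH] ML.
      by rewrite subn0 /one_row map_nseq; apply: InsertNil.
    apply: InsertCons (IH (ltnW ML)) _.
    by rewrite (_ : L - M = (L - M.+1).+1); [apply: insert_top_i | lia].
  elim: (K - M) => [|m IH]; first by rewrite addn0.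
  by apply: InsertCons IH _; rewrite addnS; apply: insert_top_o.
- rewrite /second_row_length count_cat !count_nseq /=; lia.
- rewrite size_nseq; have := inv_inserts_top (L - M) M (K - M).
  by rewrite subnKC.
Qed.

(** The equations make the two paths of [steps_hw] equal and their starting points the two top words
    with [L] and [K] exchanged, which [core_word_top] relates. *)
Lemma core_word_hw p A q X1 X2 Y p' A' q' X1' Y' : 2 <= n ->
  (p == 0) || (q == 0) -> (p' == 0) || (q' == 0) ->
  p.*2 + A = X1' + X2 + Y' + q'.*2 -> p'.*2 + A' = X1 + X2 + Y + q.*2 ->
  p + q + Y = p' + q' + Y' ->
  p + q + A + (X1 - p - Y) = p' + q' + A' + (X1' - p' - Y') ->
  let K := minn X1 (p + Y) + X2 + Y + q in
  let K' := minn X1' (p' + Y') + X2 + Y' + q' in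
  p + (K - p - A) = p' + (K' - p' - A') -> minn K (p + A) = minn K' (p' + A') ->
  core_word n (p.*2 + A) (p'.*2 + A') (minn K (p + A))
    (hw_word n p A q X1 X2 Y) (hw_word n p' A' q' X1' X2 Y').
Proof.
move=> n2 pq pq' eL eK eP e1 K K' e2 eM.
apply: core_word_steps (steps_hw n2 A X1 X2 Y pq) _; last first.
  have := steps_hw n2 A' X1' X2 Y' pq'.
  by lazy zeta; rewrite -/K' -eP -e1 -e2 -eM; apply.
lazy zeta; rewrite -/K -eK -eL; apply: core_word_top.
  by clearbody K; clear; lia.
by rewrite eK /K; clear; lia.
Qed.

End TopRule.

(** * The insertions are deterministic *)

Section Determinism.
Variable n : nat.

Lemma insB_det (c : letter n) K K1 K2 d1 d2 :
  insB c K K1 d1 -> insB c K K2 d2 -> K1 = K2 /\ d1 = d2.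
Proof.
rewrite !insBP; case: K K1 K2 => [|a [|b []]] // [|a1 [|b1 []]] // [|a2 [|b2 []]] //=.
  by case/and3P=> _ /eqP -> /eqP -> /and3P[_ /eqP -> /eqP ->].
move=> h1 h2; have [ea [eb ed]] : a1 = a2 :> nat /\ b1 = b2 :> nat /\ d1 = d2 :> nat.
  move: h1 h2; move: (nat_of_ord a) (nat_of_ord b) (nat_of_ord a1)(nat_of_ord b1)
    (nat_of_ord a2) (nat_of_ord b2) (nat_of_ord c) (nat_of_ord d1) (nat_of_ord d2).
  by move=> ? ? ? ? ? ? ? ? ? h1 h2; case/or4P: h1 => h1; case/or4P: h2 => h2; lia.
by rewrite (letter_inj ea) (letter_inj eb) (letter_inj ed).
Qed.

(** The rules are separated by their results [a'], [b'], [d] as well as by their inputs, so inverse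
    insertion is also a partial function. *)
Lemma insB_inv_det (c1 c2 : letter n) K K1 K2 d :
  insB c1 K1 K d -> insB c2 K2 K d -> K1 = K2 /\ c1 = c2.
Proof.
rewrite !insBP; case: K1 K K2 => [|a1 [|b1 []]] // [|a [|b []]] // [|a2 [|b2 []]] //=.
  by case/and3P=> _ /eqP -> /eqP -> /and3P[_ /eqP -> /eqP ->].
move=> h1 h2; have [ea [eb ed]] : a1 = a2 :> nat /\ b1 = b2 :> nat /\ c1 = c2 :> nat.
  move: h1 h2; move: (nat_of_ord a) (nat_of_ord b) (nat_of_ord a1)(nat_of_ord b1)
    (nat_of_ord a2) (nat_of_ord b2) (nat_of_ord c1) (nat_of_ord c2) (nat_of_ord d).
  by move=> ? ? ? ? ? ? ? ? ? h1 h2; case/or4P: h1 => h1; case/or4P: h2 => h2; lia.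
by rewrite (letter_inj ea) (letter_inj eb) (letter_inj ed).
Qed.

Lemma insA_det (c : letter n) K K1 K2 : insA c K K1 -> insA c K K2 -> K1 = K2.
Proof. by case=> [a|a b _] h; inversion h. Qed.

Lemma insA_insB (c : letter n) K K1 K2 d : insA c K K1 -> insB c K K2 d -> False.
Proof.
move=> h; rewrite insBP; case: h => [a|a b ab] //=.
by case: K2 => [|? []] // /and3P[]; rewrite leqNgt ab.
Qed.

Lemma insert_det (c : letter n) T T1 T2 : insert c T T1 -> insert c T T2 -> T1 = T2.
Proof.
move=> h; elim: h T2 => {c T T1}.
- move=> c K' hA T2 h2; inversion h2 as [c' K2 hA2| |]; subst.
  by rewrite (insA_det hA hA2).
- move=> c K K' T hA T2 h2.
  inversion h2 as [|c' L L' T' hA2|c' L L' d T' T'' hB2 hI2]; subst.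
    by rewrite (insA_det hA hA2).
  by case: (insA_insB hA hB2).
- move=> c K K' d T T' hB _ IH T2 h2.
  inversion h2 as [|c' L L' T3 hA2|c' L L' d' T3 T4 hB2 hI2]; subst.
    by case: (insA_insB hA2 hB).
  have [-> ed] := insB_det hB hB2; subst.
  by rewrite (IH _ hI2).
Qed.

Lemma insert_word_det vs (T T1 T2 : tableau n) :
  insert_word vs T T1 -> insert_word vs T T2 -> T1 = T2.
Proof.
move=> h; elim: h T2 => {vs T T1} [T T2 h|v vs T T1 T2 _ IH h T3 h3].
  by inversion h.
inversion h3 as [|v' vs' T' T4 T5 hW hI]; subst.
by have E := IH _ hW; subst; apply: insert_det h hI.
Qed.

Lemma inv_cols_det (T T1 T2 : tableau n) d w1 w2 :
  inv_cols T d T1 w1 -> inv_cols T d T2 w2 -> T1 = T2 /\ w1 = w2.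
Proof.
move=> h; elim: h T2 w2 => {T T1 w1 d} [d T2 w2 h|K K' T T' d c w _ IH hB T2 w2 h].
  by inversion h.
inversion h as [|L L' T3 T4 d' c' w' hC hB2]; subst.
have [eT ec] := IH _ _ hC; subst.
by have [-> ->] := insB_inv_det hB hB2.
Qed.

Lemma second_row_split (T1 T2 R1 R2 : tableau n) K1 K2 :
  1 < size K1 -> 1 < size K2 ->
  second_row_length R1 = 0 -> second_row_length R2 = 0 ->
  T1 ++ K1 :: R1 = T2 ++ K2 :: R2 -> [/\ T1 = T2, K1 = K2 & R1 = R2].
Proof.
move=> s1 s2 h1 h2; elim: T1 T2 => [|K T1 IH] [|K' T2] /=.
- by case=> -> ->.
- case=> _ E; move: h1; rewrite E /second_row_length count_cat /= s2; lia.
- case=> _ E; move: h2; rewrite -E /second_row_length count_cat /= s1; lia.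
- by case=> -> /IH [-> -> ->].
Qed.

Lemma inv_insert_det s (T T1 T2 : tableau n) w1 w2 :
  inv_insert s T w1 T1 -> inv_insert s T w2 T2 -> T1 = T2 /\ w1 = w2.
Proof.
case=> {s T w1 T1} [T T' d w h h2|T T' R a d w h hR h2].
  inversion h2 as [T3 T4 d' w' hC E0 E|]; case: (rcons_inj E) => ? ?; subst.
  by have [-> ->] := inv_cols_det h hC.
inversion h2 as [|T3 T4 R' a' d' w' hC hR' E0 E].
have [? [? ?] ?] := @second_row_split _ _ _ _ [:: a'; d'] [:: a; d] isT isT hR' hR E; subst.
by have [-> ->] := inv_cols_det h hC.
Qed.

Lemma inv_inserts_det ss (T T1 T2 : tableau n) ws1 ws2 :
  inv_inserts ss T ws1 T1 -> inv_inserts ss T ws2 T2 -> T1 = T2 /\ ws1 = ws2.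
Proof.
move=> h; elim: h T2 ws2 => {ss T ws1 T1} [T T2 ws2 h|s ss T T1 T2 w ws h _ IH T3 ws3 h3].
  by inversion h.
inversion h3 as [|s' ss' T' T4 T5 w' ws' hV hVs]; subst.
have [? ?] := inv_insert_det h hV; subst.
by have [-> ->] := IH _ _ hVs.
Qed.

End Determinism.

(** * The words of the crystals B_l *)

Section CountWords.
Variable n : nat.
Notation pw j := (phw (phn n j) (epn n j)).
Notation ew j := (epw (phn n j) (epn n j)).
Notation fs j := (fw (phn n j) (epn n j) succn).

Definition blocks (C : nat -> nat) (s : seq nat) : seq nat :=
  flatten [seq nseq (C a) a | a <- s].

(** Decreasing order, since a weakly increasing row is read from right to left. *)
Definition count_word (C : nat -> nat) : seq nat :=
  blocks C (rev (iota 0 n.*2.+2)).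

Lemma blocks_cat C s1 s2 : blocks C (s1 ++ s2) = blocks C s1 ++ blocks C s2.
Proof. by rewrite /blocks map_cat flatten_cat. Qed.

Lemma blocks1 C a : blocks C [:: a] = nseq (C a) a.
Proof. by rewrite /blocks /= cats0. Qed.

Lemma eq_in_blocks C C' s : {in s, C =1 C'} -> blocks C s = blocks C' s.
Proof. by move=> E; congr flatten; apply/eq_in_map => a /E ->. Qed.

Lemma eq_count_word C C' :
  (forall a, a <= n.*2.+1 -> C a = C' a) -> count_word C = count_word C'.
Proof.
by move=> E; apply: eq_in_blocks => a; rewrite mem_rev mem_iota; apply: E.
Qed.

Definition move_up (a : nat) (C : nat -> nat) (b : nat) : nat :=
  if b == a then (C b).-1 else if b == a.+1 then (C b).+1 else C b.

Definition neutral j s := all (fun a => ~~ phn n j a && ~~ epn n j a) s.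

Lemma neutral_signature j C s : j <= n -> neutral j s ->
  pw j (blocks C s) = 0 /\ ew j (blocks C s) = 0.
Proof.
move=> jn; elim: s => [|a s IH] //= /andP[/andP[/negbTE pa /negbTE ea] /IH[p e]].
rewrite -cat1s blocks_cat blocks1 phw_cat epw_cat p e pw_nseq // ew_nseq //.
by rewrite pa ea.
Qed.

Lemma fs_nseq j m a : j <= n -> phn n j a -> 0 < m ->
  fs j (nseq m a) = a.+1 :: nseq m.-1 a.
Proof. by move=> jn pa m0; have := iter_fs_nseq jn pa m0; rewrite subn1. Qed.

Lemma move_up_blocks j C s : j <= n -> neutral j s ->
  forall a, phn n j a -> blocks (move_up a C) s = blocks C s.
Proof.
move=> jn ns a pa; apply: eq_in_blocks => b bs; rewrite /move_up.
have /andP[pb eb] := allP ns _ bs.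
case: eqP => [E|_]; first by rewrite E pa in pb.
by case: eqP => // E; rewrite E (epn_succ jn pa) in eb.
Qed.

Lemma iota_split a b c : a <= b -> b <= c -> iota a (c - a) = iota a (b - a) ++ iota b (c - b).
Proof.
by move=> ab bc; rewrite -{2}(subnKC ab) -iotaD; congr iota; lia.
Qed.

Lemma blocks2 C a b s t : blocks C (s ++ [:: b; a] ++ t) =
  blocks C s ++ nseq (C b) b ++ nseq (C a) a ++ blocks C t.
Proof. by rewrite !blocks_cat /= /blocks /= cats0 -catA. Qed.

Lemma letters_split_last : exists s1 s2,
  rev (iota 0 n.*2.+2) = s1 ++ [:: n.+1; n] ++ s2 /\ neutral n s1 /\ neutral n s2.
Proof.
exists (rev (iota n.+2 n)), (rev (iota 0 n)); split; last split.
- rewrite -[n.*2.+2]subn0 (@iota_split 0 n) 1?(@iota_split n n.+2); try lia.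
  rewrite subn0 (_ : n.+2 - n = 2) 1?(_ : n.*2.+2 - n.+2 = n); try lia.
  by rewrite !rev_cat -catA.
- by apply/allP=> a; rewrite mem_rev mem_iota /phn /epn; lia.
- by apply/allP=> a; rewrite mem_rev mem_iota /phn /epn; lia.
Qed.

(** A node [j < n] sees two adjacent pairs of letters, [j], [j + 1] and their bars. For [j = n] the
    two pairs are the same. *)
Lemma letters_split j : j < n -> exists s1 s2 s3,
  rev (iota 0 n.*2.+2) =
    s1 ++ [:: n.*2.+1 - j; n.*2 - j] ++ s2 ++ [:: j.+1; j] ++ s3
  /\ [/\ neutral j s1, neutral j s2 & neutral j s3].
Proof.
move=> jn; exists (rev (iota (n.*2.+2 - j) j)), (rev (iota j.+2 (n.*2 - j - j.+2))),
  (rev (iota 0 j)); split; last split.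
- rewrite -[n.*2.+2]subn0 (@iota_split 0 j) 1?(@iota_split j j.+2)
    1?(@iota_split j.+2 (n.*2 - j)) 1?(@iota_split (n.*2 - j) (n.*2.+2 - j)); try lia.
  rewrite subn0 (_ : j.+2 - j = 2) 1?(_ : n.*2.+2 - j - (n.*2 - j) = 2); try lia.
  rewrite (_ : iota j 2 = [:: j; j.+1]) // (_ : iota (n.*2 - j) 2 = [:: n.*2 - j; n.*2.+1 - j]).
    rewrite !rev_cat -!catA (_ : n.*2.+2 - (n.*2.+2 - j) = j) //; lia.
  by rewrite /= subSn //; lia.
- by apply/allP=> a; rewrite mem_rev mem_iota /phn /epn; lia.
- by apply/allP=> a; rewrite mem_rev mem_iota /phn /epn; lia.
- by apply/allP=> a; rewrite mem_rev mem_iota /phn /epn; lia.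
Qed.

Lemma count_word_last C :
  [/\ pw n (count_word C) = C n, ew n (count_word C) = C n.+1
    & 0 < C n -> fs n (count_word C) = count_word (move_up n C)].
Proof.
have [s1 [s2 [E [n1 n2]]]] := letters_split_last.
have pn : phn n n n by rewrite /phn eqxx.
have en : epn n n n.+1 by exact: epn_succ.
rewrite /count_word E !blocks2 !(move_up_blocks _ (leqnn n) _ pn) //.
have [p1 e1] := neutral_signature C (leqnn n) n1.
have [p2 e2] := neutral_signature C (leqnn n) n2.
have eN := phn_epn (leqnn n) pn; have pN := phn_succ (leqnn n) pn.
have sg := (phw_cat, epw_cat, pw_nseq (leqnn n), ew_nseq (leqnn n), pn, en, eN, pN,
  p1, e1, p2, e2).
rewrite !sg; split; [lia|lia|move=> C0].
rewrite !fw_cat !sg !ltn0 C0.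
rewrite fs_nseq // /move_up eqxx (gtn_eqF (ltnSn n)) eqxx.
by rewrite -cat1s -[[:: n.+1]]/(nseq 1 n.+1) -!catA (catA (nseq (C n.+1) _)) -nseqD addn1.
Qed.

(** The relevant blocks are, in order, the bars of [j] and [j + 1], then [j + 1] and [j], of types
    epsilon, phi, epsilon, phi. Only the two middle ones cancel, which is the comparison of x_(j+1)
    with xbar_(j+1) in the definition of the operators. *)
Lemma count_word_lt C j : j < n ->
  [/\ pw j (count_word C) = C j + (C (n.*2 - j) - C j.+1),
      ew j (count_word C) = C (n.*2.+1 - j) + (C j.+1 - C (n.*2 - j))
    & 0 < pw j (count_word C) -> fs j (count_word C) =
        count_word (move_up (if C (n.*2 - j) <= C j.+1 then j else n.*2 - j) C)].
Proof.
move=> jn; have jn' := ltnW jn.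
have [s1 [s2 [s3 [E [n1 n2 n3]]]]] := letters_split jn.
have pj : phn n j j by rewrite /phn eqxx.
have pb : phn n j (n.*2 - j) by rewrite /phn; lia.
have eb : epn n j (n.*2.+1 - j) by rewrite /epn; lia.
have pb' : phn n j (n.*2.+1 - j) = false by rewrite /phn; lia.
have [p1 e1] := neutral_signature C jn' n1.
have [p2 e2] := neutral_signature C jn' n2.
have [p3 e3] := neutral_signature C jn' n3.
have sg := (phw_cat, epw_cat, pw_nseq jn', ew_nseq jn', pj, phn_epn jn' pj,
  epn_succ jn' pj, phn_succ jn' pj, pb, phn_epn jn' pb, eb, pb',
  p1, e1, p2, e2, p3, e3).
have W D : count_word D = blocks D s1 ++ nseq (D (n.*2.+1 - j)) (n.*2.+1 - j) ++
    nseq (D (n.*2 - j)) (n.*2 - j) ++ blocks D s2 ++ nseq (D j.+1) j.+1 ++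
    nseq (D j) j ++ blocks D s3.
  by rewrite /count_word E !blocks2.
have e : ew j (count_word C) = C (n.*2.+1 - j) + (C j.+1 - C (n.*2 - j)).
  by rewrite W !sg; clear; lia.
have p : pw j (count_word C) = C j + (C (n.*2 - j) - C j.+1).
  by rewrite W !sg; clear; lia.
split=> //; rewrite p => p0.
have mj D s a : neutral j s -> phn n j a -> blocks (move_up a D) s = blocks D s.
  by move=> ns pa; apply: (move_up_blocks _ jn' ns pa).
case: leqP => h; rewrite !W !mj //.
  have -> : move_up j C (n.*2.+1 - j) = C (n.*2.+1 - j).
    by rewrite /move_up !ifF //; lia.
  have -> : move_up j C (n.*2 - j) = C (n.*2 - j) by rewrite /move_up !ifF //; lia.
  have -> : move_up j C j.+1 = (C j.+1).+1 by rewrite /move_up ifF ?eqxx //; lia.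
  have -> : move_up j C j = (C j).-1 by rewrite /move_up eqxx.
  rewrite !fw_cat !sg !ltn0 (_ : _ < C (n.*2 - j) = false); last by clear -h; lia.
  rewrite (_ : 0 < C j = true); last by clear -h p0; lia.
  rewrite fs_nseq //; last by clear -h p0; lia.
  by rewrite -(addn1 (C j.+1)) nseqD -!catA.
have -> : move_up (n.*2 - j) C (n.*2.+1 - j) = (C (n.*2.+1 - j)).+1.
  by rewrite /move_up ifF ?ifT //; lia.
have -> : move_up (n.*2 - j) C (n.*2 - j) = (C (n.*2 - j)).-1.
  by rewrite /move_up eqxx.
have -> : move_up (n.*2 - j) C j.+1 = C j.+1 by rewrite /move_up !ifF //; lia.
have -> : move_up (n.*2 - j) C j = C j by rewrite /move_up !ifF //; lia.
rewrite !fw_cat !sg !ltn0 (_ : _ < C (n.*2 - j) = true); last by clear -h; lia.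
rewrite fs_nseq //; last by clear -h p0; lia.
rewrite -(addn1 (C (n.*2.+1 - j))) nseqD -!catA.
by rewrite (_ : (n.*2 - j).+1 = n.*2.+1 - j); last lia.
Qed.

End CountWords.

(** * From coordinates to words *)

Section Coordinates.
Variable n : nat.

Definition letter_count (L : nat) (p : vec2 n) (a : nat) : nat :=
  if (a == 0) || (a == n.*2.+1) then `|(L%:Z - csum p)%R|%N./2
  else if a <= n then `|coordv p.1 a|%N else `|coordv p.2 (n.*2.+1 - a)|%N.

Lemma coordvE (x : vec n) (j : 'I_n) : coordv x j.+1 = x j.
Proof. by rewrite /coordv /= insubT //= => h; congr (x _); apply: val_inj. Qed.

Lemma coordv_shift i a d (x : vec n) : 0 < a -> 0 < i -> i <= n ->
  coordv (shift i d x) a = (coordv x a + (if a == i then d else 0))%R.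
Proof.
case: a => // a _ i0 iN; case: (ltnP a n) => an.
  have E := coordvE _ (Ordinal an); rewrite /= in E.
  by rewrite !E ffunE /=; case: eqP; rewrite ?addr0.
rewrite /coordv /= !insubF ?ltnNge ?an //=; case: eqP => [E|]; lia.
Qed.

Lemma csum_shift1 i d (x y : vec n) : 0 < i -> i <= n ->
  csum (shift i d x, y) = (csum (x, y) + d)%R.
Proof.
case: i => // i _ iN; rewrite /csum (bigD1 (Ordinal iN)) //= [in RHS](bigD1 (Ordinal iN)) //=.
rewrite ffunE eqxx (eq_bigr (fun j => x j + y j)%R) => [|j /eqP ji].
  by rewrite (addrAC (x _) d) (addrAC _ d).
rewrite ffunE; case: eqP => // E.
by case: ji; apply: val_inj => /=; case: E.
Qed.

Lemma csumC (x y : vec n) : csum (x, y) = csum (y, x).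
Proof. by rewrite /csum; apply: eq_bigr => j _; rewrite addrC. Qed.

Lemma csum_shift2 i d (x y : vec n) : 0 < i -> i <= n ->
  csum (x, shift i d y) = (csum (x, y) + d)%R.
Proof. by move=> i0 iN; rewrite csumC csum_shift1 // csumC. Qed.

(** [coordv] reads index 0 as index 1 and is 0 beyond [n], so [a] can range over all naturals. *)
Lemma nonnegP (p : vec2 n) :
  nonneg p <-> forall a, (0 <= coordv p.1 a)%R /\ (0 <= coordv p.2 a)%R.
Proof.
split=> [/forallP h a|h].
  by rewrite /coordv; case: insubP => //= j _ _; have /andP[] := h j.
by apply/forallP=> j; have := h j.+1; rewrite !coordvE => -[-> ->].
Qed.

Definition word_of (L : nat) (p : vec2 n) : seq nat := count_word n (letter_count L p).

Lemma rev_blocks C s : rev (blocks C s) = blocks C (rev s).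
Proof.
elim: s => // a s IH; rewrite -cat1s [in RHS]rev_cat !blocks_cat rev_cat IH.
by rewrite -[rev [:: a]]/[:: a] blocks1 rev_nseq.
Qed.

Lemma map_val_blocks (s : seq 'I_n) (C : 'I_n -> nat) (D : nat -> nat)
    (g : 'I_n -> letter n) (h : nat -> nat) :
  (forall j, g j = h j :> nat) -> (forall j : 'I_n, C j = D (h j)) ->
  map val (flatten [seq nseq (C j) (g j) | j <- s]) =
  blocks D [seq h j | j <- map val s].
Proof.
move=> gh CD; elim: s => //= j s IH.
by rewrite map_cat IH map_nseq -cat1s blocks_cat blocks1 -CD -gh.
Qed.

Lemma letters_range : iota 0 n.*2.+2 =
  [:: 0] ++ map succn (iota 0 n) ++
    map (fun j => n.*2.+1 - j.+1) (rev (iota 0 n)) ++ [:: n.*2.+1].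
Proof.
rewrite (_ : n.*2.+2 = 1 + (n + (n + 1))); last by lia.
rewrite !iotaD -[iota (0 + 1) n]/(iota (1 + 0) n) iotaDl /=; congr (_ :: _ ++ _ ++ [:: _]).
  apply: (@eq_from_nth _ 0) => [|k]; rewrite ?size_map ?size_rev !size_iota // => kn.
  rewrite (nth_map 0) ?size_rev ?size_iota // nth_rev ?size_iota // !nth_iota //; lia.
lia.
Qed.

Lemma word_of_row_word L (c : Cset n L) :
  map val (rev (row_word c)) = word_of L (val c).
Proof.
rewrite /word_of /count_word -rev_blocks map_rev letters_range; congr rev.
rewrite /row_word; case: c => -[x y] ?; rewrite [val _]/=; set p := (x, y).
have C0 : letter_count L p 0 = `|(L%:Z - csum p)%R|%N./2 by [].
have CN : letter_count L p n.*2.+1 = `|(L%:Z - csum p)%R|%N./2.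
  by rewrite /letter_count eqxx orbT.
rewrite !blocks_cat !blocks1 C0 CN !map_cat !map_nseq.
congr (nseq _ _ ++ _ ++ _ ++ nseq _ _).
- exact: val_ub.
- rewrite (@map_val_blocks _ _ (letter_count L p) _ succn).
  + by rewrite val_enum_ord.
  + by move=> j; rewrite val_ub.
  + by move=> j; rewrite /letter_count /= ltn_ord coordvE ifF //; have := ltn_ord j; lia.
- rewrite (@map_val_blocks _ _ (letter_count L p) _ (fun j => n.*2.+1 - j.+1)).
  + by rewrite -val_enum_ord -map_rev.
  + by move=> j; rewrite val_br.
  + move=> j; have jn := ltn_ord j.
    rewrite /letter_count ifF; last by lia.
    rewrite ifF; last by lia.
    by rewrite subKn ?coordvE //; lia.
- exact: etrans (val_br (leq0n n)) (subn0 _).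
Qed.

Notation pw j := (phw (phn n j) (epn n j)).
Notation ew j := (epw (phn n j) (epn n j)).
Notation fs j := (fw (phn n j) (epn n j) succn).

Lemma letter_count_slack L p a : (a == 0) || (a == n.*2.+1) ->
  letter_count L p a = `|(L%:Z - csum p)%R|%N./2.
Proof. by rewrite /letter_count => ->. Qed.

Lemma letter_count_low L p a : 0 < a -> a <= n -> letter_count L p a = `|coordv p.1 a|%N.
Proof. by move=> a0 an; rewrite /letter_count ifF ?an //; lia. Qed.

Lemma letter_count_high L p a : n < a -> a <= n.*2 ->
  letter_count L p a = `|coordv p.2 (n.*2.+1 - a)|%N.
Proof. by move=> a0 an; rewrite /letter_count !ifF //; lia. Qed.

Lemma word_of_last L p : 0 < n ->
  pw n (word_of L p) = `|coordv p.1 n|%N /\ ew n (word_of L p) = `|coordv p.2 n|%N.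
Proof.
move=> n0; have [-> -> _] := count_word_last n (letter_count L p).
rewrite letter_count_low // letter_count_high; [|lia|lia].
by rewrite (_ : n.*2.+1 - n.+1 = n); last lia.
Qed.

Lemma word_of_lt L p i : 0 < i -> i < n ->
  pw i (word_of L p) = `|coordv p.1 i|%N + (`|coordv p.2 i.+1|%N - `|coordv p.1 i.+1|%N) /\
  ew i (word_of L p) = `|coordv p.2 i|%N + (`|coordv p.1 i.+1|%N - `|coordv p.2 i.+1|%N).
Proof.
move=> i0 iN; have [-> -> _] := count_word_lt (letter_count L p) iN.
rewrite (letter_count_low _ _ i0 (ltnW iN)) (letter_count_low _ _ (ltn0Sn i) iN).
rewrite !letter_count_high; try lia.
rewrite (_ : n.*2.+1 - (n.*2 - i) = i.+1); last by lia.
by rewrite (_ : n.*2.+1 - (n.*2.+1 - i) = i); last by lia.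
Qed.

Lemma fA_csum i (p : vec2 n) : 0 < i -> i <= n -> csum (fA i p) = csum p.
Proof.
case: p => x y i0 iN; rewrite /fA; case: eqP => [_|/eqP ne].
  have n0 : 0 < n by lia.
  by rewrite csum_shift1 1?csum_shift2 //= addrK.
rewrite /f_lt ifF; last by lia.
have iN' : i.+1 <= n by lia.
by case: ifP => _; rewrite ?csum_shift1 ?csum_shift2 //; lia.
Qed.

(** Nonnegativity of both vectors is what lets absolute values count letters and guarantees that the
    letter to be lowered is present. *)
Lemma word_fA L p i : 0 < i -> i <= n -> nonneg p -> nonneg (fA i p) ->
  0 < pw i (word_of L p) /\ fs i (word_of L p) = word_of L (fA i p).
Proof.
move=> i0 iN /nonnegP np /nonnegP nq; have e := fA_csum p i0 iN.
have count_eq s : phn n i s -> s <= n.*2 ->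
    (forall a, 0 < a -> a <= n -> move_up s (fun a => `|coordv p.1 a|%N) a =
       `|coordv (fA i p).1 a|%N) ->
    (forall a, n < a -> a <= n.*2 ->
       move_up s (fun a => `|coordv p.2 (n.*2.+1 - a)|%N) a =
       `|coordv (fA i p).2 (n.*2.+1 - a)|%N) ->
    count_word n (move_up s (letter_count L p)) = word_of L (fA i p).
  move=> ps sN low high; apply: eq_count_word => a aN.
  case a0: ((a == 0) || (a == n.*2.+1)).
    move: ps; rewrite /move_up !letter_count_slack // e /phn => ps.
    by rewrite !ifF //; lia.
  case: (leqP a n) => an.
    rewrite [RHS]letter_count_low -?low ?/move_up ?letter_count_low //; lia.
  rewrite [RHS]letter_count_high -?high ?/move_up ?letter_count_high //; lia.
have [En|ne] := eqVneq i n.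
  subst i; have pn' : phn n n n by rewrite /phn eqxx.
  move: count_eq; rewrite /fA eqxx in nq e * => count_eq.
  have [x1 _] := nq n; rewrite /= coordv_shift // eqxx in x1.
  have [p0 _] := word_of_last L p i0.
  have pn : 0 < pw n (word_of L p) by rewrite p0; lia.
  split=> //; have [_ _] := count_word_last n (letter_count L p).
  rewrite letter_count_low // -p0 => /(_ pn) ->; apply: count_eq; rewrite //; first by lia.
    move=> a a0 an; rewrite /move_up /= coordv_shift //.
    case: eqP => [->|_]; first by lia.
    by rewrite ifF ?addr0 //; lia.
  move=> a na aN; rewrite /move_up /= coordv_shift //; last by lia.
  have [_ y0] := np (n.*2.+1 - a).
  by rewrite ifF; [case: eqP => b1; case: eqP => b2; lia | lia].
have iN' : i < n by rewrite ltn_neqAle ne.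
have [p0 _] := word_of_lt L p i0 iN'.
have [_ _] := count_word_lt (letter_count L p) iN'; rewrite -/(word_of L p).
rewrite letter_count_high; [|lia|lia].
rewrite letter_count_low //; rewrite (_ : n.*2.+1 - (n.*2 - i) = i.+1); last by lia.
move: count_eq p0 nq; rewrite /fA (negbTE ne) /f_lt; case: p np {e} => x y np.
have -> : (i == 0) = false by lia.
have [xi1 yi1] := np i.+1; have [xi yi] := np i; rewrite /= in xi1 yi1 xi yi.
case: ifP => h count_eq p0 nq.
  have := nq i; rewrite /= !coordv_shift // eqxx (ltn_eqF (ltnSn i)) addr0 => -[x1 _].
  have pn : 0 < pw i (word_of L (x, y)) by rewrite p0 /=; lia.
  move=> /(_ pn) E; split=> //; rewrite E ifT; last by rewrite /=; lia.
  apply: count_eq; [by rewrite /phn eqxx | lia | |].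
    move=> a a0 an; rewrite /move_up /= !coordv_shift //.
    have [xa _] := np a; rewrite /= in xa.
    by case: eqP => b1; case: eqP => b2; try subst a; lia.
  by move=> a na aN; rewrite /move_up /= !ifF //; lia.
have := nq i.+1; rewrite /= !coordv_shift // eqxx (gtn_eqF (ltnSn i)) addr0 => -[_ y1].
have pn : 0 < pw i (word_of L (x, y)) by rewrite p0 /=; lia.
move=> /(_ pn) E; split=> //; rewrite E ifF; last by rewrite /=; lia.
apply: count_eq; [by rewrite /phn; lia | lia | |].
  by move=> a a0 an; rewrite /move_up /= !ifF //; lia.
move=> a na aN; rewrite /move_up /= !coordv_shift //; try lia.
have [_ ya] := np (n.*2.+1 - a); rewrite /= in ya.
have [E1|ne1] := eqVneq a (n.*2 - i).
  have E2 : n.*2.+1 - a = i.+1 by lia.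
  by rewrite E2 eqxx (gtn_eqF (ltnSn i)); lia.
have -> : (n.*2.+1 - a == i.+1) = false by lia.
have [E1|ne2] := eqVneq a (n.*2 - i).+1.
  have E2 : n.*2.+1 - a = i by lia.
  by rewrite E2 eqxx; lia.
have -> : (n.*2.+1 - a == i) = false by lia.
by rewrite !addr0.
Qed.

End Coordinates.

Ltac eq_cases :=
  repeat match goal with
  | |- context [if (?a == ?b) then _ else _] => case: (a =P b) => ?
  end.

(** * Doubled coordinates and squares of the operators *)

Section Operators.
Variable n : nat.
Notation pw j := (phw (phn n j) (epn n j)).
Notation fs j := (fw (phn n j) (epn n j) succn).

Lemma coordv_double (x : vec n) a : coordv (vec_double x) a = (coordv x a *+ 2)%R.
Proof. by rewrite /coordv; case: insubP => //= j _ _; rewrite ffunE. Qed.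

Lemma fA_mono i (q : vec2 n) a : 0 < a -> 0 < i -> i <= n ->
  (if (a == i)%N then coordv (fA i q).1 a <= coordv q.1 a
   else coordv q.1 a <= coordv (fA i q).1 a)%R /\
  (if (a == i.+1)%N && (i < n)%N then coordv (fA i q).2 a <= coordv q.2 a
   else coordv q.2 a <= coordv (fA i q).2 a)%R.
Proof.
case: q => x y a0 i0 iN; rewrite /fA; have [->|ne] := eqVneq i n.
  have n0 : 0 < n by lia.
  rewrite ltnn andbF /= !coordv_shift //; case: eqP => _; lia.
have iN' : i < n by rewrite ltn_neqAle ne.
rewrite iN' /f_lt (gtn_eqF i0) andbT.
case: (boolP (coordv y i.+1 <= coordv x i.+1)%R) => _ /=; rewrite !coordv_shift //.
  by split; [case: (a =P i) => ?; case: (a =P i.+1) => ?; lia | case: ifP].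
by split; [case: ifP | case: (a =P i) => ?; case: (a =P i.+1) => ?; lia].
Qed.

(** Over the two applications each coordinate moves in one direction only, by [fA_mono], so its
    middle value is at least one of its end values. *)
Lemma nonneg_mid i (q : vec2 n) : 0 < i -> i <= n ->
  nonneg q -> nonneg (fA i (fA i q)) -> nonneg (fA i q).
Proof.
move=> i0 iN /nonnegP nq /nonnegP nq2; apply/nonnegP.
suff main a : 0 < a -> (0 <= coordv (fA i q).1 a)%R /\ (0 <= coordv (fA i q).2 a)%R.
  by case=> [|a]; [exact: (main 1) | exact: main].
move=> a0; have [m1 m2] := fA_mono q a0 i0 iN.
have [m3 m4] := fA_mono (fA i q) a0 i0 iN.
have [n1 n2] := nq a; have [n3 n4] := nq2 a; split.
  by move: m1 m3; case: ifP => _; lia.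
by move: m2 m4; case: ifP => _; lia.
Qed.

Lemma word_fA2 L (p : vec2 n) i : 0 < i -> i <= n -> nonneg p -> nonneg (fA i (fA i p)) ->
  1 < pw i (word_of L p) /\
  iter 2 (fs i) (word_of L p) = word_of L (fA i (fA i p)).
Proof.
move=> i0 iN np np2; have np1 := nonneg_mid i0 iN np np2.
have [p1 e1] := word_fA L i0 iN np np1; have [p2 e2] := word_fA L i0 iN np1 np2.
rewrite /= e1 e2; split=> //; move: p2; rewrite -e1 phw_fw //; first by lia.
- exact: phn_epn.
- exact: phn_succ.
- exact: epn_succ.
Qed.

(** The tested difference is even, so one step cannot change the outcome of the test: both
    applications take the same branch. *)
Lemma f_lt_twice i (x y u v : vec n) : 0 < i -> i < n ->
  (coordv v i.+1 - coordv u i.+1 = (coordv y i.+1 - coordv x i.+1) *+ 2)%R ->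
  fA i (fA i (u, v)) =
    if (coordv y i.+1 <= coordv x i.+1)%R
    then (shift i.+1 2 (shift i (-2) u), v) else (u, shift i.+1 (-2) (shift i 2 v)).
Proof.
move=> i0 iN e; have iN' : (i == n) = false by lia.
have iN2 := ltnW iN.
have s2 (a b : int) w : shift i.+1 a (shift i b (shift i.+1 a (shift i b w))) =
    shift i.+1 (a *+ 2)%R (shift i (b *+ 2)%R w) :> vec n.
  apply/ffunP=> j; rewrite !ffunE.
  by case: eqP => ?; case: eqP => ?; lia.
rewrite /fA iN' /f_lt (gtn_eqF i0).
case: (lerP (coordv y i.+1) (coordv x i.+1)) => h.
  have -> : (coordv v i.+1 <= coordv u i.+1)%R by lia.
  rewrite !coordv_shift // eqxx (gtn_eqF (ltnSn i)) addr0.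
  have -> : (coordv v i.+1 <= coordv u i.+1 + 1)%R by lia.
  by rewrite s2.
have -> : (coordv v i.+1 <= coordv u i.+1)%R = false by lia.
rewrite !coordv_shift // eqxx (gtn_eqF (ltnSn i)) addr0.
have -> : (coordv v i.+1 - 1 <= coordv u i.+1)%R = false by lia.
by rewrite s2.
Qed.

Lemma f_lt_if i (x y : vec n) : 0 < i -> f_lt i (x, y) =
    if (coordv y i.+1 <= coordv x i.+1)%R
    then (shift i.+1 1%R (shift i (-1)%R x), y)
    else (x, shift i.+1 (-1)%R (shift i 1%R y)).
Proof. by move=> i0; rewrite /f_lt (gtn_eqF i0). Qed.

Lemma e_lt_if i (x y : vec n) : 0 < i -> e_lt i (x, y) =
    if (coordv y i.+1 < coordv x i.+1)%R
    then (shift i.+1 (-1)%R (shift i 1%R x), y)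
    else (x, shift i.+1 1%R (shift i (-1)%R y)).
Proof. by move=> i0; rewrite /e_lt (gtn_eqF i0). Qed.

Lemma omega_vecA_fA i (p : vec2 n) : 0 < i -> i <= n ->
  omega_vecA (fA i p) = fA i (fA i (omega_vecA p)).
Proof.
case: p => x y i0 iN; have [->|ne] := eqVneq i n.
  rewrite /fA eqxx /omega_vecA /=; congr pair; apply/ffunP=> j; rewrite !ffunE;
    by eq_cases; lia.
have iN' : i < n by rewrite ltn_neqAle ne.
rewrite /omega_vecA (@f_lt_twice _ x y) //=; last by rewrite !coordv_double; lia.
rewrite /fA (negbTE ne) f_lt_if //; case: ifP => _ /=; congr pair;
  apply/ffunP=> j; rewrite !ffunE; by eq_cases; lia.
Qed.

Lemma omega_vecD_fD_lt i (q : vec2 n * bool) : 0 < i -> i < n ->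
  omega_vecD (fD i q) = fA i (fA i (omega_vecD q)).
Proof.
case: q => -[x y] o i0 iN'; have ne : (i == n) = false by lia.
have n0 : 0 < n by lia.
have -> : fD i ((x, y), o) = (f_lt i (x, y), o) by rewrite /fD ne.
rewrite f_lt_if // {2}/omega_vecD (@f_lt_twice _ x y) //; last first.
  by rewrite !coordv_shift ?coordv_double //=; eq_cases; lia.
rewrite /omega_vecD; case: ifP => _ /=; congr pair;
  apply/ffunP=> j; rewrite !ffunE; by eq_cases; lia.
Qed.

Lemma omega_vecD_fD_last (q : vec2 n * bool) :
  omega_vecD (fD n q) = fA n (omega_vecD q).
Proof.
by case: q => -[x y] []; rewrite /omega_vecD /fD /fA eqxx /=; congr pair;
  apply/ffunP=> j; rewrite !ffunE; case: eqP => ?; lia.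
Qed.

End Operators.

(** * Lengths of strings *)

Section Strings.
Variables (T : finType) (e : T -> option T) (E : T -> nat).
Hypothesis eS : forall b b', e b = Some b' -> E b = (E b').+1.
Hypothesis eN : forall b, e b = None -> E b = 0.

Lemma iter_string m b b' : iter m (obind e) (Some b) = Some b' -> E b = E b' + m.
Proof.
elim: m b' => [|m IH] b' /=; first by case=> ->; rewrite addn0.
by case: (iter _ _ _) IH => //= c /(_ _ erefl) -> /eS ->; lia.
Qed.

Lemma iter_string_some m b : m <= E b -> exists b', iter m (obind e) (Some b) = Some b'.
Proof.
elim: m => [|m IH] le; first by exists b.
have [c Ec] := IH (ltnW le); have := iter_string Ec; rewrite iterS Ec /=.
by case Eb: (e c) => [b'|]; [exists b' | have := eN Eb; lia].
Qed.

(** [E] separates the [E b + 1] elements of the string that starts at [b], hence [E b < #|T|], and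
    the bound on [m] does not cut the maximum. *)
Lemma max_string b :
  \max_(m < #|T| | isSome (iter m (obind e) (Some b))) m = E b.
Proof.
apply/eqP; rewrite eqn_leq; apply/andP; split.
  apply/bigmax_leqP => m; case Em: (iter _ _ _) => [b'|] // _.
  by have := iter_string Em; lia.
have lt : E b < #|T|.
  pose f (m : 'I_(E b).+1) := odflt b (iter m (obind e) (Some b)).
  have fE m : E b = E (f m) + m.
    have mE : m <= E b by rewrite -ltnS.
    by have [b' Eb] := iter_string_some mE; rewrite /f Eb /=; apply: iter_string.
  have inj : injective f.
    by move=> m m' fm; apply: val_inj => /=; have := fE m; have := fE m'; rewrite fm; lia.
  by have := leq_card f inj; rewrite card_ord.
have [b' Eb] := iter_string_some (leqnn (E b)).
by apply: (@leq_bigmax_cond _ _ _ (Ordinal lt)); rewrite /= Eb.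
Qed.

End Strings.

Section CountInjectivity.
Variable n : nat.

Lemma count_mem_word (C : nat -> nat) a : a <= n.*2.+1 ->
  count_mem a (count_word n C) = C a.
Proof.
move=> aN; have E s : count_mem a (blocks C s) = C a * count_mem a s.
  elim: s => [|b s IH]; first by rewrite muln0.
  rewrite -cat1s blocks_cat count_cat IH blocks1 count_nseq /=.
  by case: eqP => [->|_]; lia.
rewrite /count_word E count_uniq_mem ?rev_uniq ?iota_uniq //.
by rewrite mem_rev mem_iota ltnS aN muln1.
Qed.

Lemma word_of_inj L (p q : vec2 n) : nonneg p -> nonneg q ->
  word_of L p = word_of L q -> p = q.
Proof.
move=> np nq E; have C a : a <= n.*2.+1 -> letter_count L p a = letter_count L q a.
  by move=> aN; rewrite -(count_mem_word _ aN) -/(word_of L p) E count_mem_word.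
case: p q np nq {E} C => x y [x' y'] /nonnegP np /nonnegP nq C; congr pair; apply/ffunP=> j.
  have := C j.+1; rewrite !letter_count_low //= !coordvE; have := np j.+1; have := nq j.+1.
  by rewrite /= !coordvE => -[? _] [? _]; have := ltn_ord j; lia.
have := C (n.*2.+1 - j.+1); rewrite !letter_count_high; try (have := ltn_ord j; lia).
have -> : n.*2.+1 - (n.*2.+1 - j.+1) = j.+1 by have := ltn_ord j; lia.
rewrite !coordvE; have := np j.+1; have := nq j.+1.
by rewrite /= !coordvE => -[_ ?] [_ ?]; lia.
Qed.

Lemma row_word_inj L (c c' : Cset n L) : row_word c = row_word c' -> c = c'.
Proof.
move=> E; apply: val_inj; apply: (@word_of_inj L).
- by have /and3P[] := valP c.
- by have /and3P[] := valP c'.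
- by rewrite -!word_of_row_word E.
Qed.

End CountInjectivity.

Section Admissible.
Variable n : nat.

Lemma nonneg_pos (x y : vec n) :
  (forall a, 0 < a -> (0 <= coordv x a)%R /\ (0 <= coordv y a)%R) -> nonneg (x, y).
Proof. by move=> h; apply/nonnegP => -[|a]; [exact: (h 1) | exact: h]. Qed.

Lemma nonneg_f_lt i (x y : vec n) : 0 < i -> i < n -> nonneg (x, y) ->
  0 < `|coordv x i|%N + (`|coordv y i.+1|%N - `|coordv x i.+1|%N) ->
  nonneg (f_lt i (x, y)).
Proof.
move=> i0 iN /nonnegP np p0; have iN2 := ltnW iN; rewrite f_lt_if //.
have := np i; have := np i.+1; rewrite /= => -[x1 y1] [x0 y0].
case: (lerP (coordv y i.+1) (coordv x i.+1)) => h; apply: nonneg_pos => a a0;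
  rewrite !coordv_shift //; have := np a; rewrite /= => -[xa ya]; split=> //.
  by case: eqP => [Ea|_]; case: eqP => [Eb|_]; try subst a; lia.
by case: eqP => [Ea|_]; case: eqP => [Eb|_]; try subst a; lia.
Qed.

Lemma nonneg_e_lt i (x y : vec n) : 0 < i -> i < n -> nonneg (x, y) ->
  0 < `|coordv y i|%N + (`|coordv x i.+1|%N - `|coordv y i.+1|%N) ->
  nonneg (e_lt i (x, y)).
Proof.
move=> i0 iN /nonnegP np p0; have iN2 := ltnW iN; rewrite e_lt_if //.
have := np i; have := np i.+1; rewrite /= => -[x1 y1] [x0 y0].
case: (ltrP (coordv y i.+1) (coordv x i.+1)) => h; apply: nonneg_pos => a a0;
  rewrite !coordv_shift //; have := np a; rewrite /= => -[xa ya]; split=> //.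
  by case: eqP => [Ea|_]; case: eqP => [Eb|_]; try subst a; lia.
by case: eqP => [Ea|_]; case: eqP => [Eb|_]; try subst a; lia.
Qed.

Lemma nonneg_shift_down (x : vec n) i d : 0 < i -> i <= n ->
  nonneg (x, vec0 n) -> (0 <= coordv x i + d)%R -> nonneg (shift i d x, vec0 n).
Proof.
move=> i0 iN /nonnegP np p0; apply: nonneg_pos => a a0; have := np a.
by rewrite coordv_shift //= => -[xa ya]; split=> //; case: eqP => [->|_]; lia.
Qed.

Lemma nonneg_split (x y : vec n) :
  nonneg (x, y) = nonneg (x, vec0 n) && nonneg (y, vec0 n).
Proof.
apply/forallP/andP => [h|[/forallP h1 /forallP h2] j].
  by split; apply/forallP=> j /=; have /andP[a b] := h j; rewrite ffunE ?a ?b.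
by have /andP[a _] := h1 j; have /andP[b _] := h2 j; rewrite /= a b.
Qed.

Lemma csum_e_lt i (x y : vec n) : 0 < i -> i < n -> csum (e_lt i (x, y)) = csum (x, y).
Proof.
move=> i0 iN; have iN2 := ltnW iN; rewrite e_lt_if //.
by case: ifP => _; rewrite ?csum_shift1 ?csum_shift2 //; lia.
Qed.

Lemma csum_f_lt i (x y : vec n) : 0 < i -> i < n -> csum (f_lt i (x, y)) = csum (x, y).
Proof.
move=> i0 iN; have iN2 := ltnW iN; rewrite f_lt_if //.
by case: ifP => _; rewrite ?csum_shift1 ?csum_shift2 //; lia.
Qed.

End Admissible.

(** * Words of the elements of B_l and the classical operators *)

Section Crystals.
Variables (g : affine_type) (n : nat).
Notation pw j := (phw (phn n j) (epn n j)).
Notation ew j := (epw (phn n j) (epn n j)).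
Notation fs j := (fw (phn n j) (epn n j) succn).

(* omega intertwines the i-th operators with the kappa-th powers of those of
   type C. *)
Definition kappa (i : nat) : nat := if g is D2 then (if i == n then 1 else 2) else 2.

Lemma kappa_gt0 i : 0 < kappa i.
Proof. by rewrite /kappa; case: g => //; case: eqP. Qed.

Lemma kappa_cases i : kappa i = 1 \/ kappa i = 2.
Proof. by rewrite /kappa; case: g; last case: eqP; auto. Qed.

Section Level.
Variable l : nat.

Definition bword (b : Bl g n l) : seq nat := word_of (2 * l) (val (omega b)).

Lemma nonneg_omega (b : Bl g n l) : nonneg (val (omega b)).
Proof. by have /and3P[] := valP (omega b). Qed.

Lemma ord_leq (i : 'I_n.+1) : i <= n. Proof. by rewrite -ltnS. Qed.

Lemma bword_ft (i : 'I_n.+1) (b b' : Bl g n l) : 0 < i -> ft i b = Some b' ->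
  kappa i <= pw i (bword b) /\ iter (kappa i) (fs i) (bword b) = bword b'.
Proof.
move=> i0 E; have np := nonneg_omega b; have np' := nonneg_omega b'.
have iN := ord_leq i.
suff E' : val (omega b') = iter (kappa i) (fA i) (val (omega b)).
  move: np'; rewrite /bword E'; case: (kappa_cases i) => ->.
    exact: word_fA.
  exact: word_fA2.
rewrite /kappa; move: b b' E {np np'}; case: (g) => b b' /=.
  by case: insubP => // u _ uE [<-]; rewrite /= uE omega_vecA_fA.
case: insubP => // u _ uE [<-]; rewrite /= uE; case: eqP => [En|/eqP ne].
  by rewrite En omega_vecD_fD_last.
by rewrite omega_vecD_fD_lt // ltn_neqAle ne.
Qed.

(** [x_n] and [xbar_n] receive the same shift [o], so their difference is still doubled, and a
    positive string length of the word gives one for the undoubled coordinates. *)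
Lemma bword_lt (x y : vec n) (o : int) i : 0 < i -> i < n ->
  let p := (shift n o (vec_double x), shift n o (vec_double y)) in
  (0 <= o <= 1)%R -> nonneg (x, y) ->
  (0 < pw i (word_of (2 * l) p) ->
     0 < `|coordv x i|%N + (`|coordv y i.+1|%N - `|coordv x i.+1|%N)) /\
  (0 < ew i (word_of (2 * l) p) ->
     0 < `|coordv y i|%N + (`|coordv x i.+1|%N - `|coordv y i.+1|%N)).
Proof.
move=> i0 iN p o01 /nonnegP np; have n0 := ltn_trans i0 iN.
have [-> ->] := word_of_lt (2 * l) p i0 iN.
have := np i; have := np i.+1; rewrite /= => -[x1 y1] [x0 y0].
rewrite !coordv_shift // !coordv_double [i == n]ltn_eqF //.
by case: eqP => _; split; lia.
Qed.

(** By contraposition: if phi of the word is positive, then the formula of the operator stays inside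
    the set, so [ft] is defined. *)
Lemma bword_ft_none (i : 'I_n.+1) (b : Bl g n l) : 0 < i -> ft i b = None ->
  pw i (bword b) = 0.
Proof.
move=> i0 E; have iN := ord_leq i; have n0 := leq_trans i0 iN.
have [//|p0] := posnP (pw i (bword b)); exfalso; move: p0; rewrite /bword.
have shift0 x : shift n 0 x = x :> vec n.
  by apply/ffunP=> j; rewrite ffunE addr0; case: ifP.
move: b E; case: (g) => b /=; case: insubP => // /negP nP _ p0; apply: nP.
  case: b p0 => -[x y] /= /andP[np tot] p0; rewrite /inA fA_csum // tot andbT.
  have [En|ne] := eqVneq (i : nat) n.
    have [p1 _] := word_of_last (2 * l) (omega_vecA (x, y)) n0.
    move: p0; rewrite En p1 /= coordv_double => p0.
    rewrite /fA eqxx /= nonneg_split.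
    move: np; rewrite nonneg_split => /andP[nx ny]; apply/andP.
    have /nonnegP/(_ n)[/= xn _] := nx; have /nonnegP/(_ n)[/= yn _] := ny.
    by split; apply: nonneg_shift_down => //=; lia.
  have iN' : i < n by rewrite ltn_neqAle ne.
  rewrite /fA (negbTE ne); apply: nonneg_f_lt => //.
  by apply: (@bword_lt x y 0 i _ _ _ _).1 => //; rewrite !shift0.
case: b p0 => -[[x y] o] /= /andP[np tot] p0.
have [En|ne] := eqVneq (i : nat) n.
  have [p1 _] := word_of_last (2 * l) (omega_vecD (x, y, o)) n0.
  move: p0; rewrite En p1 /= coordv_shift // coordv_double eqxx.
  move: np tot; rewrite /inD /= nonneg_split => /andP[nx ny].
  have /nonnegP/(_ n)[/= xn _] := nx; have /nonnegP/(_ n)[/= yn _] := ny.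
  case: (o) => /= tot p0; rewrite nonneg_split ?nx ?ny ?csum_shift2 ?csum_shift1 //=.
    by rewrite nonneg_shift_down //=; lia.
  by rewrite nonneg_shift_down //=; lia.
have iN' : i < n by rewrite ltn_neqAle ne.
rewrite -[X in inD l X]/(f_lt i (x, y), o) /inD /= csum_f_lt // tot andbT.
apply: nonneg_f_lt => //.
by apply: (@bword_lt x y (o : nat)%:Z i _ _ _ _).1 => //; case: (o).
Qed.

Lemma bword_et_none (i : 'I_n.+1) (b : Bl g n l) : 0 < i -> et i b = None ->
  ew i (bword b) = 0.
Proof.
move=> i0 E; have iN := ord_leq i; have n0 := leq_trans i0 iN.
have [//|p0] := posnP (ew i (bword b)); exfalso; move: p0; rewrite /bword.
have shift0 x : shift n 0 x = x :> vec n.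
  by apply/ffunP=> j; rewrite ffunE addr0; case: ifP.
move: b E; case: (g) => b /=; case: insubP => // /negP nP _ p0; apply: nP.
  case: b p0 => -[x y] /= /andP[np tot] p0; rewrite /inA.
  have [En|ne] := eqVneq (i : nat) n.
    have [_ p1] := word_of_last (2 * l) (omega_vecA (x, y)) n0.
    move: p0; rewrite En p1 /= coordv_double => p0.
    rewrite /eA eqxx /= nonneg_split.
    move: np; rewrite nonneg_split => /andP[nx ny].
    have /nonnegP/(_ n)[/= xn _] := nx; have /nonnegP/(_ n)[/= yn _] := ny.
    rewrite csum_shift1 1?csum_shift2 //= subrK tot andbT; apply/andP.
    by split; apply: nonneg_shift_down => //=; lia.
  have iN' : i < n by rewrite ltn_neqAle ne.
  rewrite /eA (negbTE ne) csum_e_lt // tot andbT; apply: nonneg_e_lt => //.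
  by apply: (@bword_lt x y 0 i _ _ _ _).2 => //; rewrite !shift0.
case: b p0 => -[[x y] o] /= /andP[np tot] p0.
have [En|ne] := eqVneq (i : nat) n.
  have [_ p1] := word_of_last (2 * l) (omega_vecD (x, y, o)) n0.
  move: p0; rewrite En p1 /= coordv_shift // coordv_double eqxx.
  move: np tot; rewrite /inD /= nonneg_split => /andP[nx ny].
  have /nonnegP/(_ n)[/= xn _] := nx; have /nonnegP/(_ n)[/= yn _] := ny.
  case: (o) => /= tot p0; rewrite nonneg_split ?nx ?ny ?csum_shift2 ?csum_shift1 //=.
    by rewrite nonneg_shift_down //=; lia.
  by rewrite nonneg_shift_down //=; lia.
have iN' : i < n by rewrite ltn_neqAle ne.
rewrite -[X in inD l X]/(e_lt i (x, y), o) /inD /= csum_e_lt // tot andbT.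
apply: nonneg_e_lt => //.
by apply: (@bword_lt x y (o : nat)%:Z i _ _ _ _).2 => //; case: (o).
Qed.

End Level.
End Crystals.

(** * String lengths, and node 0 through letter counts *)

Section Level.
Variables (g : affine_type) (n l : nat).
Hypothesis n2 : 2 <= n.
Notation pw j := (phw (phn n j) (epn n j)).
Notation ew j := (epw (phn n j) (epn n j)).
Implicit Types (b : Bl g n l) (i : 'I_n.+1).

Lemma bword_inj b b' : bword b = bword b' -> b = b'.
Proof.
move=> E; apply: omega_inj; first by lia.
by apply: val_inj; apply: word_of_inj E; apply: nonneg_omega.
Qed.

Lemma bword_et i b b' : 0 < i -> et i b = Some b' ->
  ew i (bword b) = ew i (bword b') + kappa g n i.
Proof.
move=> i0 /(Bl_axiom i b' b) /(bword_ft i0)[le <-]; apply: epw_iter => //.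
- exact: phn_epn (ord_leq i).
- exact: phn_succ (ord_leq i).
- exact: epn_succ (ord_leq i).
Qed.

Lemma bword_ft_pw i b b' : 0 < i -> ft i b = Some b' ->
  pw i (bword b) = pw i (bword b') + kappa g n i.
Proof.
move=> i0 /(bword_ft i0)[le <-]; rewrite phw_iter ?subnK //.
- exact: phn_epn (ord_leq i).
- exact: phn_succ (ord_leq i).
- exact: epn_succ (ord_leq i).
Qed.

(** Induction along the string shows that [k] divides [F], and the quotient satisfies
    [max_string]. *)
Lemma scaled_string (T : finType) (e : T -> option T) (F : T -> nat) k (b : T) :
  0 < k -> (forall c c', e c = Some c' -> F c = F c' + k) ->
  (forall c, e c = None -> F c = 0) ->
  F b = k * \max_(m < #|T| | isSome (iter m (obind e) (Some b))) m.
Proof.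
move=> k0 FS FN.
have dvd c : k %| F c.
  have [m] := ubnP (F c); elim: m c => // m IH c; rewrite ltnS => le.
  case Ec: (e c) => [c'|]; last by rewrite (FN _ Ec).
  by rewrite (FS _ _ Ec) dvdn_addl ?dvdnn //; apply: IH; have := FS _ _ Ec; lia.
rewrite (@max_string _ _ (fun c => F c %/ k)).
- by rewrite mulnC divnK.
- by move=> c c' /FS ->; rewrite divnDr ?dvdnn // divnn k0 addn1.
- by move=> c /FN ->; rewrite div0n.
Qed.

Lemma eps_bword i b : 0 < i -> ew i (bword b) = kappa g n i * eps i b.
Proof.
move=> i0; apply: (@scaled_string (Bl g n l) _ (fun c => ew i (bword c)));
  first exact: kappa_gt0.
  by move=> c c'; apply: bword_et.
by move=> c; apply: bword_et_none.
Qed.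

Lemma phi_bword i b : 0 < i -> pw i (bword b) = kappa g n i * phi i b.
Proof.
move=> i0; apply: (@scaled_string (Bl g n l) _ (fun c => pw i (bword c)));
  first exact: kappa_gt0.
  by move=> c c'; apply: bword_ft_pw.
by move=> c; apply: bword_ft_none.
Qed.

Definition cnt b (a : nat) : nat := letter_count (2 * l) (val (omega b)) a.

Lemma csum_double (p : vec2 n) : csum (omega_vecA p) = (csum p *+ 2)%R.
Proof.
rewrite /csum -sumrMnl; apply: eq_bigr => j _ /=.
by rewrite !ffunE mulrnDl.
Qed.

Lemma csum_omegaD (p : vec2 n) (o : bool) :
  csum (omega_vecD (p, o)) = ((csum p + (o : nat)%:Z) *+ 2)%R.
Proof.
have n0 : 0 < n by lia.
rewrite /omega_vecD /= csum_shift1 // csum_shift2 //.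
by rewrite -[(vec_double _, _)]/(omega_vecA p) csum_double; lia.
Qed.

(** Both types in the coordinates of type D, with x_o = 0 in type A. In these coordinates [omega]
    and the operators of node 0 have the same formula for both types. *)
Definition base (b : Bl g n l) : vec2 n * bool :=
  match g as g' return Bl g' n l -> vec2 n * bool with
  | A2 => fun c => (val c, false) | D2 => fun c => val c end b.

Lemma base_in b : inD l (base b).
Proof.
rewrite /base; move: b; case: g => b; last exact: valP b.
by have /andP[np tot] := valP b; rewrite /inD /= np add0r.
Qed.

Lemma val_omega b : val (omega b) = omega_vecD (base b).
Proof.
rewrite /base; move: b; case: g => //= b.
rewrite /omega_vecA /omega_vecD /=; congr pair; apply/ffunP=> j; rewrite !ffunE.
  by case: ifP; rewrite ?addr0.
by case: ifP; rewrite ?addr0.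
Qed.

Lemma et0_base b : match et ord0 b with
  | Some b' => base b' = (e_lt 0 (base b).1, (base b).2)
  | None => ~~ inD l (e_lt 0 (base b).1, (base b).2)
  end.
Proof.
have n0 : (0 == n) = false by lia.
rewrite /base; move: b; case: g => b /=; case: insubP => [u _ ->|] //=.
- by rewrite /eA n0.
- by rewrite /eA n0 /inA /inD /= add0r.
- by rewrite /eD; case: (Dval b) => p o; rewrite n0.
- by rewrite /eD; case: (Dval b) => p o; rewrite n0.
Qed.

Lemma ft0_base b : ft ord0 b = None -> ~~ inD l (f_lt 0 (base b).1, (base b).2).
Proof.
have n0 : (0 == n) = false by lia.
rewrite /base; move: b; case: g => b /=; case: insubP => //=.
- by rewrite /fA n0 /inA /inD /= add0r.
- by rewrite /fD; case: (Dval b) => p o; rewrite n0.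
Qed.

Lemma cntE b : let x := (base b).1.1 in let y := (base b).1.2 in
  [/\ cnt b 1 = (`|coordv x 1|%N).*2, cnt b n.*2 = (`|coordv y 1|%N).*2
    & cnt b 0 = `|(l%:Z - (csum (x, y) + ((base b).2 : nat)%:Z))%R|%N].
Proof.
have n0 : 0 < n by lia.
rewrite /cnt val_omega; case: (base b) => -[x y] o; split.
- rewrite letter_count_low //= coordv_shift // coordv_double ifF; last by lia.
  by rewrite addr0; lia.
- rewrite letter_count_high; [|lia|lia].
  rewrite (_ : n.*2.+1 - n.*2 = 1); last by lia.
  rewrite /= coordv_shift // coordv_double ifF; last by lia.
  by rewrite addr0; lia.
- rewrite letter_count_slack // csum_omegaD /=.
  by move: (csum _) => s; case: o; lia.
Qed.

(* n.*2 is the letter 1bar. *)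
Lemma cnt_e0 b : match et ord0 b with
  | Some b' => if cnt b n.*2 < cnt b 1
      then [/\ cnt b 1 = (cnt b' 1).+2, cnt b' n.*2 = cnt b n.*2 & cnt b' 0 = (cnt b 0).+1]
      else [/\ cnt b' 1 = cnt b 1, cnt b' n.*2 = (cnt b n.*2).+2 & cnt b 0 = (cnt b' 0).+1]
  | None => cnt b 1 <= cnt b n.*2 /\ cnt b 0 = 0
  end.
Proof.
have n0 : 0 < n by lia.
have := et0_base b; have [-> -> ->] := cntE b; have := base_in b.
case: (et ord0 b) => [b'|].
  have [-> -> ->] := cntE b'; have := base_in b'.
  case: (base b) (base b') => -[x y] o [[x' y'] o'] /andP[/nonnegP np' tot'] /andP[/nonnegP np tot].
  move=> [E Eo]; subst o'; move: np' tot' np tot E => /=.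
  case: (ltrP (coordv y 1) (coordv x 1)) => h np' tot' np tot [? ?]; subst x' y'.
    have [x1 _] := np 1; have [x1' _] := np' 1; have [_ y1] := np 1.
    rewrite /= in x1 x1' y1; move: x1' tot'; rewrite !coordv_shift // csum_shift1 //= => x1' tot'.
    by rewrite ifT; [split | ]; lia.
  have [x1 _] := np 1; have [_ y1'] := np' 1; have [_ y1] := np 1.
  rewrite /= in x1 y1' y1; move: y1' tot'; rewrite !coordv_shift // csum_shift2 //= => y1' tot'.
  by rewrite ifF; [split | ]; lia.
case: (base b) => -[x y] o /= /andP[np tot].
have /nonnegP np1 := np; have [/= x1 y1] := np1 1.
rewrite /= in tot; move: np; rewrite nonneg_split => /andP[nx ny].
rewrite /inD /=; case: (ltrP (coordv y 1) (coordv x 1)) => h /=.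
  by rewrite csum_shift1 // nonneg_split ny nonneg_shift_down //=; lia.
by rewrite csum_shift2 // nonneg_split nx nonneg_shift_down //=; lia.
Qed.

Lemma cnt_f0_none b : ft ord0 b = None -> cnt b n.*2 <= cnt b 1 /\ cnt b 0 = 0.
Proof.
have n0 : 0 < n by lia.
move/ft0_base; have [-> -> ->] := cntE b; have := base_in b.
case: (base b) => -[x y] o /= /andP[np tot].
have /nonnegP np1 := np; have [/= x1 y1] := np1 1.
rewrite /= in tot; move: np; rewrite nonneg_split => /andP[nx ny].
rewrite /inD /=; case: (lerP (coordv y 1) (coordv x 1)) => h /=.
  by rewrite csum_shift1 // nonneg_split ny nonneg_shift_down //=; lia.
by rewrite csum_shift2 // nonneg_split nx nonneg_shift_down //=; lia.
Qed.

Lemma even_cnt b : ~~ odd (cnt b 1) /\ ~~ odd (cnt b n.*2).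
Proof. by have [-> -> _] := cntE b; rewrite !odd_double. Qed.

(** While the letters 1 prevail, a step removes two of them and adds one 0; afterwards a step uses
    up one 0. The counts of 1 and 1bar are even, so the truncated difference falls by exactly 2 in
    the first phase. *)
Lemma eps0E b : eps ord0 b = cnt b 0 + (cnt b 1 - cnt b n.*2).
Proof.
apply: (@max_string (Bl g n l) _ (fun c => cnt c 0 + (cnt c 1 - cnt c n.*2))).
  move=> c c' E; have := cnt_e0 c; rewrite E; have := even_cnt c.
  by case: ltnP => h [o1 o2] [h1 h2 h3]; lia.
by move=> c E; have := cnt_e0 c; rewrite E; lia.
Qed.

Lemma phi0E b : phi ord0 b = cnt b 0 + (cnt b n.*2 - cnt b 1).
Proof.
apply: (@max_string (Bl g n l) _ (fun c => cnt c 0 + (cnt c n.*2 - cnt c 1))).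
  move=> c c' /(Bl_axiom ord0 c c') E; have := cnt_e0 c'; rewrite E.
  have := even_cnt c.
  by case: ltnP => h [o1 o2] [h1 h2 h3]; lia.
by move=> c /cnt_f0_none; lia.
Qed.

End Level.

(** * Elements with coordinates x_1, x_2 and xbar_1 only *)

Section Level.
Variables (g : affine_type) (n l : nat).
Hypothesis n2 : 2 <= n.
Implicit Types (b : Bl g n l) (i : 'I_n.+1).

Definition hv (x1 x2 y : nat) : vec2 n :=
  ([ffun j : 'I_n => if val j == 0 then x1%:Z%R else if val j == 1 then x2%:Z%R else 0%R],
   vec_first n y).

(** Data outside the set fall back to [b_first]; the lemmas on [helt] assume [x1 + x2 + y <= l]. *)
Definition helt (x1 x2 y : nat) : Bl g n l :=
  match g return Bl g n l with
  | A2 => insubd (b_first A2 n l : Aset n l) (hv x1 x2 y)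
  | D2 => insubd (b_first D2 n l : Dset n l) (hv x1 x2 y, false)
  end.

Lemma base_inj : injective (@base g n l).
Proof.
rewrite /base; case: g => b b' /=; last exact: val_inj.
by case=> E; apply: val_inj.
Qed.

Lemma coordv_hv1 x1 x2 y a : 0 < a -> coordv (hv x1 x2 y).1 a =
  if a == 1 then x1%:Z%R else if a == 2 then x2%:Z%R else 0%R.
Proof.
case: a => // a _; rewrite /coordv /=; case: insubP => /= [j _ ja|an]; first by rewrite ffunE /= ja.
by rewrite !ifF //; lia.
Qed.

Lemma coordv_hv2 x1 x2 y a : 0 < a -> coordv (hv x1 x2 y).2 a =
  if a == 1 then y%:Z%R else 0%R.
Proof.
case: a => // a _; rewrite /coordv /=; case: insubP => /= [j _ ja|an]; first by rewrite ffunE /= ja.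
by rewrite !ifF //; lia.
Qed.

Lemma csum_hv x1 x2 y : csum (hv x1 x2 y) = (x1 + x2 + y)%N%:Z%R.
Proof.
have -> : hv x1 x2 y = (shift 2 x2 (shift 1 x1 (vec0 n)), shift 1 y (vec0 n)).
  congr pair; apply/ffunP=> -[[|[|j]] jn]; by rewrite !ffunE /= ?add0r ?addr0.
rewrite !csum_shift1 ?csum_shift2; try lia.
rewrite /csum big1 => [|j _]; first by lia.
by rewrite !ffunE.
Qed.

Lemma nonneg_hv x1 x2 y : nonneg (hv x1 x2 y).
Proof.
apply: nonneg_pos => a a0; rewrite -[[ffun _ => _]]/(hv x1 x2 y).1 coordv_hv1 //.
by rewrite -[vec_first n y]/(hv x1 x2 y).2 coordv_hv2 //; do ![case: ifP].
Qed.

Lemma base_helt x1 x2 y : x1 + x2 + y <= l -> base (helt x1 x2 y) = (hv x1 x2 y, false).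
Proof.
move=> le; have inh : inA l (hv x1 x2 y).
  by rewrite /inA nonneg_hv csum_hv lez_nat.
rewrite /base /helt; case: g => /=.
  by rewrite -[Aval _]/(val _) val_insubd inh.
by rewrite -[Dval _]/(val _) val_insubd /inD /= add0r -/(inA _ _) inh.
Qed.

Lemma eq_helt b x1 x2 y : base b = (hv x1 x2 y, false) -> x1 + x2 + y <= l /\ b = helt x1 x2 y.
Proof.
move=> E; have le : x1 + x2 + y <= l.
  by have := base_in b; rewrite E /inD /= csum_hv => /andP[_]; lia.
by split=> //; apply: base_inj; rewrite base_helt.
Qed.

Lemma vec_eqP (x y : vec n) : (forall a, 0 < a -> coordv x a = coordv y a) -> x = y.
Proof. by move=> h; apply/ffunP=> j; rewrite -!coordvE h. Qed.

Lemma cnt_helt x1 x2 y : x1 + x2 + y <= l ->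
  [/\ cnt (helt x1 x2 y) 1 = x1.*2, cnt (helt x1 x2 y) n.*2 = y.*2
    & cnt (helt x1 x2 y) 0 = l - (x1 + x2 + y)].
Proof.
move=> le; have [] := cntE n2 (helt x1 x2 y); rewrite base_helt //.
rewrite [(hv _ _ _, _).1]/= coordv_hv1 // coordv_hv2 //= => -> -> ->.
by rewrite -[([ffun _ => _], _)]/(hv x1 x2 y) csum_hv; split; lia.
Qed.

Lemma eps0_helt x1 x2 y : x1 + x2 + y <= l ->
  eps ord0 (helt x1 x2 y) = l - (x1 + x2 + y) + (x1 - y).*2.
Proof. by move=> le; rewrite eps0E //; have [-> -> ->] := cnt_helt le; lia. Qed.

Lemma phi0_helt x1 x2 y : x1 + x2 + y <= l ->
  phi ord0 (helt x1 x2 y) = l - (x1 + x2 + y) + (y - x1).*2.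
Proof. by move=> le; rewrite phi0E //; have [-> -> ->] := cnt_helt le; lia. Qed.

Lemma et0_helt_lt x1 x2 y : x1 + x2 + y <= l -> y < x1 ->
  et ord0 (helt x1 x2 y) = Some (helt x1.-1 x2 y).
Proof.
move=> le yx; have := et0_base n2 (helt x1 x2 y); have := cnt_e0 n2 (helt x1 x2 y).
have [-> -> ->] := cnt_helt le.
case: (et ord0 _) => [b' _|]; last by lia.
rewrite base_helt //= => E; congr Some; apply: (eq_helt _).2; rewrite E; congr pair.
rewrite -[vec_first n y]/(hv x1 x2 y).2 -[[ffun _ => _]]/(hv x1 x2 y).1.
rewrite coordv_hv1 // coordv_hv2 //= ltz_nat yx; congr pair.
apply: vec_eqP => a a0; rewrite -[RHS]/(coordv (hv x1.-1 x2 y).1 a).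
rewrite coordv_shift ?coordv_hv1 //; last by lia.
by case: eqP; lia.
Qed.

Lemma et0_helt_ge x1 x2 y : x1 + x2 + y < l -> x1 <= y ->
  et ord0 (helt x1 x2 y) = Some (helt x1 x2 y.+1).
Proof.
move=> lt xy; have le := ltnW lt.
have := et0_base n2 (helt x1 x2 y); have := cnt_e0 n2 (helt x1 x2 y).
have [-> -> ->] := cnt_helt le.
case: (et ord0 _) => [b' _|]; last by lia.
rewrite base_helt //= => E; congr Some; apply: (eq_helt _).2; rewrite E; congr pair.
rewrite -[vec_first n y]/(hv x1 x2 y).2 -[[ffun _ => _]]/(hv x1 x2 y).1.
rewrite coordv_hv1 // coordv_hv2 //= ltz_nat ltnNge xy /=; congr pair.
apply: vec_eqP => a a0; rewrite -[RHS]/(coordv (hv x1 x2 y.+1).2 a).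
rewrite coordv_shift ?coordv_hv2 //; last by lia.
by case: eqP; lia.
Qed.

(** e_0 lowers x_1 down to [y], then raises xbar_1; [d] counts the steps of the first kind. *)
Lemma iter_et0_helt m x1 x2 y : x1 + x2 + y <= l ->
  m <= l - (x1 + x2 + y) + (x1 - y).*2 -> let d := minn m (x1 - y) in
  iter m (obind (et ord0)) (Some (helt x1 x2 y)) = Some (helt (x1 - d) x2 (y + (m - d))).
Proof.
move=> le; elim: m => [|m IH] lem /=; first by rewrite min0n !subn0 addn0.
rewrite IH /=; last by lia.
have [lt|ge] := ltnP m (x1 - y).
  rewrite et0_helt_lt; [|lia|lia]; congr (Some (helt _ _ _)); lia.
by rewrite et0_helt_ge; [congr (Some (helt _ _ _)) | |]; lia.
Qed.

Lemma bword_helt x1 x2 y : x1 + x2 + y <= l ->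
  let s := l - (x1 + x2 + y) in
  bword (helt x1 x2 y) = nseq s n.*2.+1 ++ nseq y.*2 n.*2 ++ nseq x2.*2 2 ++
    nseq x1.*2 1 ++ nseq s 0.
Proof.
move=> le s; have [c1 cB c0] := cnt_helt le.
rewrite /bword /word_of /count_word.
have -> : rev (iota 0 n.*2.+2) = [:: n.*2.+1; n.*2] ++ rev (iota 3 (n.*2 - 3)) ++ [:: 2; 1; 0].
  rewrite -[n.*2.+2]subn0 (@iota_split 0 3) 1?(@iota_split 3 n.*2); try lia.
  by rewrite (_ : n.*2.+2 - n.*2 = 2) ?rev_cat -?catA; last by lia.
have mid a : 2 < a -> a < n.*2 -> letter_count (2 * l) (val (omega (helt x1 x2 y))) a = 0.
  move=> a2 aN; rewrite val_omega base_helt //; case: (leqP a n) => an.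
    rewrite letter_count_low //; last by lia.
    rewrite coordv_shift; try lia.
    rewrite [(hv _ _ _, _).1]/= coordv_double coordv_hv1; last by lia.
    by do ![case: ifP] => /=; lia.
  rewrite letter_count_high; try lia.
  rewrite coordv_shift; try lia.
  rewrite [(hv _ _ _, _).1]/= coordv_double coordv_hv2; last by lia.
  by do ![case: ifP] => /=; lia.
have cN : letter_count (2 * l) (val (omega (helt x1 x2 y))) n.*2.+1 = s.
  by rewrite letter_count_slack ?eqxx ?orbT // -c0 /cnt letter_count_slack.
have e2 : letter_count (2 * l) (val (omega (helt x1 x2 y))) 2 = x2.*2.
  rewrite val_omega base_helt // letter_count_low // coordv_shift; try lia.
  by rewrite coordv_double coordv_hv1 //=; case: ifP => /=; lia.
rewrite !blocks_cat (_ : blocks _ (rev _) = [::]).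
  rewrite /blocks /= cN e2; move: c1 c0 cB; rewrite /cnt => -> -> ->.
  by rewrite !cats0 -!catA.
rewrite /blocks; set s' := rev _; have : {in s', forall a, 2 < a < n.*2}.
  by move=> a; rewrite mem_rev mem_iota; lia.
elim: s' => //= a s' IH h; have /andP[h1 h2] := h a (mem_head _ _).
by rewrite mid //= IH // => c cs; apply: h; rewrite in_cons cs orbT.
Qed.

End Level.

(** * Tensor products *)

Section Level.
Variables (g : affine_type) (n : nat).
Hypothesis n2 : 2 <= n.
Notation pw j := (phw (phn n j) (epn n j)).
Notation ew j := (epw (phn n j) (epn n j)).
Notation fs j := (fw (phn n j) (epn n j) succn).

Lemma et_shift l (i : 'I_n.+1) (b b' : Bl g n l) : et i b = Some b' ->
  eps i b = (eps i b').+1 /\ phi i b' = (phi i b).+1.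
Proof.
move=> E; have [i0|i0] := posnP i.
  have Ei : i = ord0 by apply: val_inj.
  rewrite Ei !eps0E // !phi0E // in E *; have := cnt_e0 n2 b; rewrite E.
  have := even_cnt n2 b; have := even_cnt n2 b'.
  by case: ltnP => h [o1 o2] [o3 o4] [h1 h2 h3]; lia.
have F := (Bl_axiom i b' b).2 E; have k0 := kappa_gt0 g n i.
have := bword_et i0 E; have := bword_ft_pw i0 F.
by rewrite !eps_bword // !phi_bword //; case: (kappa_cases g n i) => ->; lia.
Qed.

Section Tensor.
Variables l k : nat.
Implicit Types (p : tensor (Bl g n l) (Bl g n k)) (i : 'I_n.+1).

Definition tword p : seq nat := bword p.1 ++ bword p.2.

Lemma tensor_et_ft i p p' : et i p = Some p' -> ft i p' = Some p.
Proof.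
case: p p' => b1 b2 [c1 c2] /=; case: (leqP (eps i b2) (phi i b1)) => h.
  case E: (et i b1) => [d|] //= -[<- <-]; have [_ ->] := et_shift E.
  by rewrite ltnS h (Bl_axiom i d b1).2.
case E: (et i b2) => [d|] //= -[<- <-]; have [e _] := et_shift E.
by rewrite ifF ?(Bl_axiom i d b2).2 //; lia.
Qed.

Lemma tensor_ft_et i p p' : ft i p = Some p' -> et i p' = Some p.
Proof.
case: p p' => b1 b2 [c1 c2] /=; case: (ltnP (eps i b2) (phi i b1)) => h.
  case E: (ft i b1) => [d|] //= -[<- <-].
  have E' := (Bl_axiom i b1 d).1 E; have [_ e] := et_shift E'.
  by rewrite ifT ?E' //; lia.
case E: (ft i b2) => [d|] //= -[<- <-].
have E' := (Bl_axiom i b2 d).1 E; have [e _] := et_shift E'.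
by rewrite ifF ?E' //; lia.
Qed.

(** Both sides of the comparison in the tensor rule are scaled by the same [kappa], so [kappa]
    consecutive lowering steps on the word stay in one factor. *)
Lemma tword_ft i p p' : 0 < i -> ft i p = Some p' ->
  kappa g n i <= pw i (tword p) /\ iter (kappa g n i) (fs i) (tword p) = tword p'.
Proof.
move=> i0; case: p p' => b1 b2 [c1 c2] /=; rewrite /tword /=.
have e2 := eps_bword n2 b2 i0; have f1 := phi_bword n2 b1 i0.
have k0 := kappa_gt0 g n i; set q := kappa g n i in k0 e2 f1 *.
case: (ltnP (eps i b2) (phi i b1)) => h.
  case E: (ft i b1) => [d|] //= -[<- <-]; have [le <-] := bword_ft i0 E.
  rewrite -/q /=.
  have lt : q <= pw i (bword b1) - ew i (bword b2).
    by rewrite e2 f1 -mulnBr leq_pmulr // subn_gt0.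
  have le2 : q <= pw i (bword b1 ++ bword b2) by rewrite phw_cat; lia.
  split=> //; apply: (@iter_fs_cat n i (ord_leq i) q) => //; first by lia.
  by rewrite subnn.
case E: (ft i b2) => [d|] //= -[<- <-]; have [le <-] := bword_ft i0 E.
rewrite -/q /=.
have z : pw i (bword b1) - ew i (bword b2) = 0.
  by rewrite e2 f1 -mulnBr (eqP (_ : phi i b1 - eps i b2 == 0)) ?muln0 ?subn_eq0.
have le2 : q <= pw i (bword b1 ++ bword b2) by rewrite phw_cat; rewrite -/q in le; lia.
split=> //; apply: (@iter_fs_cat n i (ord_leq i) 0) => //; first by lia.
by rewrite subn0.
Qed.

Lemma tword_ft_none i p : 0 < i -> ft i p = None -> pw i (tword p) = 0.
Proof.
move=> i0; case: p => b1 b2 /=; rewrite /tword /= phw_cat.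
rewrite (eps_bword n2 b2 i0) (phi_bword n2 b1 i0) -mulnBr.
case: (ltnP (eps i b2) (phi i b1)) => h.
  case E: (ft i b1) => //= _; have := bword_ft_none i0 E.
  by rewrite phi_bword //; have := kappa_gt0 g n i; nia.
case E: (ft i b2) => //= _; have -> := bword_ft_none i0 E.
by rewrite (eqP (_ : phi i b1 - eps i b2 == 0)) ?muln0 ?subn_eq0.
Qed.

Lemma tword_et_none i p : 0 < i -> et i p = None ->
  ew i (bword p.1) = 0 /\ ew i (bword p.2) <= pw i (bword p.1).
Proof.
move=> i0; case: p => b1 b2 /=.
rewrite (eps_bword n2 b2 i0) (phi_bword n2 b1 i0) leq_pmul2l ?kappa_gt0 //.
case: (leqP (eps i b2) (phi i b1)) => h.
  by case E: (et i b1) => //= _; rewrite (bword_et_none i0 E).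
case E: (et i b2) => //= _; have := bword_et_none i0 E.
by rewrite eps_bword //; have := kappa_gt0 g n i; nia.
Qed.

(* The number of steps of a string of e_0 that act on the right factor. *)
Definition right0 p : nat := eps ord0 p.2 - phi ord0 p.1.

Lemma right0_et p p' : et ord0 p = Some p' -> right0 p' = (right0 p).-1.
Proof.
case: p p' => b1 b2 [c1 c2] /=; rewrite /right0 /=; case: (leqP (eps ord0 b2) (phi ord0 b1)) => h.
  by case E: (et ord0 b1) => [d|] //= -[<- <-]; have [_ ->] := et_shift E; lia.
by case E: (et ord0 b2) => [d|] //= -[<- <-]; have [-> _] := et_shift E; lia.
Qed.

Lemma right0_iter m p p' :
  iter m (obind (et ord0)) (Some p) = Some p' -> right0 p' = right0 p - m.
Proof.
elim: m p' => [|m IH] p' /=; first by case=> ->; rewrite subn0.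
case: (iter _ _ _) IH => // c /(_ _ erefl) E h.
by rewrite (right0_et h) E; lia.
Qed.

Lemma tensor_et0_right m b1 b2 c2 : m <= right0 (b1, b2) ->
  iter m (obind (et ord0)) (Some b2) = Some c2 ->
  iter m (obind (et ord0)) (Some ((b1, b2) : tensor (Bl g n l) (Bl g n k))) =
  Some (b1, c2).
Proof.
elim: m c2 => [|m IH] c2 le /=; first by case=> ->.
case E: (iter _ _ _) => [d|] //= Ed; rewrite (IH d) //=; last by lia.
have := right0_iter (IH d (ltnW le) E); rewrite /right0 /= in le * => h.
by rewrite ifF ?Ed //; lia.
Qed.

Lemma tensor_et0_left m b1 b2 c1 : right0 (b1, b2) = 0 ->
  iter m (obind (et ord0)) (Some b1) = Some c1 ->
  iter m (obind (et ord0)) (Some ((b1, b2) : tensor (Bl g n l) (Bl g n k))) =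
  Some (c1, b2).
Proof.
move=> r0; elim: m c1 => [|m IH] c1 /=; first by case=> ->.
case E: (iter _ _ _) => [d|] //= Ed; rewrite (IH d) //=.
have := right0_iter (IH d E); rewrite r0 sub0n /right0 /= => h.
by rewrite ifT ?Ed //; lia.
Qed.

Lemma tensor_et0 m1 m2 b1 b2 c1 c2 : m2 = right0 (b1, b2) ->
  iter m1 (obind (et ord0)) (Some b1) = Some c1 ->
  iter m2 (obind (et ord0)) (Some b2) = Some c2 ->
  iter (m1 + m2) (obind (et ord0)) (Some ((b1, b2) : tensor (Bl g n l) (Bl g n k))) =
  Some (c1, c2).
Proof.
move=> e h1 h2; have E : m2 <= right0 (b1, b2) by rewrite e.
have E2 := tensor_et0_right E h2; rewrite iterD E2; apply: tensor_et0_left h1.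
by rewrite (right0_iter E2) -e subnn.
Qed.

Lemma size_bword (b : Bl g n l) : size (bword b) = 2 * l.
Proof.
rewrite /bword -word_of_row_word size_map size_rev /row_word.
case: (omega b) => -[x y] /= /and3P[/forallP np tot /dvdzP[q qE]].
have sz (u : vec n) (f : 'I_n -> letter n) s : perm_eq s (enum 'I_n) ->
    size (flatten [seq nseq `|u j|%N (f j) | j <- s]) = \sum_j `|u j|%N.
  move=> sp; rewrite size_flatten /shape -map_comp sumnE big_map.
  rewrite (perm_big _ sp) big_enum; apply: eq_bigr => j _.
  by rewrite /= size_nseq.
rewrite !size_cat !size_nseq !sz ?perm_rev //.
have E : csum (x, y) = ((\sum_j `|x j|%N)%N%:Z + (\sum_j `|y j|%N)%N%:Z)%R.
  rewrite /csum big_split /= !(big_morph Posz PoszD (erefl _)); congr (_ + _)%R.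
    by apply: eq_bigr => j _; have /andP[x0 _] := np j; rewrite gez0_abs.
  by apply: eq_bigr => j _; have /andP[_ y0] := np j; rewrite gez0_abs.
rewrite E in qE tot *; move: (\sum_j _) (\sum_j _) qE tot => u v; lia.
Qed.

End Tensor.

End Level.

Lemma steps_fun n path u v v' : steps n path u v -> steps n path u v' -> v = v'.
Proof.
elim: path u => [|[j k] path IH] u /=; first by move=> <- <-.
by case=> _ _ h [_ _ h']; apply: IH h h'.
Qed.

(** * The isomorphism and the energy function *)

Section Iso.
Variables (g : affine_type) (n l k : nat).
Hypothesis n2 : 2 <= n.
Notation pw j := (phw (phn n j) (epn n j)).
Notation fs j := (fw (phn n j) (epn n j) succn).
Variable iota : tensor (Bl g n l) (Bl g n k) -> tensor (Bl g n k) (Bl g n l).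
Hypothesis hiota : crystal_iso iota.
Variable H : tensor (Bl g n l) (Bl g n k) -> int.
Hypothesis hH : energy_function iota H.
Implicit Types (p : tensor (Bl g n l) (Bl g n k)) (i : 'I_n.+1).

Lemma tword_inj (l' k' : nat) (p p' : tensor (Bl g n l') (Bl g n k')) :
  tword p = tword p' -> p = p'.
Proof.
case: p p' => b1 b2 [c1 c2] /cat_inj[]; first by rewrite !size_bword.
by move=> /(bword_inj n2) /= -> /(bword_inj n2) /= ->.
Qed.

Lemma iota_ft i p p' : ft i p = Some p' -> ft i (iota p) = Some (iota p').
Proof. by case: hiota => _ _ ->; move=> ->. Qed.

Lemma iota_et i p p' : et i p = Some p' -> et i (iota p) = Some (iota p').
Proof. by case: hiota => _ -> _; move=> ->. Qed.

Lemma energy_ft i p p' : 0 < i -> ft i p = Some p' -> H p' = H p.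
Proof.
move=> i0 /(tensor_ft_et n2)/hH; rewrite /energy_step ifT; first by lia.
by rewrite -val_eqE /= -lt0n.
Qed.

(** [ft] fails only where phi of the word is 0, so the string on words lifts to the crystal. Its
    image under [iota] follows the same string, and [H] changes along node 0 only. *)
Lemma lift_iter i m p : 0 < i -> kappa g n i * m <= pw i (tword p) ->
  exists p', [/\ tword p' = iter (kappa g n i * m) (fs i) (tword p),
    kappa g n i * m <= pw i (tword (iota p)),
    tword (iota p') = iter (kappa g n i * m) (fs i) (tword (iota p)) & H p' = H p].
Proof.
move=> i0; elim: m => [|m IH]; first by rewrite muln0; exists p.
rewrite mulnS => le; have [|p1 [e1 le1 e2 e3]] := IH; first by lia.
have jn := ord_leq i.
have pe u m' : m' <= pw i u -> pw i (iter m' (fs i) u) = pw i u - m'.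
  by apply: phw_iter; [exact: phn_epn | exact: phn_succ | exact: epn_succ].
have k0 := kappa_gt0 g n i.
case E: (ft i p1) => [p2|]; last first.
  by have := tword_ft_none n2 i0 E; rewrite e1 pe; lia.
have [l1 E1] := tword_ft n2 i0 E; have [l2 E2] := tword_ft n2 i0 (iota_ft E).
exists p2; rewrite !iterD -e1 -e2 E1 E2 (energy_ft i0 E); split=> //.
by move: l2; rewrite e2 pe; lia.
Qed.

Definition good_path (path : seq (nat * nat)) : bool :=
  all (fun jk => (0 < jk.1) && (kappa g n jk.1 %| jk.2)) path.

Lemma lift_steps path p u : good_path path -> steps n path (tword p) u ->
  exists p', [/\ tword p' = u, steps n path (tword (iota p)) (tword (iota p'))
    & H p' = H p].
Proof.
elim: path p => [|[j e] path IH] p /=; first by move=> _ <-; exists p.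
case/andP=> /andP[j0 /dvdnP[m em]] gp [jn le st]; rewrite mulnC in em; subst e.
pose i : 'I_n.+1 := Ordinal (jn : j < n.+1).
have [p1 [e1 le1 e2 e3]] := @lift_iter i m p j0 le.
have [|p' [h1 h2 h3]] := IH p1 gp; first by rewrite e1.
by exists p'; rewrite h3 e3; split=> //; split=> //; rewrite -e2.
Qed.

Lemma iter_iota_et i m p p' : iter m (obind (et i)) (Some p) = Some p' ->
  iter m (obind (et i)) (Some (iota p)) = Some (iota p').
Proof.
elim: m p' => [|m IH] p' /=; first by case=> ->.
by case E: (iter _ _ _) => [c|] // Ec; rewrite (IH _ E); apply: iota_et Ec.
Qed.

(** A step counts -1 as long as both strings act on their right factors, that is up to the minimum
    of the two [right0], and +1 once both act on their left factors, that is beyond the maximum. *)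
Lemma energy_string m p p' : iter m (obind (et ord0)) (Some p) = Some p' ->
  H p' = (H p + (m - maxn (right0 p) (right0 (iota p)))%N%:Z
    - (minn m (minn (right0 p) (right0 (iota p))))%N%:Z)%R.
Proof.
elim: m p' => [|m IH] p' /=; first by case=> ->; lia.
case E: (iter _ _ _) => [c|] //= Ec; have Hc := IH _ E.
have r1 := right0_iter n2 E; have r2 := right0_iter n2 (iter_iota_et E).
have := hH Ec; rewrite /energy_step eqxx /=; move: r1 r2 Hc; rewrite /right0.
move: (eps ord0 c.2) (phi ord0 c.1) (eps ord0 (iota c).2) (phi ord0 (iota c).1).
move=> e1 f1 e2 f2 r1 r2 ->.
by do ![case: ifP]; lia.
Qed.

Lemma et_inj i (q q' r : tensor (Bl g n k) (Bl g n l)) m :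
  iter m (obind (et i)) (Some q) = Some r ->
  iter m (obind (et i)) (Some q') = Some r -> q = q'.
Proof.
elim: m r => [|m IH] r /=; first by case=> -> [->].
case E: (iter _ _ _) => [c|] //= Ec; case E': (iter _ _ _) => [c'|] //= Ec'.
have := tensor_et_ft n2 Ec; rewrite (tensor_et_ft n2 Ec') => -[ec].
by apply: IH E _; rewrite E' ec.
Qed.

Lemma cnt_count l' (b : Bl g n l') a : a <= n.*2.+1 -> cnt b a = count_mem a (bword b).
Proof. by move=> aN; rewrite /bword /word_of count_mem_word. Qed.

Lemma cnt_le l' (b : Bl g n l') a : a <= n.*2.+1 -> cnt b a <= 2 * l'.
Proof. by move=> aN; rewrite cnt_count // -(size_bword n2 b) count_size. Qed.

Lemma eq_first l' (b : Bl g n l') : cnt b 1 = 2 * l' -> b = helt g n l' l' 0 0.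
Proof.
have n0 : 1 <= n.*2.+1 by [].
move=> c1; apply: bword_inj => //; rewrite bword_helt ?addn0 // subnn /= cats0.
have : all (pred1 1) (bword b) by rewrite all_count -cnt_count // c1 size_bword.
by move/all_pred1P->; rewrite size_bword // mul2n.
Qed.

(** The weight along e_0: in both cases of [cnt_e0] the number of letters 1 minus that of letters
    1bar falls by 2. *)
Lemma cnt_string m l' k' (p p' : tensor (Bl g n l') (Bl g n k')) :
  iter m (obind (et ord0)) (Some p) = Some p' ->
  cnt p.1 1 + cnt p.2 1 + cnt p'.1 n.*2 + cnt p'.2 n.*2 =
  cnt p'.1 1 + cnt p'.2 1 + cnt p.1 n.*2 + cnt p.2 n.*2 + m.*2.
Proof.
elim: m p' => [|m IH] p' /=; first by case=> ->; lia.
case E: (iter _ _ _) => [c|] //=; have := IH _ E; case: c {E IH} => b1 b2.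
case: p p' => a1 a2 [c1 c2] /= h.
case: leqP => _.
  case Eb: (et ord0 b1) => [d|] //= -[<- <-]; have := cnt_e0 n2 b1; rewrite Eb.
  by case: ltnP => _ [h1 h2 h3]; lia.
case Eb: (et ord0 b2) => [d|] //= -[<- <-]; have := cnt_e0 n2 b2; rewrite Eb.
by case: ltnP => _ [h1 h2 h3]; lia.
Qed.

(** The e_0-string of length 2l + 2k leads from letters 1 only to letters 1bar only. The image has
    an equally long string, and by [cnt_string] such a drop is the largest that words of these
    lengths allow, so the image is forced. *)
Lemma iota_first : iota (helt g n l l 0 0, helt g n k k 0 0) =
  (helt g n k k 0 0, helt g n l l 0 0).
Proof.
have h1 : iter (2 * l) (obind (et ord0)) (Some (helt g n l l 0 0)) = Some (helt g n l 0 0 l).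
  rewrite iter_et0_helt ?addn0 //; last by lia.
  by congr (Some (helt _ _ _ _ _ _)); lia.
have h2 : iter (2 * k) (obind (et ord0)) (Some (helt g n k k 0 0)) = Some (helt g n k 0 0 k).
  rewrite iter_et0_helt ?addn0 //; last by lia.
  by congr (Some (helt _ _ _ _ _ _)); lia.
have r0 : 2 * k = right0 (helt g n l l 0 0, helt g n k k 0 0).
  by rewrite /right0 eps0_helt ?phi0_helt ?addn0 //=; lia.
have := cnt_string (iter_iota_et (tensor_et0 n2 r0 h1 h2)).
case: (iota _) => c1 c2; case: (iota _) => d1 d2 /= E.
have n1 : 1 <= n.*2.+1 by []; have nB : n.*2 <= n.*2.+1 by [].
have := cnt_le c1 n1; have := cnt_le c2 n1; have := cnt_le d1 nB; have := cnt_le d2 nB.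
by move=> *; congr pair; apply: eq_first; lia.
Qed.

End Iso.

(** * Arithmetic of the highest weight data *)

Lemma min3_add A B C c v : v <= A + c -> v <= B + c -> v <= C + c ->
  [|| A + c <= v, B + c <= v | C + c <= v] -> minn (minn A B) C + c = v.
Proof. by move=> *; lia. Qed.

Ltac split_cases cases :=
  case: cases => [[[? ?] [? ?]]|[[[? ?] [? ?]]|[[? ?] [? ?]]]].

(* The highest weight element with data a, x1, x2, y in B_l (x) B_k is sent by
   iota to the one with data a', x1', x2, y' in B_k (x) B_l. The numbers c and c'
   count the steps on the right factor of the e_0-strings that lead to the same
   pair (X, S), and the last equations say that both elements are reached from
   a top word by the same path of [steps_hw]. *)
Lemma hw_arith (l k a x1 x2 y t s : nat) : l = a + t -> k = s + (x1 + x2 + y) -> x2 + y <= a ->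
  forall c d X Y,
  c = s + (x1 - y).*2 - t -> d = minn c (x1 - y) ->
  X = x1 - d -> Y = y + (c - d) ->
  exists a' x1' y' t' s' c' d' S : nat,
  [/\ k = a' + t', l = s' + (x1' + x2 + y'),
   c' = s' + (x1' - y').*2 - t' & d' = minn c' (x1' - y')] /\
  [/\ x1' = X + d', y' + (c' - d') + k = Y + l, l + a + c = k + a' + c', minn t s = minn t' s'
   & k = S + (X + x2 + Y)] /\
  [/\ t + s + y.*2 = t' + s' + y'.*2,
    minn x1.*2 (t - s + y.*2) = minn x1'.*2 (t' - s' + y'.*2),
    minn (minn (k.*2 - (s - t)) (l.*2 - (t - s))) (t + s + y.*2.*2 + x2.*2) + c' = S + l + a
  & minn (minn (l.*2 - (s' - t')) (k.*2 - (t' - s'))) (t' + s' + y'.*2.*2 + x2.*2) + c' =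
      S + l + a].
Proof.
move=> el ek ya c d X Y ec ed eX eY.
(* Three regimes of the e_0-string on the right factor: no step, steps on x_1 only, steps on x_1 and
   then on xbar_1. *)
have {ec ed eX eY} cases :
   ((c = 0 /\ s + (x1 - y).*2 <= t) /\ (X = x1 /\ Y = y)) \/
   ((c + t = s + (x1 - y).*2 /\ s + (x1 - y) <= t < s + (x1 - y).*2) /\ (X + c = x1 /\ Y = y)) \/
   ((c + t = s + (x1 - y).*2 /\ t <= s + (x1 - y)) /\ (X + (x1 - y) = x1 /\
     Y + t = y + s + (x1 - y))).
  case: (leqP (s + (x1 - y).*2) t) => h1.
    by left; split; lia.
  case: (leqP (s + (x1 - y)) t) => h2.
    by right; left; lia.
  by right; right; lia.
have kY : k <= Y + l by lia.
(* [Y2] is xbar_1 in the right factor of the image of the common end point. This factor has the same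
   [X], [x2] and slack [S], now in B_l. *)
have [Y2 eY2] : exists Y2, Y2 + k = Y + l by exists (Y + l - k); lia.
have [S eS] : exists S, k = S + (X + x2 + Y) by exists (k - (X + x2 + Y)); lia.
have eS2 : l = S + (X + x2 + Y2) by lia.
(* [E] is epsilon_0 of (X, x2, Y2) in B_l. Going back by f_0 from (1bar^k) (x) (X, x2, Y2), the left
   factor, with phi_0 = 2k, is acted on until its phi_0 falls to [E]. So it takes the minimum of l +
   a + c and 2k - E steps, and the right factor takes the other [c']. *)
have [E eE] : exists E, E = S + (X - Y2).*2 by exists (S + (X - Y2).*2).
have Ek : E <= k.*2 by lia.
have [a' [c' [t' [ek' eN tc]]]] : exists a' c' t', [/\ k = a' + t', l + a + c = k + a' + c' &
    (t' = E \/ c' = 0 /\ E <= t')].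
  have [hN|hN] := leqP (l + a + c) (k.*2 - E).
    by exists (l + a + c - k), 0, (k.*2 - (l + a + c)); split; [lia|lia|right; lia].
  by exists (k - E), (l + a + c - (k.*2 - E)), E; split; [lia|lia|left].
(* Undoing [c'] steps on the right factor lowers xbar_1 while it exceeds x_1, and then raises x_1.
   The cases are Y2 <= X, c' <= Y2 - X and c' > Y2 - X. *)
have [h|h] := leqP Y2 X.
  have [s' [es' ms]] : exists s', S = s' + c' /\ minn t s = minn t' s'.
    have cS : c' <= S by case: tc => [?|[-> _]] //; lia.
    exists (S - c'); split; first by rewrite subnK.
    rewrite (minn_idPr (_ : S - c' <= t')); last by clear cases; lia.
    split_cases cases; lia.
  exists a', (X + c'), Y2, t', s', c', c', S.
  split; first by clear cases; split; lia.
  split; first by clear cases; split; lia.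
  case: tc => tc; case: (leqP t s) => ?; case: (leqP x1 y) => ?; split_cases cases;
    try (exfalso; lia); split; try apply: min3_add; lia.
have [v ev] : exists v, Y2 = X + v by exists (Y2 - X); lia.
have [hc|hc] := leqP c' v.
  exists a', X, (Y2 - c'), t', (S + c'), c', 0, S.
  have ms : minn t s = minn t' (S + c').
    split_cases cases; lia.
  split; first by clear cases; split; lia.
  split; first by clear cases; split; lia.
  case: tc => tc; case: (leqP t s) => ?; case: (leqP x1 y) => ?; split_cases cases;
    try (exfalso; lia); split; try apply: min3_add; lia.
have [w ew] : exists w, c' = v + w by exists (c' - v); lia.
have {tc} tS : t' = S by lia.
have [s' [es' ms]] : exists s', s' + w = S + v /\ minn t s = minn t' s'.
  exists (S + v - w).
  split_cases cases; lia.
exists a', (X + w), X, t', s', c', w, S.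
split; first by clear cases; split; lia.
split; first by clear cases; split; lia.
case: (leqP t s) => ?; case: (leqP x1 y) => ?; split_cases cases;
  try (exfalso; lia); split; try apply: min3_add; lia.
Qed.

(** * Classical highest weight elements, images and energies *)

Section HighestWeight.
Variables (g : affine_type) (n : nat).
Hypothesis n2 : 2 <= n.
Notation pw j := (phw (phn n j) (epn n j)).
Notation ew j := (epw (phn n j) (epn n j)).

Lemma b_firstE l : b_first g n l = helt g n l l 0 0.
Proof.
apply: (eq_helt n2 _).2; rewrite /base /b_first.
by case: g; congr ((_, _), _); apply/ffunP=> j; rewrite !ffunE //; do ![case: ifP].
Qed.

Lemma b_first_barE l : b_first_bar g n l = helt g n l 0 0 l.
Proof.
apply: (eq_helt n2 _).2; rewrite /base /b_first_bar.
by case: g; congr ((_, _), _); apply/ffunP=> j; rewrite !ffunE //; do ![case: ifP].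
Qed.

Lemma helt_of l (b : Bl g n l) :
  (forall a, 2 < a -> a <= n -> coordv (base b).1.1 a = 0%R) ->
  (forall a, 1 < a -> a <= n -> coordv (base b).1.2 a = 0%R) ->
  (base b).2 = false ->
  exists x1 x2 y, x1 + x2 + y <= l /\ b = helt g n l x1 x2 y.
Proof.
move=> hx hy ho; have /andP[/nonnegP np _] := base_in b.
exists `|coordv (base b).1.1 1|%N, `|coordv (base b).1.1 2|%N, `|coordv (base b).1.2 1|%N.
apply: (eq_helt n2); move: hx hy ho np; case: (base b) => -[x y] o /= hx hy -> np.
have out (u : vec n) a : n < a -> coordv u a = 0%R.
  by case: a => // a an; rewrite /coordv /= insubF //; lia.
congr ((_, _), _); apply: vec_eqP => a a0.
  rewrite -[RHS]/(coordv (hv n _ _ 0).1 a) coordv_hv1 //.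
  case: eqP => [->|n1]; first by have [] := np 1; lia.
  case: eqP => [->|n3]; first by have [] := np 2; lia.
  by case: (leqP a n) => an; [apply: hx; lia | rewrite out].
rewrite -[RHS]/(coordv (hv n 0 0 _).2 a) coordv_hv2 //.
case: eqP => [->|n1]; first by have [] := np 1; lia.
by case: (leqP a n) => an; [apply: hy; lia | rewrite out].
Qed.

Lemma omega_coordv l (b : Bl g n l) a : 0 < a -> a <= n ->
  `|coordv (val (omega b)).1 a|%N = (`|coordv (base b).1.1 a|%N).*2 +
     (if a == n then (base b).2 : nat else 0) /\
  `|coordv (val (omega b)).2 a|%N = (`|coordv (base b).1.2 a|%N).*2 +
     (if a == n then (base b).2 : nat else 0).
Proof.
move=> a0 an; have n0 : 0 < n by lia.
have /andP[/nonnegP np _] := base_in b; rewrite val_omega.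
move: np; case: (base b) => -[x y] o /= np.
rewrite !coordv_shift // !coordv_double; have [] := np a.
by case: eqP => _ /=; lia.
Qed.

Lemma omega_helt l x1 x2 y : x1 + x2 + y <= l -> let w := val (omega (helt g n l x1 x2 y)) in
  [/\ `|coordv w.1 1|%N = x1.*2, `|coordv w.1 2|%N = x2.*2, `|coordv w.2 1|%N = y.*2
    & `|coordv w.2 2|%N = 0].
Proof.
move=> le w; have n0 : 0 < n by lia.
have [] := @omega_coordv l (helt g n l x1 x2 y) 1 isT n0; rewrite -/w => -> ->.
have [] := @omega_coordv l (helt g n l x1 x2 y) 2 isT n2; rewrite -/w => -> ->.
rewrite base_helt // -[(_, false).1]/(hv n x1 x2 y) -[(_, false).2]/false.
rewrite !coordv_hv1 // !coordv_hv2 //=.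
by rewrite !if_same !addn0.
Qed.

(** The left factor has to be of highest weight, so only its x_1 = a is nonzero, and its phi is
    positive at node 1 alone. The condition that epsilon of the right factor is at most this phi
    then leaves x_1, x_2, xbar_1, with x_2 + xbar_1 <= a. *)
Lemma hw_shape l k (p : tensor (Bl g n l) (Bl g n k)) :
  (forall i : 'I_n.+1, 0 < i -> et i p = None) ->
  exists a x1 x2 y, [/\ a <= l, x1 + x2 + y <= k, x2 + y <= a
    & p = (helt g n l a 0 0, helt g n k x1 x2 y)].
Proof.
case: p => b1 b2 hw.
have W i : 0 < i -> i <= n -> ew i (bword b1) = 0 /\ ew i (bword b2) <= pw i (bword b1).
  move=> i0 iN; pose j : 'I_n.+1 := Ordinal (iN : i < n.+1).
  exact: (@tword_et_none g n n2 l k j (b1, b2) i0 (hw j i0)).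
have n0 : 0 < n by lia.
have L l' (b : Bl g n l') := @word_of_last n (2 * l') (val (omega b)) n0.
have [e1 e2] := W n n0 (leqnn n); rewrite /bword (L l b1).1 (L l b1).2 (L k b2).2 in e1 e2.
have M i : 0 < i -> i < n ->
    [/\ `|coordv (val (omega b1)).2 i|%N = 0,
        `|coordv (val (omega b1)).1 i.+1|%N <= `|coordv (val (omega b1)).2 i.+1|%N &
        `|coordv (val (omega b2)).2 i|%N +
          (`|coordv (val (omega b2)).1 i.+1|%N - `|coordv (val (omega b2)).2 i.+1|%N) <=
        `|coordv (val (omega b1)).1 i|%N +
          (`|coordv (val (omega b1)).2 i.+1|%N - `|coordv (val (omega b1)).1 i.+1|%N)].
  move=> i0 iN; have [] := W i i0 (ltnW iN); rewrite /bword.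
  have [f1 g1] := word_of_lt (2 * l) (val (omega b1)) i0 iN.
  have [f2 g2] := word_of_lt (2 * k) (val (omega b2)) i0 iN.
  rewrite f1 g1 g2; clear; do ?move: (absz _) => ?.
  by move=> h1 h2; split; lia.
have Y1 a : 0 < a -> a <= n -> `|coordv (val (omega b1)).2 a|%N = 0.
  by move=> a0; rewrite leq_eqVlt => /predU1P[->|an] //; have [] := M a a0 an.
have X1 a : 1 < a -> a <= n -> `|coordv (val (omega b1)).1 a|%N = 0.
  case: a => // a a1 an; have [_ h _] := M a a1 an.
  by move: h; rewrite Y1 //; lia.
have Y2 a : 1 < a -> a <= n -> `|coordv (val (omega b2)).2 a|%N = 0.
  move=> a1; rewrite leq_eqVlt => /predU1P[->|an]; first by have := X1 n n2 (leqnn n); lia.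
  by have [_ _] := M a (ltnW a1) an; rewrite (X1 a) ?(ltnW an) // Y1; lia.
have X2 a : 2 < a -> a <= n -> `|coordv (val (omega b2)).1 a|%N = 0.
  case: a => // a a1 an; have [_ _] := M a (ltnW a1) an.
  by rewrite (X1 a) ?(ltnW an) // Y1 // (Y2 a.+1) //; lia.
have ob l' (b : Bl g n l') : `|coordv (val (omega b)).2 n|%N = 0 -> (base b).2 = false.
  by move=> h; have [_] := omega_coordv b n0 (leqnn n); rewrite h eqxx; case: (base b).2; lia.
have o1 := ob _ b1 (Y1 n n0 (leqnn n)); have o2 := ob _ b2 (Y2 n n2 (leqnn n)).
have z1 l' (b : Bl g n l') a : 0 < a -> a <= n -> `|coordv (val (omega b)).1 a|%N = 0 ->
    coordv (base b).1.1 a = 0%R.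
  by move=> a0 an h; have [] := omega_coordv b a0 an; rewrite h; lia.
have z2 l' (b : Bl g n l') a : 0 < a -> a <= n -> `|coordv (val (omega b)).2 a|%N = 0 ->
    coordv (base b).1.2 a = 0%R.
  by move=> a0 an h; have [_] := omega_coordv b a0 an; rewrite h; lia.
have [a [x [y [le1 E1]]]] : exists x1 x2 y, x1 + x2 + y <= l /\ b1 = helt g n l x1 x2 y.
  apply: helt_of => // c c0 cn; [apply: z1 | apply: z2] => //; try lia.
    by apply: X1 => //; lia.
  by apply: Y1 => //; lia.
have [x1 [x2 [y2 [le2 E2]]]] : exists x1 x2 y, x1 + x2 + y <= k /\ b2 = helt g n k x1 x2 y.
  apply: helt_of => // c c0 cn; [apply: z1 | apply: z2] => //; try lia.
    by apply: X2.
  by apply: Y2.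
have [_ _] := M 1 isT n2; subst b1 b2.
have := Y1 1 isT n0; have := X1 2 isT n2; have := Y2 2 isT n2.
have [-> -> -> ->] := omega_helt le1; have [_ -> -> ->] := omega_helt le2.
move=> _ x0 y0 h; have [ex ey] : x = 0 /\ y = 0 by lia.
by subst x y; exists a, x1, x2, y2; split=> //; lia.
Qed.

Section Iota.
Variables l k : nat.
Variable iota : tensor (Bl g n l) (Bl g n k) -> tensor (Bl g n k) (Bl g n l).
Hypothesis hiota : crystal_iso iota.
Variable H : tensor (Bl g n l) (Bl g n k) -> int.
Hypothesis hH : energy_function iota H.
Hypothesis hH0 : H (b_first g n l, b_first_bar g n k) = 0%R.
Notation h_ l := (helt g n l).

Lemma iter_et0_first l' m : m <= l' ->
  iter m (obind (et ord0)) (Some (h_ l' l' 0 0)) = Some (h_ l' (l' - m) 0 0).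
Proof.
move=> ml; rewrite iter_et0_helt ?addn0 //; last by lia.
by rewrite subn0 (minn_idPl ml) subnn.
Qed.

(** The normalizing element is e_0^(2k) of this one. All these steps act on the right factor, and in
    the image the first 2l do, so [H] loses the minimum of 2k and 2l and arrives at 0. *)
Lemma energy_first : H (h_ l l 0 0, h_ k k 0 0) = ((minn l k).*2)%:Z%R.
Proof.
have h2 : iter (2 * k) (obind (et ord0)) (Some (h_ k k 0 0)) = Some (h_ k 0 0 k).
  rewrite iter_et0_helt ?addn0 //; last by lia.
  by congr (Some (helt _ _ _ _ _ _)); lia.
have r0 : right0 (h_ l l 0 0, h_ k k 0 0) = 2 * k.
  by rewrite /right0 eps0_helt ?phi0_helt ?addn0 //=; lia.
have r1 : right0 (h_ k k 0 0, h_ l l 0 0) = 2 * l.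
  by rewrite /right0 eps0_helt ?phi0_helt ?addn0 //=; lia.
have le : 2 * k <= right0 (h_ l l 0 0, h_ k k 0 0) by rewrite r0.
have := energy_string n2 hiota hH (tensor_et0_right n2 le h2).
by rewrite iota_first // r0 r1 -b_firstE -b_first_barE hH0; lia.
Qed.

Lemma bar_path_good P X2 : good_path g n (bar_path n P.*2 X2.*2).
Proof.
have ev j m : kappa g n j %| m.*2.
  by case: (kappa_cases g n j) => ->; rewrite ?dvd1n // -muln2 dvdn_mull.
rewrite /good_path /bar_path /= all_cat /= -doubleD !ev !andbT /=.
by apply/allP=> jk /mapP[i]; rewrite mem_iota => h -> /=; rewrite ev; lia.
Qed.

Lemma steps_bar_helt l' k' X x2 Y S : S + (X + x2 + Y) = k' ->
  steps n (bar_path n (l' + Y).*2 x2.*2) (tword (h_ l' l' 0 0, h_ k' (k' - S) 0 0))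
    (tword (h_ l' 0 0 l', h_ k' X x2 Y)).
Proof.
move=> e; rewrite /tword !bword_helt ?addn0; try lia.
have := steps_bar_path n2 0 l'.*2 0 S Y.*2 x2.*2 X.*2 S; rewrite /= -doubleD.
have -> : k' - (k' - S) = S by lia.
have -> : k' - (X + x2 + Y) = S by lia.
have -> : (k' - S).*2 = Y.*2 + x2.*2 + X.*2 by lia.
by rewrite subnn /= !cats0.
Qed.

(** Apply e_0^S to the pair of [iota_first]: all steps act on the right factors of both sides, which
    costs [S] in [H]. Since l + Y = k + Y', one [bar_path] then serves both sides, and a path
    determines its end point. *)
Lemma iota_bar X x2 Y Y' S : S + (X + x2 + Y) = k -> S + (X + x2 + Y') = l ->
  iota (h_ l 0 0 l, h_ k X x2 Y) = (h_ k 0 0 k, h_ l X x2 Y') /\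
  H (h_ l 0 0 l, h_ k X x2 Y) = ((minn l k).*2%:Z - S%:Z)%R.
Proof.
move=> ek el.
have r0 : S <= right0 (h_ l l 0 0, h_ k k 0 0).
  by rewrite /right0 eps0_helt ?phi0_helt ?addn0 //=; lia.
have r1 : S <= right0 (h_ k k 0 0, h_ l l 0 0).
  by rewrite /right0 eps0_helt ?phi0_helt ?addn0 //=; lia.
have Sk : S <= k by lia.
have Sl : S <= l by lia.
have s1 := tensor_et0_right n2 r0 (iter_et0_first Sk).
have s2 := tensor_et0_right n2 r1 (iter_et0_first Sl).
have := iter_iota_et hiota s1; rewrite iota_first // s2 => -[e2].
have := energy_string n2 hiota hH s1; rewrite iota_first // energy_first => h2.
have [p [tp sp hp]] := lift_steps n2 hiota hH (bar_path_good _ _) (steps_bar_helt l ek).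
have := steps_bar_helt k el; rewrite (_ : k + Y' = l + Y); last by lia.
rewrite e2 => /(steps_fun sp) tq.
rewrite -(tword_inj n2 tp) (tword_inj n2 tq) hp h2; split=> //.
by move: r0 r1; move: (right0 _) (right0 _) => u v; lia.
Qed.

End Iota.

End HighestWeight.

(** The left side is the second row length plus [2z], with z = [minn t s]; the right side is the
    form compared in [hw_arith]. *)
Lemma min_core (l k a x1 x2 y t s : nat) : l = a + t -> k = s + (x1 + x2 + y) ->
  minn (minn x1.*2 (t - s + y.*2) + x2.*2 + y.*2 + (s - t)) (t - s + a.*2) + (minn t s).*2 =
  minn (minn (k.*2 - (s - t)) (l.*2 - (t - s))) (t + s + y.*2.*2 + x2.*2).
Proof. by move=> -> ->; case: (leqP t s) => ts; lia. Qed.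

(** * The Rule at highest weight elements *)

Section HighestWeightRule.
Variables (g : affine_type) (n l k : nat).
Hypothesis n2 : 2 <= n.
Variable iota : tensor (Bl g n l) (Bl g n k) -> tensor (Bl g n k) (Bl g n l).
Hypothesis hiota : crystal_iso iota.
Variable H : tensor (Bl g n l) (Bl g n k) -> int.
Hypothesis hH : energy_function iota H.
Hypothesis hH0 : H (b_first g n l, b_first_bar g n k) = 0%R.
Implicit Types (p : tensor (Bl g n l) (Bl g n k)).
Notation h_ l := (helt g n l).

Definition padded z (w : seq nat) : seq nat := nseq z n.*2.+1 ++ w ++ nseq z 0.

(** The Rule on words, with output given by [iota]. That 0 is absent from [t] or from [v] says that
    [z] is the minimum required by the Rule. *)
Definition rule_holds p : Prop := exists z t v r w m,
  [/\ bword p.1 = padded z t, bword p.2 = padded z v,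
      bword (iota p).1 = padded z r & bword (iota p).2 = padded z w] /\
  [/\ core_word n (size t) (size r) m (t ++ v) (r ++ w), (0 \notin t) || (0 \notin v)
    & H p = ((minn (size t) (size v))%:Z - m%:Z)%R].

Lemma iter_et0_single l' a : a <= l' ->
  iter (l' + a) (obind (et ord0)) (Some (h_ l' a 0 0)) = Some (h_ l' 0 0 l').
Proof.
move=> al; rewrite iter_et0_helt ?addn0 //; last by lia.
by congr (Some (helt _ _ _ _ _ _)); lia.
Qed.

Lemma bword_single l' a t z : l' = a + t -> z <= t ->
  bword (h_ l' a 0 0) =
  padded z (nseq (t - z) n.*2.+1 ++ nseq a.*2 1 ++ nseq (t - z) 0).
Proof.
move=> el zt; rewrite bword_helt ?addn0 //; last by lia.
have -> : l' - a = z + (t - z) by lia.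
by rewrite nseqD (addnC z (_ - z)) nseqD /padded /= -!catA.
Qed.

Lemma bword_double k' x1 x2 y s z : k' = s + (x1 + x2 + y) -> z <= s ->
  bword (h_ k' x1 x2 y) = padded z (nseq (s - z) n.*2.+1 ++ nseq y.*2 n.*2 ++
    nseq x2.*2 2 ++ nseq x1.*2 1 ++ nseq (s - z) 0).
Proof.
move=> ek zs; rewrite bword_helt; [|by []|lia].
have -> : k' - (x1 + x2 + y) = z + (s - z) by lia.
by rewrite nseqD (addnC z (_ - z)) nseqD /padded -!catA.
Qed.

Lemma right0_hw l' k' a x1 x2 y t s : l' = a + t -> k' = s + (x1 + x2 + y) ->
  right0 (h_ l' a 0 0, h_ k' x1 x2 y) = s + (x1 - y).*2 - t.
Proof.
move=> -> ->; rewrite /right0 eps0_helt ?leq_addl // phi0_helt ?addn0 ?leq_addr //.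
by clear; lia.
Qed.

Lemma rule_holds_hw a x1 x2 y : a <= l -> x1 + x2 + y <= k -> x2 + y <= a ->
  rule_holds (h_ l a 0 0, h_ k x1 x2 y).
Proof.
move=> al xk ya.
have [t elt] : exists t, l = a + t by exists (l - a); lia.
have [s es] : exists s, k = s + (x1 + x2 + y) by exists (k - (x1 + x2 + y)); lia.
have [c ec] : exists c, c = s + (x1 - y).*2 - t by eexists.
have [d ed] : exists d, d = minn c (x1 - y) by eexists.
have [X eX] : exists X, X = x1 - d by eexists.
have [Y eY] : exists Y, Y = y + (c - d) by eexists.
have [a' [x1' [y' [t' [s' [c' [d' [S]]]]]]]] := hw_arith elt es ya ec ed eX eY.
case=> -[ek' el' ec' ed'] [[eX' eY' eN ez eS] [eP eK eM eM']].
have i1 : iter c (obind (et ord0)) (Some (h_ k x1 x2 y)) = Some (h_ k X x2 Y).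
  have lc : c <= k - (x1 + x2 + y) + (x1 - y).*2 by clear -ec es; lia.
  by have := iter_et0_helt g n2 xk lc; rewrite /= -ed -eX -eY.
have xl : x1' + x2 + y' <= l by clear -el'; lia.
have i2 : iter c' (obind (et ord0)) (Some (h_ l x1' x2 y')) =
    Some (h_ l X x2 (y' + (c' - d'))).
  have lc : c' <= l - (x1' + x2 + y') + (x1' - y').*2 by clear -ec' el'; lia.
  by have := iter_et0_helt g n2 xl lc; rewrite /= -ed' eX' addnK.
have r1 : c = right0 (h_ l a 0 0, h_ k x1 x2 y) by rewrite (right0_hw elt es).
have r2 : c' = right0 (h_ k a' 0 0, h_ l x1' x2 y') by rewrite (right0_hw ek' el').
have j1 := tensor_et0 n2 r1 (iter_et0_single al) i1.
have a'k : a' <= k by rewrite ek' leq_addr.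
have j2 := tensor_et0 n2 r2 (iter_et0_single a'k) i2; rewrite -eN in j2.
have eSk : S + (X + x2 + Y) = k by rewrite eS.
have eSl : S + (X + x2 + (y' + (c' - d'))) = l by clear -eS eY'; lia.
have [b1 hb] := iota_bar n2 hiota hH hH0 eSk eSl.
have := iter_iota_et hiota j1; rewrite b1 => j3.
(* Both e_0-strings have length l + a + c and end at the same element, so they start at the same
   one. *)
have iE := et_inj n2 j3 j2.
have := energy_string n2 hiota hH j1; rewrite iE -r1 -r2 hb => he.
(* In terms of [core_word_hw]: p = t - s and q = s - t, one of which is 0 by truncation, A = 2a, X1
   = 2x1, X2 = 2x2, Y = 2y. The last witness is its [minn K (p + A)]. *)
exists (minn t s), (nseq (t - minn t s) n.*2.+1 ++ nseq a.*2 1 ++ nseq (t - minn t s) 0),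
  (nseq (s - minn t s) n.*2.+1 ++ nseq y.*2 n.*2 ++ nseq x2.*2 2 ++ nseq x1.*2 1 ++
    nseq (s - minn t s) 0),
  (nseq (t' - minn t s) n.*2.+1 ++ nseq a'.*2 1 ++ nseq (t' - minn t s) 0),
  (nseq (s' - minn t s) n.*2.+1 ++ nseq y'.*2 n.*2 ++ nseq x2.*2 2 ++ nseq x1'.*2 1 ++
    nseq (s' - minn t s) 0),
  (minn (minn x1.*2 (t - s + y.*2) + x2.*2 + y.*2 + (s - t)) (t - s + a.*2)).
have m1 := min_core elt es; have m2 := min_core ek' el'.
split.
  rewrite iE; split.
  - by apply: bword_single => //; exact: geq_minl.
  - by apply: bword_double => //; exact: geq_minr.
  - by apply: bword_single => //; rewrite ez geq_minl.
  - by apply: bword_double => //; rewrite ez geq_minr.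
have tsE : t - minn t s = t - s by clear; lia.
have stE : s - minn t s = s - t by clear; lia.
have tsE' : t' - minn t s = t' - s' by rewrite ez; clear; lia.
have stE' : s' - minn t s = s' - t' by rewrite ez; clear; lia.
rewrite tsE stE tsE' stE'.
have eMM : minn (minn x1.*2 (t - s + y.*2) + x2.*2 + y.*2 + (s - t)) (t - s + a.*2) =
    minn (minn x1'.*2 (t' - s' + y'.*2) + x2.*2 + y'.*2 + (s' - t')) (t' - s' + a'.*2).
  rewrite -m1 in eM; rewrite -m2 -ez in eM'; move: eM eM'.
  by clear; move: (minn (_ + (s - t)) _) (minn (_ + (s' - t')) _) => M M'; lia.
have eKK : minn x1.*2 (t - s + y.*2) + x2.*2 + y.*2 + (s - t) + (t - s) =
    minn x1'.*2 (t' - s' + y'.*2) + x2.*2 + y'.*2 + (s' - t') + (t' - s').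
  rewrite eK; have distE u v : u - v + (v - u) + (minn u v).*2 = u + v by clear; lia.
  by move: (distE s t) (distE s' t') ez eP; rewrite ![minn s _]minnC ![minn s' _]minnC;
    clear; move: (s - t) (s' - t') (t - s) (t' - s') (minn t s) (minn t' s') (minn x1'.*2 _)
      => *; lia.
have pq : (t - s == 0) || (s - t == 0) by clear; lia.
have pq' : (t' - s' == 0) || (s' - t' == 0) by clear; lia.
split.
- rewrite !size_cat !size_nseq.
  have eA : t - s + (a.*2 + (t - s)) = (t - s).*2 + a.*2 by clear; lia.
  have eA' : t' - s' + (a'.*2 + (t' - s')) = (t' - s').*2 + a'.*2 by clear; lia.
  rewrite eA eA'; apply: (core_word_hw (ltnW n2) n2 pq pq').
  + by clear -el' elt ez; lia.
  + by clear -es ek' ez; lia.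
  + by clear -eP ez; lia.
  + by clear -eP eK ez el' elt es ek'; lia.
  + by move: eMM eKK; clear; move: (_ + (s - t)) (_ + (s' - t')) => K K'; lia.
  + exact: eMM.
- rewrite !mem_cat !mem_nseq /=.
  have -> : (0 == n.*2) = false by rewrite eq_sym double_eq0; case: (n) n2.
  by case/orP: pq => /eqP ->; rewrite ?andbF ?orbT.
rewrite !size_cat !size_nseq.
have zt : (minn (t - s + (a.*2 + (t - s)))
    (s - t + (y.*2 + (x2.*2 + (x1.*2 + (s - t))))) + (minn t s).*2 = (minn l k).*2)%N.
  by clear -elt es; lia.
have c'A : c' <= l + a + c by rewrite eN leq_addl.
have cA : l + a + c - maxn c c' = l + a + minn c c' - c' by clear -c'A; lia.
have mA : minn (l + a + c) (minn c c') = minn c c' by clear; lia.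
have mc : c' <= l + a + minn c c' by clear -c'A; lia.
move: he m1 eM zt mc; rewrite cA mA; clear.
move: (minn (_ + (s - t)) _) (minn (t - s + _) _) (minn (minn (k.*2 - _) _) _).
move: (minn l k) (minn t s) (minn c c') (H _) => M1 M2 M3 h M4 M5 M6; lia.
Qed.

End HighestWeightRule.

(** * Propagation and conclusion *)

Section Padding.
Variable n : nat.
Notation pw j := (phw (phn n j) (epn n j)).
Notation ew j := (epw (phn n j) (epn n j)).
Notation fs j := (fw (phn n j) (epn n j) succn).

Lemma padded_pw z j w : 0 < j <= n ->
  pw j (padded n z w) = pw j w /\ ew j (padded n z w) = ew j w.
Proof.
case/andP=> j0 jn; have p0 : phn n j 0 = false by rewrite /phn; lia.
have pN : phn n j n.*2.+1 = false by rewrite /phn; lia.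
have e0 : epn n j 0 = false by rewrite /epn; lia.
have eN : epn n j n.*2.+1 = false by rewrite /epn; lia.
rewrite /padded !phw_cat !epw_cat !pw_nseq // !ew_nseq // p0 pN e0 eN.
by split; lia.
Qed.

Lemma padded_iter z j w m : 0 < j <= n -> m <= pw j w ->
  iter m (fs j) (padded n z w) = padded n z (iter m (fs j) w).
Proof.
move=> jn le; have [pe ee] := padded_pw z w jn.
case/andP: (jn) => j0 jn'; have p0 : phn n j 0 = false by rewrite /phn; lia.
have pN : phn n j n.*2.+1 = false by rewrite /phn; lia.
have e0 : epn n j 0 = false by rewrite /epn; lia.
apply: (@iter_fs_cat n j jn' 0).
- by rewrite -/(padded n z w) pe.
- by rewrite pw_nseq // pN; lia.
- by [].
rewrite subn0; have le' : m <= pw j (w ++ nseq z 0).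
  by rewrite phw_cat pw_nseq // ew_nseq // p0 e0; lia.
apply: (@iter_fs_cat n j jn' m) => //; first by rewrite ew_nseq // e0; lia.
by rewrite subnn.
Qed.

(** A lowered letter is a successor, so 0 never appears and [z] stays minimal. *)
Lemma iter_fs_notin0 j m w : 0 \notin w -> 0 \notin iter m (fs j) w.
Proof.
have fs0 u : 0 \notin u -> 0 \notin fs j u.
  elim: u => //= a u IH; rewrite inE negb_or => /andP[a0 nu].
  by case: ifP => _; rewrite inE negb_or /= ?a0 ?nu ?IH.
by elim: m => //= m IH /IH; apply: fs0.
Qed.

End Padding.

Section Propagation.
Variables (g : affine_type) (n : nat).
Hypothesis n2 : 2 <= n.
Notation pw j := (phw (phn n j) (epn n j)).
Notation ew j := (epw (phn n j) (epn n j)).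
Notation fs j := (fw (phn n j) (epn n j) succn).

Lemma padded_ft l k (p p' : tensor (Bl g n l) (Bl g n k)) (i : 'I_n.+1) z t v :
  0 < i -> ft i p = Some p' ->
  bword p.1 = padded n z t -> bword p.2 = padded n z v ->
  kappa g n i <= pw i (t ++ v) /\ exists t' v',
  [/\ bword p'.1 = padded n z t', bword p'.2 = padded n z v',
      size t' = size t /\ size v' = size v,
      t' ++ v' = iter (kappa g n i) (fs i) (t ++ v)
    & (0 \notin t) || (0 \notin v) -> (0 \notin t') || (0 \notin v')].
Proof.
move=> i0 E et ev; have [le e] := tword_ft n2 i0 E.
have ni : 0 < i <= n by rewrite i0 ord_leq.
have [pt et'] := padded_pw z t ni; have [pv ev'] := padded_pw z v ni.
have E1 : pw i (t ++ v) = pw i (tword p) by rewrite /tword et ev phw_cat [RHS]phw_cat pt pv ev'.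
rewrite E1; set q := kappa g n i in le *; set q1 := minn q (pw i t - ew i v).
have le1 : q1 <= pw i t by rewrite /q1; lia.
have le2 : q - q1 <= pw i v.
  by move: le; rewrite -E1 phw_cat /q1; lia.
have Ep := padded_iter z ni le1; have Eq := padded_iter z ni le2.
have sz : size (padded n z (iter q1 (fs i) t)) = size (bword p'.1).
  by rewrite size_bword // -(size_bword n2 p.1) et /padded !size_cat size_iter_fw.
have [|b1 b2] := cat_inj sz (y := padded n z (iter (q - q1) (fs i) v)) (y' := bword p'.2).
  rewrite -/(tword p') -e /tword et ev.
  by rewrite (@iter_fs_cat n i (ord_leq i) q1 _ _ _ _ _ _ _ Ep Eq) ?pt ?ev' -?et -?ev.
split=> //; exists (iter q1 (fs i) t), (iter (q - q1) (fs i) v).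
rewrite -b1 -b2 !size_iter_fw; split=> //.
  by rewrite (@iter_fs_cat n i (ord_leq i) q1 q t v _ _ _ _ erefl erefl) ?E1.
by case/orP=> /(@iter_fs_notin0 n i) h; rewrite h ?orbT.
Qed.

Variables l k : nat.
Variable iota : tensor (Bl g n l) (Bl g n k) -> tensor (Bl g n k) (Bl g n l).
Hypothesis hiota : crystal_iso iota.
Variable H : tensor (Bl g n l) (Bl g n k) -> int.
Hypothesis hH : energy_function iota H.
Hypothesis hH0 : H (b_first g n l, b_first_bar g n k) = 0%R.
Implicit Types (p : tensor (Bl g n l) (Bl g n k)) (i : 'I_n.+1).

Lemma rule_holds_ft i p p' : 0 < i -> ft i p = Some p' ->
  rule_holds iota H p -> rule_holds iota H p'.
Proof.
move=> i0 E [z [t [v [r [w [m [[b1 b2 c1 c2] [cw nz hp]]]]]]]].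
have [le [t' [v' [b1' b2' [st sv] e1 nz']]]] := padded_ft i0 E b1 b2.
have [_ [r' [w' [c1' c2' [sr _] e2 _]]]] := padded_ft i0 (iota_ft hiota E) c1 c2.
exists z, t', v', r', w', m; split; first by split.
split; last by rewrite (energy_ft n2 hH i0 E) st sv.
  by rewrite st sr e1 e2; apply: core_word_iter (ord_leq i) cw le.
exact: nz'.
Qed.

Lemma sumn_iter_fs j m u : j <= n -> m <= pw j u -> sumn (iter m (fs j) u) = sumn u + m.
Proof.
move=> jn; have fsS w : 0 < pw j w -> sumn (fs j w) = (sumn w).+1.
  elim: w => //= a w IH p0; case: ifP => h /=; first by lia.
  by rewrite IH; lia.
elim: m => /= [|m IH] le; first by rewrite addn0.
rewrite fsS ?IH ?addnS ?(ltnW le) //.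
by rewrite phw_iter ?subn_gt0 ?(ltnW le) //; [exact: phn_epn|exact: phn_succ|exact: epn_succ].
Qed.

(** Induction on the sum of the letters, which f_i raises by [kappa]: going up by the e_i with i > 0
    ends at a highest weight element. *)
Lemma rule_holds_all p : rule_holds iota H p.
Proof.
have [d] := ubnP (sumn (tword p)); elim: d p => // d IH p.
rewrite ltnS => le.
case: (pickP (fun i : 'I_n.+1 => (0 < i) && isSome (et i p))) => [i /andP[i0]|hw].
  case E: (et i p) => [p'|] // _; have F := tensor_et_ft n2 E.
  apply: (rule_holds_ft i0 F); apply: IH; have [le' e] := tword_ft n2 i0 F.
  by have := sumn_iter_fs (ord_leq i) le'; rewrite e; have := kappa_gt0 g n i; lia.
have [|a [x1 [x2 [y [al xk ya ->]]]]] := @hw_shape g n n2 l k p.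
  by move=> i i0; case E: (et i p) => [q|] //; move: (hw i); rewrite E i0.
exact: (rule_holds_hw n2 hiota hH hH0).
Qed.

End Propagation.

(** * From padded words back to rows *)

Section Rows.
Variable n : nat.
Implicit Types (t v : seq (letter n)).

(** [rem] deletes the first occurrence, which may lie in [u]. The results still agree, being sorted
    with the same content. *)
Lemma iter_rem_sorted (T : eqType) (e : rel T) (u v : seq T) a z :
  transitive e -> antisymmetric e -> sorted e (u ++ nseq z a ++ v) ->
  iter z (rem a) (u ++ nseq z a ++ v) = u ++ v.
Proof.
move=> tr anti; elim: z => //= z IH so.
have sub : subseq (rem a (u ++ a :: nseq z a ++ v)) (u ++ a :: nseq z a ++ v).
  exact: rem_subseq.
have sub' : subseq (u ++ nseq z a ++ v) (u ++ a :: nseq z a ++ v).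
  by rewrite subseq_cat2l subseq_cons.
have so' := subseq_sorted tr sub' so.
rewrite -iterS iterSr (_ : rem a _ = u ++ nseq z a ++ v) ?IH //.
apply: (sorted_eq tr anti (subseq_sorted tr sub so) so').
have aX : a \in u ++ a :: nseq z a ++ v by rewrite mem_cat inE eqxx orbT.
rewrite -(perm_cons a) -(permPl (perm_to_rem aX)) -[_ :: _ ++ _]cat1s.
by rewrite perm_catCA.
Qed.

Lemma pairwise_blocks C (s : seq nat) : pairwise leq s -> pairwise leq (blocks C s).
Proof.
have sub (r : seq nat) x : x \in blocks C r -> x \in r.
  by case/flatten_mapP=> b br; rewrite mem_nseq => /andP[_ /eqP ->].
elim: s => // a s IH /andP[/allP las /IH h]; rewrite -cat1s blocks_cat blocks1 pairwise_cat h andbT.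
apply/andP; split; last by elim: (C a) => //= m ->; rewrite all_nseq leqnn orbT.
apply/allrelP => x y; rewrite mem_nseq => /andP[_ /eqP ->] /sub; exact: las.
Qed.

Lemma sorted_row_word L (c : Cset n L) : sorted (relpre val leq) (row_word c).
Proof.
rewrite -sorted_map -(revK (row_word c)) map_rev word_of_row_word.
rewrite /word_of /count_word -rev_blocks revK.
rewrite sorted_pairwise; last exact: leq_trans.
apply: pairwise_blocks; rewrite -sorted_pairwise; last exact: leq_trans.
exact: iota_sorted.
Qed.

Lemma remove0_pad0 L (c : Cset n L) z t : row_word c = pad0 z t ->
  remove0 z (row_word c) = t.
Proof.
have tr : transitive (relpre (val : letter n -> nat) leq).
  by move=> x y w; apply: leq_trans.
have an : antisymmetric (relpre (val : letter n -> nat) leq).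
  by move=> x y /= h; apply: val_inj; apply/eqP; rewrite eqn_leq.
move=> e; have := sorted_row_word c; rewrite /remove0 e /pad0 => so.
have := @iter_rem_sorted _ _ (nseq z (ub n 0) ++ t) [::] (br n 0) z tr an.
rewrite !cats0 -catA => -> //.
apply: (@iter_rem_sorted _ _ [::] t (ub n 0) z tr an).
by move: so; rewrite catA => /cat_sorted2[].
Qed.

Lemma padded_pad0 (L z : nat) (c : Cset n L) t :
  word_of L (val c) = padded n z (map val (rev t)) -> row_word c = pad0 z t.
Proof.
rewrite -word_of_row_word => E; apply: (can_inj (@revK _)); apply: (inj_map val_inj); rewrite E.
rewrite /padded /pad0 !rev_cat !rev_nseq !map_cat !map_nseq -catA.
congr (nseq _ _ ++ _ ++ nseq _ _); last by rewrite [RHS]val_ub.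
by rewrite [RHS]val_br // subn0.
Qed.

Lemma count0_pad0 z t : count0 (pad0 z t) = z + count_mem (ub n 0) t.
Proof.
rewrite /count0 /pad0 !count_cat !count_nseq /= eqxx mul1n.
suff -> : (br n 0 == ub n 0) = false by rewrite mul0n addn0.
by rewrite -val_eqE [val _]val_br // [val _]val_ub.
Qed.

Lemma mem0_rev t : 0 \notin map val (rev t) -> count_mem (ub n 0) t = 0.
Proof.
move=> h; apply/count_memPn; apply: contra h => h.
by apply/mapP; exists (ub n 0); rewrite ?mem_rev // [RHS]val_ub.
Qed.

End Rows.

Section RuleHolds.
Variables (g : affine_type) (n l k : nat).
Hypothesis n2 : 2 <= n.
Variable iota : tensor (Bl g n l) (Bl g n k) -> tensor (Bl g n k) (Bl g n l).
Variable H : tensor (Bl g n l) (Bl g n k) -> int.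

Lemma rule_of_rule_holds b1 b2 : rule_holds iota H (b1, b2) ->
  exists l' k' m,
    Rule (omega b1) (omega b2) (omega (iota (b1, b2)).1) (omega (iota (b1, b2)).2)
      l' k' m /\
    H (b1, b2) = ((minn l' k')%:Z - m%:Z)%R.
Proof.
case=> z [t [v [r [w [m [[e1 e2 e3 e4] [cw nz hp]]]]]]].
have [st sv] : size t = 2 * l - 2 * z /\ size v = 2 * k - 2 * z.
  have := size_bword n2 b1; have := size_bword n2 b2; rewrite e1 e2.
  by rewrite /padded !size_cat !size_nseq; lia.
case: cw => tl [vl [rl [wl [cr s1 s2 c1 c2]]]].
have [et ev] : t = map val (rev tl) /\ v = map val (rev vl).
  by apply: cat_inj; rewrite -?map_cat // size_map size_rev s1.
have [er ew] : r = map val (rev rl) /\ w = map val (rev wl).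
  by apply: cat_inj; rewrite -?map_cat // size_map size_rev s2.
subst t v r w; move/padded_pad0: e1 => e1; move/padded_pad0: e2 => e2.
move/padded_pad0: e3 => e3; move/padded_pad0: e4 => e4.
have ez : minn (count0 (row_word (omega b1))) (count0 (row_word (omega b2))) = z.
  by rewrite e1 e2 !count0_pad0; case/orP: nz => /mem0_rev ->; lia.
exists (2 * l - 2 * z), (2 * k - 2 * z), m; split; last by rewrite -st -sv.
case: cr => T0 [i1 i2 i3]; rewrite /Rule ez; split=> //.
exists T0, wl, rl; rewrite (remove0_pad0 e1) (remove0_pad0 e2) -st -s1.
by split.
Qed.
End RuleHolds.

Lemma Rule_det n L K (c1 : Cset n L) (c2 : Cset n K) d2 d1 l1 k1 m1 d2' d1' l2 k2 m2 :
  Rule c1 c2 d2 d1 l1 k1 m1 -> Rule c1 c2 d2' d1' l2 k2 m2 ->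
  [/\ d2 = d2', d1 = d1', l1 = l2, k1 = k2 & m1 = m2].
Proof.
rewrite /Rule; case=> -> -> [T [w [r [h1 -> h3 h4 h5]]]].
case=> -> -> [T' [w' [r' [h1' -> h3' h4' h5']]]].
have ET := insert_word_det h1 h1'; subst T'.
have [Er Ew] := inv_inserts_det h3 h3'.
have {}Er : r = r' by apply: inj_map Er => a b [].
by split=> //; apply: row_word_inj; rewrite ?h4 ?h4' ?h5 ?h5' ?Er ?Ew.
Qed.

Theorem theorem3p11 (g : affine_type) (n l k : nat)
    (hn : 2 <= n) (hl : 1 <= l) (hk : 1 <= k)
    (iota : tensor (Bl g n l) (Bl g n k) -> tensor (Bl g n k) (Bl g n l))
    (hiota : crystal_iso iota)
    (H : tensor (Bl g n l) (Bl g n k) -> int)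
    (hH : energy_function iota H)
    (hH0 : H (b_first g n l, b_first_bar g n k) = 0%R)
    (b1 : Bl g n l) (b2 : Bl g n k) :
  (exists (c2 : Cset n (2 * k)) (c1 : Cset n (2 * l)) (l' k' m : nat),
      Rule (omega b1) (omega b2) c2 c1 l' k' m)
  /\
  forall (c2 : Cset n (2 * k)) (c1 : Cset n (2 * l)) (l' k' m : nat),
    Rule (omega b1) (omega b2) c2 c1 l' k' m ->
    (exists2 q : tensor (Bl g n k) (Bl g n l),
        omega2 q = (c2, c1) & iota (b1, b2) = q)
    /\ H (b1, b2) = ((minn l' k')%:Z - m%:Z)%R.
Proof.
have [l0 [k0 [m0 [R0 HE]]]] :=
  rule_of_rule_holds hn (rule_holds_all hn hiota hH hH0 (b1, b2)).
split; first by do 5!eexists; exact: R0.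
(* The output found above is the only one, by [Rule_det]. *)
move=> c2 c1 l' k' m R; have [<- <- <- <- <-] := Rule_det R0 R.
by split=> //; exists (iota (b1, b2)).
Qed.
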